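(* Let $\beta\in(0,1/2]$ and $\alpha\in(0,1)$, write $\bar\beta=1-\beta$ and $\bar\alpha=1-\alpha$, and let $W$ be the root runoff on the critical Bienaymé–Galton–Watson tree with parameter $\beta$ and point contributions of parameter $\alpha$ (as defined in the context). Put $\alpha_c=\tfrac12\left(1+\beta\bar\beta-\sqrt{\beta\bar\beta(2+\beta\bar\beta)}\right)$ and $$h(t)=\frac{t\left[1-\alpha(4\beta\bar\beta+t)-\alpha^2(1-2\beta)^2(1-t^2)\right]}{4\bar\alpha\beta^2\bar\beta^2(1-\alpha(1-t^2))},$$ and let $t_0$ be the point at which $h$ achieves its maximum in $[0,1]$. Then, as $x\to\infty$, $$\mathbb{P}(W>x)\sim\begin{cases}\sqrt{\dfrac{-h''(1)(1-\alpha)}{8\pi}}\;x^{-3/2}, & \alpha=\alpha_c,\\[2ex]\sqrt{\dfrac{(h(t_0)-h(1))(1-\alpha)}{\pi}}\;x^{-1/2}, & \alpha>\alpha_c.\end{cases}$$ For $\alpha<\alpha_c$, $W$ has all positive moments finite.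
   Context: Runoff model. Consider a Bienaymé–Galton–Watson tree with root $0$ in which nodes have i.i.d. offspring numbers $Z$ with $\mathbb{P}(Z=0)=\mathbb{P}(Z=2)=\beta\bar\beta$ and $\mathbb{P}(Z=1)=\beta^2+\bar\beta^2$, where $\bar\beta=1-\beta$. (The offspring distribution has mean $1$, so the tree is almost surely finite.) Independently of the tree, attach to the nodes i.i.d. random variables $X_i$ with $\mathbb{P}(X_i=1)=\alpha$ and $\mathbb{P}(X_i=-1)=1-\alpha$. Define the runoff $W_i$ from node $i$ recursively, from the leaves towards the root, by $$W_i=\max\Big(X_i+\sum_{j:\,j\to i}W_j,\;0\Big),$$ where $j\to i$ means that $j$ is a child of $i$ (so $W_i=\max(X_i,0)$ at a leaf). Let $W=W_0$ be the runoff at the root. Equivalently, the law of $W$ satisfies $W\overset{d}{=}\max(W_LI_L+W_RI_R+X,0)$, where $W_L,W_R$ are distributed as $W$, $I_L\sim\mathrm{Bernoulli}(1-\beta)$, $I_R\sim\mathrm{Bernoulli}(\beta)$, $X$ is distributed as the $X_i$, and $W_L,W_R,I_L,I_R,X$ are independent. The notation $a(x)\sim b(x)$ means $a(x)/b(x)\to1$. The function $h$ has a unique maximum point on $[0,1]$, so $t_0$ is well defined. *)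

(* Defs.v *)
From HB Require Import structures.
From mathcomp Require Import all_boot all_order all_algebra.
From mathcomp Require Import all_classical all_reals all_analysis.
Set Implicit Arguments.
Unset Strict Implicit.
Unset Printing Implicit Defensive.
Import Order.TTheory GRing.Theory Num.Theory.
Import numFieldNormedType.Exports.
Local Open Scope classical_set_scope.
Local Open Scope ring_scope.

(* Ulam-Harris labels: the root is [::] and the children of u are rcons u j. *)
Definition node : Type := seq nat.

(* Mutual independence of a family of classes of events. *)
Definition mutually_independent d (T : measurableType d) (R : realType)
    (P : probability T R) (I : choiceType) (F : I -> set (set T)) : Prop :=
  forall (s : seq I) (A : I -> set T), uniq s ->
    (forall i, i \in s -> F i (A i)) ->
    (P (\bigcap_(i in [set` s]) A i) = \prod_(i <- s) P (A i))%E.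

Definition sigma_of d d' (T : measurableType d) (E : measurableType d')
    (Y : T -> E) : set (set T) :=
  preimage_set_system [set: T] Y measurable.

(* Z u is the offspring number and X u the contribution of the label u. Both
   are given for every label; only those of nodes of the tree matter. *)
Record runoff_environment d (T : measurableType d) (R : realType)
    (P : probability T R) (beta alpha : R)
    (Z : node -> {RV P >-> nat}) (X : node -> {RV P >-> R}) : Prop := {
  offspring_eq0 : forall u,
    P [set w | Z u w = 0%N] = (beta * (1 - beta))%:E ;
  offspring_eq1 : forall u,
    P [set w | Z u w = 1%N] = (beta ^+ 2 + (1 - beta) ^+ 2)%:E ;
  offspring_eq2 : forall u,
    P [set w | Z u w = 2%N] = (beta * (1 - beta))%:E ;
  contribution_eq1 : forall u, P [set w | X u w = 1] = alpha%:E ;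
  contribution_eqN1 : forall u, P [set w | X u w = - 1] = (1 - alpha)%:E ;
  environment_independent :
    mutually_independent P (fun i : (node + node)%type =>
      match i with
      | inl u => sigma_of (Z u)
      | inr u => sigma_of (X u)
      end)
}.

(* The label u belongs to the tree with offspring numbers z. *)
Definition in_tree (z : node -> nat) (u : node) : Prop :=
  forall (v : node) (j : nat), prefix (rcons v j) u -> (j < z v)%N.

(* On a finite tree, this recursion determines W at every node of the tree. *)
Definition is_runoff (R : realType) (z : node -> nat) (x W : node -> R) : Prop :=
  forall u, in_tree z u ->
    W u = Num.max (x u + \sum_(j < z u) W (rcons u j)) 0.

Definition alpha_c (R : realType) (beta : R) : R :=
  let b := beta * (1 - beta) in
  2^-1 * (1 + b - Num.sqrt (b * (2 + b))).

Definition h (R : realType) (beta alpha t : R) : R :=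
  t * (1 - alpha * (4 * beta * (1 - beta) + t)
         - alpha ^+ 2 * (1 - 2 * beta) ^+ 2 * (1 - t ^+ 2))
  / (4 * (1 - alpha) * beta ^+ 2 * (1 - beta) ^+ 2
       * (1 - alpha * (1 - t ^+ 2))).

Definition asymp_equiv (R : realType) (a b : R -> R) : Prop :=
  a x / b x @[x --> +oo] --> (1 : R).

(* Main.v *)
(* The code of a node at depth n records whether its subtree is extinct within n
   generations and, if so, its runoff; the laws of these codes satisfy an explicit
   recursion. As the tree is almost surely finite, letting n tend to infinity
   shows that the generating function y of the tails P(W > m) solves a quadratic
   equation on [0, 1) whose coefficients involve one unknown constant c. The
   discriminant is a positive multiple of C - h, with C determined by c; it is
   nonnegative, and its infimum is zero, as otherwise the smaller root would be
   selected on all of [0, 1), and that root is negative near 1. Hence C = max h,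
   which determines c. Solving for y, its behaviour at 1 is of order
   (1 - t)^(-1/2) if h(t0) > h(1), has a (1 - t)^(1/2) term if alpha is critical,
   and is smooth if alpha is smaller, where all moments are therefore finite. In
   the two other cases the tails follow from Karamata's Tauberian theorem and the
   monotonicity of P(W > m), by comparison with the explicit coefficients
   C(2n, n) / 4^n of (1 - t)^(-1/2). *)
Require Import Defs.
From HB Require Import structures.
From mathcomp Require Import all_boot all_order all_algebra.
From mathcomp Require Import all_classical all_reals all_analysis.
From mathcomp Require Import measurable_realfun.
From mathcomp Require Import ring lra zify.
Set Implicit Arguments.
Unset Strict Implicit.
Unset Printing Implicit Defensive.
Import Order.TTheory GRing.Theory Num.Theory.
Import numFieldNormedType.Exports.
Local Open Scope classical_set_scope.
Local Open Scope ring_scope.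

(** * Power series on [0, 1) *)

(** The hypotheses give a family [W] solving the recursion along the tree; they do not give the
    independence of the runoffs of siblings, and on an infinite tree the recursion does not
    determine [W]. The codes avoid both obstacles: they are explicit functions of finitely many
    labels, so the independence of the environment yields their laws, and a nonzero code forces the
    value of every solution. The price is the probability of the code 0 at depth n, at most 1/(1 +
    bn) with b = beta (1 - beta). The quadratic is one for u = (1 - t) y(t) = 1 - E t^W; the unknown
    constant comes from the value of E t^W at 0, through the truncation at 0 in the recursion. At t
    = 0 the root in force is the smaller one, and by continuity it can only change where the
    discriminant vanishes. The Tauberian argument treats the difference of the tails and an explicit
    sequence, so that it only has to show that partial sums are o(sqrt N). The order 3/2 is reduced
    to the order 1/2 by passing to the remainders of the series and differencing back by
    monotonicity. *)

Record has_sum (R : realType) (f : nat -> R) (l : R) : Prop :=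
  HasSum { has_sum_cvg : series f @ \oo --> l }.

Definition gen_fun (R : realType) (a : nat -> R) (y : R -> R) : Prop :=
  forall t : R, 0 <= t < 1 -> has_sum (fun n => a n * t ^+ n) (y t).

Lemma seriesX (R : realType) (f : nat -> R) n :
  series f n = \sum_(k < n) f k.
Proof. by rewrite /series /= big_mkord. Qed.

Lemma eq_has_sum (R : realType) (f g : nat -> R) l :
  has_sum f l -> f =1 g -> has_sum g l.
Proof. by move=> fl /funext <-. Qed.

Lemma has_sum_unique (R : realType) (f : nat -> R) l m :
  has_sum f l -> has_sum f m -> l = m.
Proof. by move=> [/cvg_lim fl] [/cvg_lim fm]; rewrite -fl ?fm. Qed.

Lemma has_sum0 (R : realType) : has_sum (fun _ : nat => 0 : R) 0.
Proof.
split; rewrite (_ : series _ = fun=> 0); first exact: cvg_cst.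
by apply/funext => n; rewrite seriesX big1.
Qed.

Lemma has_sumD (R : realType) (f g : nat -> R) l m :
  has_sum f l -> has_sum g m -> has_sum (fun n => f n + g n) (l + m).
Proof.
move=> [fl] [gm]; split.
rewrite (_ : series _ = series f \+ series g); first exact: cvgD.
by apply/funext => n; rewrite /= !seriesX big_split.
Qed.

Lemma has_sumZ (R : realType) (c : R) (f : nat -> R) l :
  has_sum f l -> has_sum (fun n => c * f n) (c * l).
Proof.
move=> [fl]; split.
rewrite (_ : series _ = fun n => c * series f n); first exact: cvgMr.
by apply/funext => n; rewrite /= !seriesX big_distrr.
Qed.

Lemma has_sumB (R : realType) (f g : nat -> R) l m :
  has_sum f l -> has_sum g m -> has_sum (fun n => f n - g n) (l - m).
Proof.
move=> fl gm; rewrite -mulN1r.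
apply: (eq_has_sum (has_sumD fl (has_sumZ (-1) gm))) => n.
by rewrite mulN1r.
Qed.

Lemma has_sum_sum (R : realType) (I : Type) (r : seq I) (f : I -> nat -> R) l :
  (forall i, has_sum (f i) (l i)) ->
  has_sum (fun n => \sum_(i <- r) f i n) (\sum_(i <- r) l i).
Proof.
move=> fl; elim: r => [|i r IH].
  by rewrite big_nil; apply: (eq_has_sum (has_sum0 R)) => n; rewrite big_nil.
rewrite big_cons; apply: (eq_has_sum (has_sumD (fl i) IH)) => n.
by rewrite big_cons.
Qed.

Lemma has_sum_le (R : realType) (f : nat -> R) l (M : R) :
  has_sum f l -> (forall n, \sum_(k < n) f k <= M) -> l <= M.
Proof.
move=> [fl] le; rewrite -(cvg_lim _ fl)//; apply: limr_le.
  by apply/cvg_ex; exists l.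
by near=> n; rewrite seriesX.
Unshelve. all: by end_near. Qed.

Lemma has_sum_ge (R : realType) (f : nat -> R) l (m : nat) :
  has_sum f l -> (forall n, (m <= n)%N -> 0 <= f n) -> \sum_(k < m) f k <= l.
Proof.
move=> [fl] f0; rewrite -(cvg_lim _ fl)//; apply: limr_ge.
  by apply/cvg_ex; exists l.
near=> n; rewrite seriesX.
have mn : (m <= n)%N by near: n; exact: nbhs_infty_ge.
rewrite -(subnKC mn) big_split_ord/= lerDl sumr_ge0// => i _.
by exact: f0 (leq_addr _ _).
Unshelve. all: by end_near. Qed.

Lemma has_sum_ge0 (R : realType) (f : nat -> R) l :
  has_sum f l -> (forall n, 0 <= f n) -> 0 <= l.
Proof. by move=> fl f0; have := @has_sum_ge _ _ _ 0 fl (fun n _ => f0 n); rewrite big_ord0. Qed.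

Lemma ler_has_sum (R : realType) (f g : nat -> R) l m :
  has_sum f l -> has_sum g m -> (forall n, f n <= g n) -> l <= m.
Proof.
move=> fl gm fg; rewrite -subr_ge0.
by apply: (has_sum_ge0 (has_sumB gm fl)) => n; rewrite subr_ge0.
Qed.

Lemma cvg_left1P (R : realType) (f : R -> R) l :
  f t @[t --> 1^'-] --> l <->
  forall e : R, 0 < e -> exists2 t0 : R, t0 < 1 & forall t, t0 < t < 1 -> `|f t - l| < e.
Proof.
split.
  move=> /cvgrPdist_lt fl e e0; have := fl e e0.
  rewrite /at_left => -[d /= d0 H]; exists (1 - d); first by rewrite ltrBlDr ltrDl.
  move=> t /andP[t1 t2]; rewrite distrC; apply: H => //=.
  by rewrite ger0_norm; lra.
move=> H; apply/cvgrPdist_lt => e e0; have [t0 t01 {}H] := H e e0.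
near=> t; rewrite distrC; apply: H; apply/andP; split.
  by near: t; exact: nbhs_left_gt.
by near: t; exact: nbhs_left_lt.
Unshelve. all: by end_near. Qed.

Lemma cvg0_le (R : realType) (T : Type) (F : set_system T) (FF : Filter F)
    (f g : T -> R) :
  (\forall x \near F, `|f x| <= g x) -> g @ F --> 0 -> f @ F --> 0.
Proof.
move=> fg g0; apply: (@squeeze_cvgr _ _ FF _ (fun x => - g x) g) => //.
  by apply: filterS fg => x; rewrite ler_norml.
by rewrite -oppr0; apply: cvgN.
Qed.

(* Abel summation. *)
Lemma sum_tails (R : realType) (a r : nat -> R) (L t : R) N :
  (forall n, r n = L - \sum_(k < n.+1) a k) ->
  (1 - t) * (\sum_(k < N) r k * t ^+ k) =
  L - \sum_(k < N) a k * t ^+ k - (L - \sum_(k < N) a k) * t ^+ N.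
Proof.
move=> rE; elim: N => [|N IH]; first by rewrite !big_ord0 expr0; ring.
rewrite !big_ord_recr /= mulrDr IH rE big_ord_recr /= exprS; ring.
Qed.

(** The boundary term of Abel summation is [r] times a power of t, and boundedness of [r] makes it
    vanish. For the empty sum it is L itself, whence the constant M + |L| in the proof. *)
Lemma tails_gen_fun (R : realType) (a r : nat -> R) (L : R) (y : R -> R) (M : R) :
  gen_fun a y -> (forall n, r n = L - \sum_(k < n.+1) a k) ->
  (forall n, `|r n| <= M) -> gen_fun r (fun t => (L - y t) / (1 - t)).
Proof.
move=> ay rE rM t t01; have t1 : 1 - t != 0 by lra.
split.
rewrite (_ : series _ = fun N => (L - series (fun k => a k * t ^+ k) N
   - (L - \sum_(k < N) a k) * t ^+ N) / (1 - t)); last first.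
  by apply/funext => N; rewrite !seriesX -(sum_tails t N rE) mulrC mulKf.
apply: cvgMl; rewrite -[X in _ --> X]subr0; apply: cvgB; last first.
  apply: (@cvg0_le _ _ _ _ _ (fun n => (M + `|L|) * t ^+ n)).
    apply: nearW => n; rewrite normrM [X in _ * X]ger0_norm ?exprn_ge0; try lra.
    apply: ler_wpM2r; first by apply: exprn_ge0; lra.
    have := rM n.-1; rewrite rE; case: n => [|n] /=; last first.
      by have := normr_ge0 L; lra.
    by rewrite big_ord0 subr0 lerDr; apply: le_trans.
  rewrite -[X in _ --> X](mulr0 (M + `|L|)); apply: cvgMr.
  by apply: cvg_expr; rewrite ger0_norm; lra.
by apply: cvgB; [exact: cvg_cst | exact: has_sum_cvg (ay t t01)].
Qed.

Lemma cvg_left1_sum (R : realType) (a : nat -> R) N :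
  \sum_(k < N) a k * t ^+ k @[t --> 1^'-] --> \sum_(k < N) a k.
Proof.
elim: N => [|N IH].
  rewrite big_ord0 (_ : (fun _ => _) = cst 0); first exact: cvg_cst.
  by apply/funext => t; rewrite big_ord0.
rewrite big_ord_recr/= (_ : (fun _ => _) =
  fun t => \sum_(k < N) a k * t ^+ k + a N * t ^+ N); last first.
  by apply/funext => t; rewrite big_ord_recr.
apply: cvgD => //; rewrite -[X in _ --> X]mulr1; apply: cvgMr.
rewrite -[X in _ --> X](expr1n _ N).
by apply: cvg_at_left_filter; exact: exprn_continuous.
Qed.

Lemma gen_fun_sum_le (R : realType) (a : nat -> R) (y : R -> R) (L : R) :
  gen_fun a y -> (forall n, 0 <= a n) -> y t @[t --> 1^'-] --> L ->
  forall N, \sum_(k < N) a k <= L.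
Proof.
move=> ay a0 yL N.
have c := @cvg_left1_sum _ a N.
rewrite -(cvg_lim _ c)// -(cvg_lim _ yL)//; apply: ler_lim.
- by apply/cvg_ex; eexists; exact: c.
- by apply/cvg_ex; eexists; exact: yL.
near=> t; have t01 : 0 <= t < 1.
  by apply/andP; split; near: t; [exact: nbhs_left_ge|exact: nbhs_left_lt].
apply: (has_sum_ge (ay t t01)) => n _.
by apply: mulr_ge0 => //; apply: exprn_ge0; lra.
Unshelve. all: by end_near. Qed.

Lemma cvg0_sum (R : realType) (T : Type) (F : set_system T) (FF : Filter F)
    (f : nat -> T -> R) n :
  (forall i, f i @ F --> 0) -> (fun x => \sum_(i < n) f i x) @ F --> 0.
Proof.
move=> f0; elim: n => [|n IH].
  rewrite (_ : (fun _ => _) = cst 0); first exact: cvg_cst.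
  by apply/funext => t; rewrite big_ord0.
rewrite (_ : (fun _ => _) = fun t => \sum_(k < n) f k t + f n t); last first.
  by apply/funext => t; rewrite big_ord_recr.
by rewrite -[X in _ --> X](addr0 0); apply: cvgD.
Qed.

(** * Tauberian theorems *)

Lemma bernoulli_ineq (R : realType) (x : R) n : -1 <= x -> 1 + n%:R * x <= (1 + x) ^+ n.
Proof.
move=> x1; elim: n => [|n IH]; first by rewrite mul0r addr0 expr0.
rewrite exprS -natr1; apply: (@le_trans _ _ ((1 + x) * (1 + n%:R * x))).
  by have := sqr_ge0 x; have : 0 <= n%:R :> R by []; nra.
by apply: ler_wpM2l IH; lra.
Qed.

Lemma bernoulli_ineq1 (R : realType) (t : R) n : 0 <= t -> 1 + n%:R * (t - 1) <= t ^+ n.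
Proof.
by move=> t0; have := @bernoulli_ineq _ (t - 1) n; rewrite (_ : 1 + (t - 1) = t); [apply; lra|ring].
Qed.

(** Bernoulli's inequality gives 1 - t^k <= k (1 - t), which keeps t^k in the given neighbourhood of
    1, and t^k <= t allows sqrt(1 - t) to be replaced by the larger sqrt(1 - t^k). *)
Lemma cvg0_left1_expr (R : realType) (f : R -> R) k : (0 < k)%N ->
  Num.sqrt (1 - t) * f t @[t --> 1^'-] --> (0 : R) ->
  Num.sqrt (1 - t) * f (t ^+ k) @[t --> 1^'-] --> (0 : R).
Proof.
move=> k0 /cvg_left1P H; apply/cvg_left1P => e e0.
have [t0 t01 {}H] := H e e0.
exists (Num.max 0 (1 - (1 - t0) / k%:R)).
  rewrite gt_max ltr01/= ltrBlDr ltrDl divr_gt0 ?ltr0n//; lra.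
move=> t /andP[]; rewrite gt_max => /andP[tp tk] t1.
have kp : 0 < k%:R :> R by rewrite ltr0n.
have t0k : t0 < t ^+ k.
  have := @bernoulli_ineq1 _ t k (ltW tp).
  apply: lt_le_trans; move: tk; rewrite ltrBlDr -ltrBlDl ltr_pdivlMr//; nra.
have tk1 : t ^+ k < 1 by rewrite exprn_ilt1// ?ltW// -lt0n.
have tkt : t ^+ k <= t by case: k k0 {kp tk t0k tk1} => // k _; rewrite exprS ler_piMr ?exprn_ile1 ?ltW.
have := H (t ^+ k); rewrite t0k tk1 => /(_ isT); rewrite !subr0.
apply: le_lt_trans; rewrite !normrM ler_wpM2r//.
by rewrite !ger0_norm ?sqrtr_ge0// ler_wsqrtr//; lra.
Qed.

Lemma cvg0_left1_poly (R : realType) (f : R -> R) (q : {poly R}) : q`_0 = 0 ->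
  Num.sqrt (1 - t) * f t @[t --> 1^'-] --> (0 : R) ->
  Num.sqrt (1 - t) * (\sum_(k < size q) q`_k * f (t ^+ k)) @[t --> 1^'-] --> (0 : R).
Proof.
move=> q0 f0.
rewrite (_ : (fun _ => _) = fun t => \sum_(k < size q)
   (q`_k * (Num.sqrt (1 - t) * f (t ^+ k)))); last first.
  by apply/funext => t; rewrite big_distrr/=; apply: eq_bigr => i _; ring.
apply: (@cvg0_sum _ _ _ _ (fun k t => q`_k * (Num.sqrt (1 - t) * f (t ^+ k)))) => -[|k].
  by under eq_fun do rewrite q0 mul0r; exact: cvg_cst.
by rewrite -[X in _ --> X](mulr0 q`_k.+1); apply: cvgMr; exact: cvg0_left1_expr.
Qed.

(** Karamata's device: weighting the coefficients by a polynomial in t^n amounts to combining values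
    of [f] at powers of t. A constant term of [q] would involve [f] at 1, where the series may
    diverge. *)
Lemma gen_fun_poly (R : realType) (d : nat -> R) (f : R -> R) (q : {poly R}) t :
  gen_fun d f -> q`_0 = 0 -> 0 <= t < 1 ->
  has_sum (fun n => d n * q.[t ^+ n]) (\sum_(k < size q) q`_k * f (t ^+ k)).
Proof.
move=> df q0 /andP[t0 t1].
have : forall k : 'I_(size q),
    has_sum (fun n => q`_k * (d n * (t ^+ k) ^+ n)) (q`_k * f (t ^+ k)).
  case=> -[|k] kq /=.
    rewrite q0 mul0r; apply: eq_has_sum (has_sum0 _) _ => n; by rewrite mul0r.
  by apply: has_sumZ; apply: df; rewrite exprn_ge0// exprn_ilt1.
move=> /(has_sum_sum (index_enum _)) /eq_has_sum; apply => n.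
rewrite horner_coef big_distrr/=; apply: eq_bigr => k _.
by rewrite -!exprM mulnC; ring.
Qed.

(* These polynomials tend to the indicator of [x >= 1/2] on [0, 1], at a
   geometric rate away from [1/2]. *)
Definition step_poly (R : realType) (m : nat) : {poly R} :=
  1 - (1 - 'X^m) ^+ (2 ^ m).

Lemma step_polyE (R : realType) m (x : R) :
  (step_poly R m).[x] = 1 - (1 - x ^+ m) ^+ (2 ^ m).
Proof. by rewrite /step_poly !hornerE. Qed.

Lemma step_poly_coef0 (R : realType) m : (0 < m)%N -> (step_poly R m)`_0 = 0.
Proof.
by case: m => // m _; rewrite -horner_coef0 step_polyE expr0n/= subr0 expr1n subrr.
Qed.

Lemma step_poly_itv (R : realType) m (x : R) : 0 <= x <= 1 ->
  0 <= (step_poly R m).[x] <= 1.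
Proof.
move=> /andP[x0 x1]; rewrite step_polyE.
have : 0 <= 1 - x ^+ m <= 1.
  by have := exprn_ge0 m x0; have := exprn_ile1 m x0 x1; lra.
move=> /andP[z0 z1]; have := exprn_ge0 (2 ^ m) z0; have := exprn_ile1 (2 ^ m) z0 z1; lra.
Qed.

Lemma step_poly_le (R : realType) m (x : R) : 0 <= x <= 1 ->
  (step_poly R m).[x] <= (2 * x) ^+ m.
Proof.
move=> /andP[x0 x1]; rewrite step_polyE.
have := @bernoulli_ineq _ (- x ^+ m) (2 ^ m).
have := exprn_ile1 m x0 x1; rewrite natrX exprMn lerN2 => -> /(_ isT); nra.
Qed.

(** With z = x^m and M = 2^m, the product (1 - z)^M (1 + z)^M is at most 1, while (1 + z)^M >= M z =
    (2x)^m. *)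
Lemma step_poly_ge (R : realType) m (x : R) : 0 <= x <= 1 ->
  (1 - (step_poly R m).[x]) * (2 * x) ^+ m <= 1.
Proof.
move=> /andP[x0 x1]; rewrite step_polyE opprB addrC subrK.
have xm0 := exprn_ge0 m x0; have xm1 := exprn_ile1 m x0 x1.
apply: (@le_trans _ _ ((1 - x ^+ m) ^+ (2 ^ m) * (1 + x ^+ m) ^+ (2 ^ m))).
  apply: ler_wpM2l; first by rewrite exprn_ge0// subr_ge0.
  rewrite exprMn -natrX; apply: le_trans (bernoulli_ineq _ _); lra.
rewrite -exprMn; apply: exprn_ile1; nra.
Qed.

(** The point t = 2^(-1/N) moves the jump of the step polynomials, at t^n = 1/2, to n = N.
    Bernoulli's inequality for t and for 1/t gives the two bounds on 1 - t. *)
Lemma half_root (R : realType) N : (0 < N)%N -> exists t : R,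
  [/\ 0 < t < 1, t ^+ N = 2^-1, (2 * N%:R)^-1 <= 1 - t & 1 - t <= N%:R^-1].
Proof.
move=> N0; have Np : 0 < N%:R :> R by rewrite ltr0n.
pose t : R := (2^-1) `^ (N%:R^-1).
have t0 : 0 < t by apply: powR_gt0; lra.
have tN : t ^+ N = 2^-1.
  rewrite -powR_mulrn ?ltW// -powRrM mulVf ?gt_eqF// powRr1//; lra.
have t1 : t < 1.
  rewrite ltNge; apply/negP => t1; have := exprn_ege1 N t1; rewrite tN; lra.
exists t; split => //; first by rewrite t0.
- have := @bernoulli_ineq1 _ t N (ltW t0); rewrite tN.
  by move=> H; rewrite invfM -ler_pdivlMr ?invr_gt0// invrK; nra.
- have ti : 0 <= t^-1 by rewrite invr_ge0 ltW.
  have := @bernoulli_ineq1 _ t^-1 N ti; rewrite exprVn tN invrK.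
  move=> H; rewrite -[_^-1]mul1r ler_pdivlMr//.
  have tt : t * t^-1 = 1 by rewrite mulfV ?gt_eqF.
  nra.
Qed.

Lemma seq_nonincr (R : realType) (a : nat -> R) (m n : nat) :
  (forall k, a k.+1 <= a k) -> (m <= n)%N -> a n <= a m.
Proof.
move=> a_dec mn; rewrite -(subnKC mn); elim: (n - m)%N => [|k IH].
  by rewrite addn0.
by rewrite addnS; exact: le_trans (a_dec _) IH.
Qed.

(** Away from the window |n - N| < l the error is geometric in m; inside it, at most 1. The factor
    t^n makes the geometric part summable against the coefficients: for n < N it costs nothing since
    2 t^n >= 1, and for n >= N it is the extra power provided by the degree m + 1. *)
Lemma step_poly_error (R : realType) (N l m n : nat) (t rho : R) :
  0 < t < 1 -> t ^+ N = 2^-1 -> t ^+ l <= rho <= 1 ->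
  `|(n < N)%:R - (step_poly R m.+1).[t ^+ n]| <=
    2 * rho ^+ m * t ^+ n + ((N < n + l) && (n < N + l))%N%:R.
Proof.
move=> /andP[t0 t1] tN /andP[tl rho1].
have rho0 : 0 <= rho by apply: le_trans tl; rewrite exprn_ge0 ?ltW.
have x01 : 0 <= t ^+ n <= 1 by rewrite exprn_ge0 ?exprn_ile1 ?ltW.
have q01 := step_poly_itv m.+1 x01.
have rm : 0 <= rho ^+ m by rewrite exprn_ge0.
have tl0 : 0 < t ^+ l by rewrite exprn_gt0.
have far (k : nat) : (k >= l)%N -> t ^+ k <= rho.
  by move=> lk; apply: le_trans tl; apply: ler_wiXn2l; rewrite ?ltW.
have [nN|Nn] := ltnP n N.
  have [Nnl|nlN] := ltnP N (n + l).
    rewrite (leq_trans nN (leq_addr _ _)) /= ler_norml; nra.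
  rewrite /= addr0 ger0_norm; last by lra.
  have tnN : t ^+ n * t ^+ (N - n) = 2^-1 by rewrite -exprD subnKC ?tN// ltnW.
  have rNn : t ^+ (N - n) <= rho by apply: far; rewrite leq_subRL// ltnW.
  set x := t ^+ n in x01 q01 tnN *; set r := t ^+ (N - n) in tnN rNn.
  have r1 : r <= 1 by lra.
  have x2 : 1 <= 2 * x by nra.
  have H := step_poly_ge m.+1 x01.
  have H1 : (2 * x) ^+ m * r ^+ m = 1.
    by rewrite -exprMn -mulrA tnN mulfV// expr1n.
  have x2m : 1 <= (2 * x) ^+ m by rewrite exprn_ege1.
  have r0 : 0 <= r by rewrite exprn_ge0 ?ltW.
  have rrho : r ^+ m <= rho ^+ m by rewrite lerXn2r// nnegrE.
  rewrite exprS in H; rewrite mulrAC.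
  set X := (2 * x) ^+ m in H H1 x2m; set q := (step_poly R m.+1).[x] in q01 H *.
  have q1 : 0 <= 1 - q by lra.
  have : (1 - q) * X <= 1 by apply: le_trans H; rewrite ler_wpM2l// ler_peMl//; lra.
  have : 1 - q = (1 - q) * X * r ^+ m by rewrite -mulrA H1 mulr1.
  have : 0 <= r ^+ m by rewrite exprn_ge0.
  nra.
have [nNl|Nln] := ltnP n (N + l).
  have -> : (N < n + l)%N by rewrite (leq_ltn_trans Nn)// -ltn_subLR// subnn; case: (l) nNl Nn => //; rewrite addn0 ltnNge => /negP.
  rewrite /= ler_norml; nra.
rewrite andbF addr0 sub0r normrN ger0_norm; last by lra.
apply: le_trans (step_poly_le _ x01) _; rewrite exprS.
have rNn : t ^+ (n - N) <= rho by apply: far; rewrite leq_subRL.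
have x2E : 2 * t ^+ n = t ^+ (n - N).
  by rewrite -{1}(subnKC Nn) exprD tN; field.
rewrite [leRHS]mulrAC x2E ler_wpM2l ?exprn_ge0 ?(ltW t0)//.
by rewrite lerXn2r// nnegrE exprn_ge0 ?(ltW t0).
Qed.

Lemma window_card (N l M : nat) : (l <= N)%N ->
  (\sum_(k < M) ((N < k + l) && (k < N + l)) <= 2 * l)%N.
Proof.
move=> lN.
(* The bound 2l is not inductive in M; the number of indices of the window below M is. *)
suff : (\sum_(k < M) ((N < k + l) && (k < N + l)) <= minn M (N + l) - (N - l))%N by lia.
elim: M => [|M IH]; first by rewrite big_ord0.
rewrite big_ord_recr/=; move: IH; set s := (\sum_(_ < M) _)%N => IH.
by case: (ltnP N (M + l)); case: (ltnP M (N + l)) => /=; lia.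
Qed.

Lemma near_half_root (R : realType) (Q : R -> Prop) :
  (\forall t \near 1^'-, Q t) ->
  \forall N \near \oo, exists t : R,
    [/\ [/\ 0 < t < 1, t ^+ N = 2^-1 & (2 * N%:R)^-1 <= 1 - t],
        2 / 3 <= Num.sqrt (1 - t) * Num.sqrt N%:R & Q t].
Proof.
rewrite /at_left => -[e /= e0 H].
near=> N; have N0 : (0 < N)%N by near: N; exact: nbhs_infty_gt.
have [t [/andP[t0 t1] tN tl tu]] := half_root R N0.
have Np : 0 < N%:R :> R by rewrite ltr0n.
exists t; split; first by split=> //; rewrite t0.
  rewrite -sqrtrM; last by lra.
  (* From 1 - t >= 1/(2N), the product is at least sqrt(1/2), for which 2/3 is a rational lower
     bound. *)
  apply: (@le_trans _ _ (Num.sqrt (2^-1))); last first.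
    rewrite ler_wsqrtr// -ler_pdivrMr// (le_trans _ tl)//.
    by rewrite invfM.
  rewrite (_ : 2 / 3 = Num.sqrt ((2 / 3) ^+ 2)).
    by rewrite ler_wsqrtr; lra.
  by rewrite sqrtr_sqr ger0_norm; lra.
apply: H => //=; rewrite ger0_norm; last by lra.
apply: (le_lt_trans tu); rewrite invf_plt ?posrE//.
near: N; exact: nbhs_infty_gtr.
Unshelve. all: by end_near. Qed.

(** At the point with t^N = 1/2, monotonicity makes each of the first N terms at least s_N / 2, so N
    s_N / 2 <= ys(t). The constant 3 is 2 divided by the 2/3 of [near_half_root]. *)
Lemma gen_fun_coef_bound (R : realType) (s : nat -> R) (ys : R -> R) (C : R) :
  (forall n, 0 <= s n) -> (forall n, s n.+1 <= s n) -> gen_fun s ys ->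
  (\forall t \near 1^'-, Num.sqrt (1 - t) * ys t <= C) ->
  \forall N \near \oo, Num.sqrt N%:R * s N <= 3 * C.
Proof.
move=> s0 s_dec sy /near_half_root; apply: filterS => N.
move=> [t [[/andP[t0 t1] tN _] zr HC]].
have : N%:R * (s N * 2^-1) <= ys t.
  have /has_sum_ge : has_sum (fun n => s n * t ^+ n) (ys t).
    by apply: sy; rewrite ltW.
  move=> /(_ N) H; apply: le_trans (H _); last first.
    by move=> n _; rewrite mulr_ge0 ?exprn_ge0 ?(ltW t0).
  rewrite mulr_natl -[X in _ *+ X]card_ord -sumr_const; apply: ler_sum => i _.
  rewrite -tN ler_pM ?exprn_ge0 ?(ltW t0)//; first exact: seq_nonincr (ltnW _).
  by apply: ler_wiXn2l; rewrite ?(ltW t0) ?(ltW t1) ?(ltnW (ltn_ord i)).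
have z0 := sqrtr_ge0 (1 - t); have r0 := sqrtr_ge0 (N%:R : R).
have rE : Num.sqrt N%:R * Num.sqrt N%:R = N%:R :> R by rewrite -expr2 sqr_sqrtr.
move=> H; rewrite -rE in H; have sN := s0 N; move: HC zr z0 r0 sN H.
set z := Num.sqrt (1 - t); set r := Num.sqrt _; set y := ys t; set x := s N.
move=> HC zr z0 r0 sN H.
have H2 : z * (r * r * (x * 2^-1)) <= C by apply: le_trans HC; rewrite ler_wpM2l.
have : (2/3) * (r * x) <= z * r * (r * x) by rewrite ler_wpM2r ?mulr_ge0.
lra.
Qed.

Lemma sqrtr_nat_half (R : realType) (N M : nat) : (N <= 4 * M)%N ->
  Num.sqrt N%:R <= 2 * Num.sqrt M%:R :> R.
Proof.
move=> NM; rewrite -[X in X * _](@ger0_norm _ (2 : R))// -sqrtr_sqr -sqrtrM ?sqr_ge0//.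
by rewrite ler_wsqrtr// -natrX -natrM ler_nat; lia.
Qed.

Lemma has_sum_fin (R : realType) (f : nat -> R) N :
  has_sum (fun n => f n * (n < N)%:R) (\sum_(n < N) f n).
Proof.
split; apply: cvg_near_cst; near=> M.
have NM : (N <= M)%N by near: M; exact: nbhs_infty_ge.
rewrite seriesX -(subnKC NM) big_split_ord/= [X in _ + X]big1 ?addr0 => [|i _].
  by apply: eq_bigr => i _; rewrite ltn_ord mulr1.
by rewrite ltnNge leq_addr mulr0.
Unshelve. all: by end_near. Qed.

(** The indicator of n < N is replaced by a step polynomial in t^n. The polynomial sum is small by
    the hypothesis on ya - yw, and the error of the replacement is controlled by a + w, which is
    monotone and of order 1/sqrt n. *)
Lemma tauberian_sum (R : realType) (a w : nat -> R) (ya yw : R -> R) (C : R) :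
  (forall n, 0 <= a n) -> (forall n, a n.+1 <= a n) -> gen_fun a ya ->
  (forall n, 0 <= w n) -> (forall n, w n.+1 <= w n) -> gen_fun w yw ->
  0 < C -> (\forall t \near 1^'-, Num.sqrt (1 - t) * (ya t + yw t) <= C) ->
  Num.sqrt (1 - t) * (ya t - yw t) @[t --> 1^'-] --> (0 : R) ->
  forall eta : R, 0 < eta -> \forall N \near \oo,
    `|\sum_(n < N) (a n - w n)| <= eta * Num.sqrt N%:R.
Proof.
move=> a0 a_dec ay w0 w_dec wy C0 bnd diff eta eta0.
pose s n := a n + w n.
have s0 n : 0 <= s n by rewrite addr_ge0.
have s_dec n : s n.+1 <= s n by rewrite lerD.
have sy : gen_fun s (fun t => ya t + yw t).
  move=> t t01; apply: eq_has_sum (has_sumD (ay t t01) (wy t t01)) _ => n.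
  by rewrite mulrDl.
have dy : gen_fun (fun n => a n - w n) (fun t => ya t - yw t).
  move=> t t01; apply: eq_has_sum (has_sumB (ay t t01) (wy t t01)) _ => n.
  by rewrite mulrBl.
(* The error has three parts, each allowed eta/3: the window, the geometric part and the polynomial
   sum [E]. Here [eps] is the relative half-width of the window: with l <= 2 eps N and s_(N-l) <= 6C
   / sqrt N the window costs 24 C eps sqrt N. The cap 1/4 gives 2l <= N. *)
pose eps := Num.min 4^-1 (eta / (72 * C)).
have eps0 : 0 < eps by rewrite lt_min divr_gt0 ?mulr_gt0// andbT; lra.
have eps4 : eps <= 4^-1 by rewrite ge_min lexx.
have epsC : 24 * C * eps <= eta / 3.
  have : eps <= eta / (72 * C) by rewrite ge_min lexx orbT.
  by rewrite ler_pdivlMr ?mulr_gt0//; lra.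
(* [rho] bounds t^l for every N at once: t (1 + 1/(2N)) <= 1 and (1 + 1/(2N))^l >= 1 + eps/2 when l
   >= eps N. *)
pose rho := (1 + eps / 2)^-1.
have rho0 : 0 < rho by rewrite invr_gt0; lra.
have rho1 : rho < 1 by rewrite invf_lt1; lra.
have [m rm] : exists m, 3 * C * rho ^+ m <= eta / 3.
  have : rho ^+ m @[m --> \oo] --> 0 by apply: cvg_expr; rewrite ger0_norm// ltW.
  have e1 : 0 < eta / (9 * C) by rewrite divr_gt0// mulr_gt0.
  move=> /cvgr0Pnorm_lt /(_ _ e1) [m _ /(_ m (leqnn m)) H]; exists m.
  move: H; rewrite ger0_norm ?exprn_ge0 ?(ltW rho0)// ltr_pdivlMr ?mulr_gt0//; lra.
pose q := step_poly R m.+1.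
have q0 : q`_0 = 0 by exact: step_poly_coef0.
pose E t := \sum_(k < size q) q`_k * (ya (t ^+ k) - yw (t ^+ k)).
have e2 : 0 < 2 * eta / 9 by lra.
have Elim : \forall t \near 1^'-, Num.sqrt (1 - t) * `|E t| <= 2 * eta / 9.
  have /cvgr0Pnorm_lt/(_ _ e2) := cvg0_left1_poly q0 diff.
  by apply: filterS => t /ltW; rewrite normrM ger0_norm ?sqrtr_ge0.
have H1 := gen_fun_coef_bound s0 s_dec sy bnd.
have [N1 _ {}H1] := H1.
have H2 : \forall N \near \oo, exists t : R,
    [/\ [/\ 0 < t < 1, t ^+ N = 2^-1 & (2 * N%:R)^-1 <= 1 - t],
        2 / 3 <= Num.sqrt (1 - t) * Num.sqrt N%:R &
        Num.sqrt (1 - t) * `|E t| <= 2 * eta / 9 /\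
        Num.sqrt (1 - t) * (ya t + yw t) <= C] 
  by apply: near_half_root; exact: filterI.
near=> N.
have N0 : (0 < N)%N by near: N; exact: nbhs_infty_gt.
have Np : 0 < N%:R :> R by rewrite ltr0n.
have eN : 1 <= eps * N%:R.
  by rewrite mulrC -ler_pdivrMr// mul1r; near: N; exact: nbhs_infty_ger.
pose l := (Num.truncn (eps * N%:R)).+1.
have /andP[l1 l2] : l.-1%:R <= eps * N%:R < l%:R.
  by apply: truncn_itv; rewrite mulr_ge0// ltW.
have l3 : l%:R <= 2 * (eps * N%:R).
  have lE : l%:R = l.-1%:R + 1 :> R by rewrite natr1.
  lra.
have lN : (2 * l <= N)%N by rewrite -(ler_nat R) natrM; nra.
have lN' : (l <= N)%N by apply: leq_trans lN; rewrite leq_pmull.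
have [t [[t01 tN tl] zr [HE HC]]] : exists t : R,
    [/\ [/\ 0 < t < 1, t ^+ N = 2^-1 & (2 * N%:R)^-1 <= 1 - t],
        2 / 3 <= Num.sqrt (1 - t) * Num.sqrt N%:R &
        Num.sqrt (1 - t) * `|E t| <= 2 * eta / 9 /\
        Num.sqrt (1 - t) * (ya t + yw t) <= C] by near: N; exact: H2.
have /andP[t0 t1] := t01.
have t01' : 0 <= t < 1 by rewrite ltW.
have sNl : Num.sqrt (N - l)%:R * s (N - l)%N <= 3 * C.
  apply: H1 => /=; have : (2 * N1 <= N)%N by near: N; exact: nbhs_infty_ge.
  by move: (l) lN => k; clear; lia.
have trho : t ^+ l <= rho <= 1.
  rewrite (ltW rho1) andbT /rho -[_^-1]mul1r ler_pdivlMr; last by lra.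
  have H : (t * (1 + (2 * N%:R)^-1)) ^+ l <= 1.
    have i0 : 0 < (2 * N%:R)^-1 :> R by rewrite invr_gt0 mulr_gt0.
    by apply: exprn_ile1; nra.
  apply: le_trans H; rewrite exprMn ler_wpM2l ?exprn_ge0 ?(ltW t0)//.
  apply: le_trans (bernoulli_ineq _ _); last first.
    by rewrite (@le_trans _ _ 0)// ?invr_ge0 ?mulr_ge0//; lra.
  rewrite lerD2l ler_pdivlMr; last by rewrite mulr_gt0.
  lra.
have r0 := sqrtr_ge0 (N%:R : R).
have rE : Num.sqrt N%:R * Num.sqrt N%:R = N%:R :> R by rewrite -expr2 sqr_sqrtr.
have sl : Num.sqrt N%:R * s (N - l)%N <= 6 * C.
  have := @sqrtr_nat_half R N (N - l) => /(_ _)/wrap[]; first by move: (l) lN => k; clear; lia.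
  move=> /(ler_wpM2r (s0 (N - l)%N)); lra.
have win : s (N - l)%N * (2 * l)%:R <= eta / 3 * Num.sqrt N%:R.
  have := s0 (N - l)%N; have : (2 * l)%:R <= 4 * eps * (Num.sqrt N%:R * Num.sqrt N%:R) :> R.
    by rewrite rE natrM; lra.
  move: sl epsC r0; set r := Num.sqrt _; set x := s _ => sl epsC r0 H x0.
  have h1 : x * (2 * l)%:R <= x * (4 * eps * (r * r)) by rewrite ler_wpM2l.
  have h2 : 4 * eps * r * (r * x) <= 4 * eps * r * (6 * C).
    by rewrite ler_wpM2l ?mulr_ge0// ltW.
  have h3 : 24 * C * eps * r <= eta / 3 * r by rewrite ler_wpM2r.
  lra.
have B : `|\sum_(n < N) (a n - w n) - E t| <= 2 * rho ^+ m * (ya t + yw t) + s (N - l)%N * (2 * l)%:R.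
  have /(has_sumB (has_sum_fin (fun n => a n - w n) N)) := gen_fun_poly dy q0 t01'.
  rewrite -/(E t) => dE; set B := (X in _ <= X).
  (* The bound is on sums of absolute values, so it serves for both signs of the difference
     below. *)
  have part M : \sum_(k < M) `|(a k - w k) * (k < N)%:R - (a k - w k) * q.[t ^+ k]| <= B.
    apply: (@le_trans _ _ (\sum_(k < M) (2 * rho ^+ m * (s k * t ^+ k) +
        s (N - l)%N * ((N < k + l) && (k < N + l))%N%:R))).
      apply: ler_sum => k _; rewrite -mulrBr normrM.
      have h1 : `|a k - w k| <= s k.
        by rewrite /s ler_norml; have := a0 k; have := w0 k; lra.
      have h2 := step_poly_error m k t01 tN trho.
      apply: le_trans (ler_pM (normr_ge0 _) (normr_ge0 _) h1 h2) _.
      rewrite mulrDr lerD//; first by rewrite le_eqVlt; apply/orP; left; apply/eqP; ring.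
      case: ltnP => /= [Nkl|]; last by rewrite !mulr0.
      apply: ler_wpM2r => //; apply: seq_nonincr s_dec _.
      by rewrite leq_subLR addnC ltnW.
    rewrite big_split/= lerD//.
      rewrite -big_distrr/= ler_wpM2l//; first by rewrite mulr_ge0 ?exprn_ge0 ?(ltW rho0).
      by apply: has_sum_ge (sy t t01') _ => k _; rewrite mulr_ge0 ?exprn_ge0 ?(ltW t0).
    rewrite -big_distrr/= ler_wpM2l// -natr_sum ler_nat.
    exact: window_card.
  rewrite ler_norml; apply/andP; split.
    rewrite lerNl -mulN1r; apply: has_sum_le (has_sumZ (-1) dE) _.
    move=> M; apply: le_trans (part M); apply: ler_sum => k _.
    by rewrite mulN1r -normrN ler_norm.
  by apply: has_sum_le dE _ => M; apply: le_trans (part M); apply: ler_sum => k _; rewrite ler_norm.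
have z0 := sqrtr_ge0 (1 - t).
have y0 : 0 <= ya t + yw t.
  by apply: has_sum_ge0 (sy t t01') _ => k; rewrite mulr_ge0 ?exprn_ge0 ?(ltW t0).
rewrite -[X in `|X|](subrK (E t)); apply: (le_trans (ler_normD _ _)).
have E0 := normr_ge0 (E t).
move: win zr z0 r0 HE HC B E0; clear -rm rho0 y0 C0 eta0.
set r := Num.sqrt N%:R; set z := Num.sqrt (1 - t); set e := `|E t|; set y := ya t + yw t.
set X := s _ * _; set S := `|_ - _|; set rr := rho ^+ m => win zr z0 r0 HE HC B E0.
have h1 : (2 / 3) * e <= z * r * e by rewrite ler_wpM2r.
have h2 : r * (z * e) <= r * (2 * eta / 9) by rewrite ler_wpM2l.
have h3 : (2 / 3) * y <= z * r * y by rewrite ler_wpM2r.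
have h4 : r * (z * y) <= r * C by rewrite ler_wpM2l.
have rr0 : 0 <= rr by rewrite exprn_ge0 ?(ltW rho0).
have h5 : rr * y <= rr * (3 / 2 * (r * C)) by rewrite ler_wpM2l//; lra.
have h6 : r * (3 * C * rr) <= r * (eta / 3) by rewrite ler_wpM2l.
lra.
Unshelve. all: by end_near. Qed.

(** Used with x = n and y = n - l, where p and q are the weights there: a weight growing at most
    quadratically is nearly constant on a short window. The factor 1 + 6 eps is a polynomial bound
    for (1 - eps)^(-2) on (0, 1/4]; in the next lemma 1 - 2 eps plays this role for (1 +
    eps)^(-2). *)
Lemma regular_weight_left (R : realType) (p q x y eps : R) : 0 < p -> 0 < x ->
  0 < eps <= 4^-1 -> (1 - eps) * x <= y -> p * y ^+ 2 <= q * x ^+ 2 ->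
  p <= (1 + 6 * eps) * q.
Proof.
move=> p0 x0 /andP[eps0 eps4] xy H.
have h2 : ((1 - eps) * x) ^+ 2 <= y ^+ 2.
  by rewrite lerXn2r// nnegrE; [rewrite mulr_ge0//; lra|apply: le_trans xy; rewrite mulr_ge0//; lra].
have h4 : p * (1 - eps) ^+ 2 <= q.
  rewrite -(ler_pM2r (exprn_gt0 2 x0)) -mulrA -exprMn; apply: le_trans H.
  by rewrite ler_wpM2l// ltW.
have h5 : 1 <= (1 + 6 * eps) * (1 - eps) ^+ 2 by clear -eps0 eps4; nra.
have h6 : (1 + 6 * eps) * (p * (1 - eps) ^+ 2) <= (1 + 6 * eps) * q.
  by rewrite ler_wpM2l//; lra.
have : p * 1 <= p * ((1 + 6 * eps) * (1 - eps) ^+ 2) by rewrite ler_wpM2l// ltW.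
lra.
Qed.

Lemma regular_weight_right (R : realType) (p q x y eps : R) : 0 <= p -> 0 < x -> 0 <= y ->
  0 < eps <= 4^-1 -> y <= (1 + eps) * x -> q * x ^+ 2 <= p * y ^+ 2 ->
  (1 - 2 * eps) * q <= p.
Proof.
move=> p0 x0 y0 /andP[eps0 eps4] xy H.
have h2 : y ^+ 2 <= ((1 + eps) * x) ^+ 2.
  by rewrite lerXn2r// nnegrE//; apply: le_trans xy.
have h4 : q <= p * (1 + eps) ^+ 2.
  rewrite -(ler_pM2r (exprn_gt0 2 x0)) -mulrA -exprMn; apply: (le_trans H).
  by rewrite ler_wpM2l.
have h5 : (1 - 2 * eps) * (1 + eps) ^+ 2 <= 1 by clear -eps0 eps4; nra.
have h6 : (1 - 2 * eps) * q <= (1 - 2 * eps) * (p * (1 + eps) ^+ 2).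
  by rewrite ler_wpM2l//; lra.
have : p * ((1 - 2 * eps) * (1 + eps) ^+ 2) <= p * 1 by rewrite ler_wpM2l.
lra.
Qed.

(* [P] plays the role of a regularly varying weight of index between 0 and 2. *)
Lemma monotone_density (R : realType) (P a b : nat -> R) (kap : R) :
  (forall n, (0 < n)%N -> 0 < P n) ->
  (forall m n, (m <= n)%N -> P m <= P n) ->
  (forall m n, (m <= n)%N -> P n * m%:R ^+ 2 <= P m * n%:R ^+ 2) ->
  0 <= kap -> (forall n, a n.+1 <= a n) ->
  P n * b n @[n --> \oo] --> kap ->
  (forall eta : R, 0 < eta -> \forall N \near \oo, forall M, (N <= M <= 2 * N)%N ->
     P N * `|\sum_(N <= n < M) (a n - b n)| <= eta * N%:R) ->
  P n * a n @[n --> \oo] --> kap.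
Proof.
move=> P0 Pmono Preg kap0 a_dec Pb diff; apply/cvgrPdist_le => e e0.
pose eps := Num.min 4^-1 (e / (24 * (kap + 1))).
have k1 : 0 < 24 * (kap + 1) by lra.
have eps0 : 0 < eps by rewrite lt_min divr_gt0// andbT; lra.
have eps4 : eps <= 4^-1 by rewrite ge_min lexx.
have epsk : 6 * eps * kap <= e / 4.
  have : eps <= e / (24 * (kap + 1)) by rewrite ge_min lexx orbT.
  rewrite ler_pdivlMr//; nra.
(* The window has l >= eps n / 2 terms, so an error of eta n over it is at most e/20 per term. *)
pose eta := eps * e / 40.
have eta0 : 0 < eta by rewrite /eta divr_gt0// mulr_gt0.
have [N1 _ bnear] : \forall n \near \oo, `|kap - P n * b n| <= eta.
  by move/cvgrPdist_le: Pb; apply.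
have [N2 _ {}diff] := diff _ eta0.
near=> n.
have n0 : (0 < n)%N by near: n; exact: nbhs_infty_gt.
have np : 0 < n%:R :> R by rewrite ltr0n.
have eN : 2 <= eps * n%:R.
  by rewrite mulrC -ler_pdivrMr//; near: n; exact: nbhs_infty_ger.
have nN1 : (2 * N1 <= n)%N by near: n; exact: nbhs_infty_ge.
have nN2 : (2 * N2 <= n)%N by near: n; exact: nbhs_infty_ge.
pose l := Num.truncn (eps * n%:R).
have /andP[l1 l2] : l%:R <= eps * n%:R < l.+1%:R.
  by apply: truncn_itv; rewrite mulr_ge0// ltW.
have l3 : eps * n%:R <= 2 * l%:R.
  have lE : l.+1%:R = l%:R + 1 :> R by rewrite natr1.
  lra.
have lp : 0 < l%:R :> R by lra.
have ln : (4 * l <= n)%N.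
  have : eps * n%:R <= 4^-1 * n%:R by rewrite ler_wpM2r// ltW.
  by rewrite -(ler_nat R) natrM; lra.
clearbody l; have ln' : (l <= n)%N by apply: leq_trans ln; rewrite leq_pmull.
have NN1 : (N1 <= n - l)%N by move: nN1 ln; clear; lia.
have NN2 : (N2 <= n - l)%N by move: nN2 ln; clear; lia.
have Nn2 : (n <= 2 * (n - l))%N by move: ln; clear; lia.
have N0 : (0 < n - l)%N by move: n0 ln; clear; lia.
have Mn2 : (n + l <= 2 * n)%N by move: ln; clear; lia.
have nN1' : (N1 <= n)%N by apply: leq_trans NN1 (leq_subr _ _).
have nN2' : (N2 <= n)%N by apply: leq_trans NN2 (leq_subr _ _).
have Pn := P0 n n0; have PN := P0 _ N0.
have PM : 0 < P (n + l)%N by apply: P0; rewrite addn_gt0 n0.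
have NE : (n - l)%:R = n%:R - l%:R :> R by rewrite natrB.
have ME : (n + l)%:R = n%:R + l%:R :> R by rewrite natrD.
have PnN : P n <= (1 + 6 * eps) * P (n - l)%N.
  have H := Preg (n - l)%N n (leq_subr _ _).
  by apply: regular_weight_left H => //; [rewrite eps0|rewrite NE; lra].
have PMn : (1 - 2 * eps) * P (n + l)%N <= P n.
  have H := Preg n (n + l)%N (leq_addr _ _).
  by apply: regular_weight_right H => //; [exact: ltW|rewrite eps0|rewrite ME; lra].
have etan : eta * n%:R <= e / 20 * l%:R.
  have : e / 40 * (eps * n%:R) <= e / 40 * (2 * l%:R).
    by rewrite ler_wpM2l ?divr_ge0// ltW.
  by rewrite /eta; lra.
clear eN l1 l2 l3 np ME NE; have ba (i m : nat) : (N1 <= i)%N -> (m <= i)%N -> (0 < m)%N -> P m * b i <= kap + eta.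
  move=> Ni mi m0; have Pi := P0 i (leq_trans m0 mi).
  have := bnear i Ni; rewrite ler_norml => /andP[h _].
  have : b i <= (kap + eta) / P i by rewrite ler_pdivlMr//; lra.
  move=> /(ler_wpM2l (ltW (P0 m m0)))/le_trans; apply.
  rewrite mulrA ler_pdivrMr// mulrC ler_wpM2l ?Pmono//; lra.
have bb (i : nat) : (n <= i <= n + l)%N -> kap * (1 - 2 * eps) - eta <= P n * b i.
  move=> /andP[ni inl]; have Pi := P0 i (leq_trans n0 ni).
  have := bnear i (leq_trans nN1' ni); rewrite ler_norml => /andP[_ h].
  have hb : (kap - eta) / P i <= b i by rewrite ler_pdivrMr//; lra.
  have q1 : P n / P i <= 1 by rewrite ler_pdivrMr// mul1r Pmono.
  have q2 : 1 - 2 * eps <= P n / P i.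
    rewrite ler_pdivlMr//; apply: le_trans PMn; rewrite ler_wpM2l ?Pmono//; lra.
  have := ler_wpM2l (ltW Pn) hb; rewrite mulrCA => hb'; apply: le_trans hb'.
  nra.
(* Monotonicity places [a n] below its average over [n - l, n) and, in [lo], above its average over
   [n, n + l). *)
have up : P (n - l)%N * (l%:R * a n) <= l%:R * (kap + eta) + eta * (n - l)%:R.
  have := diff _ NN2 n; rewrite leq_subr Nn2 => /(_ isT) D.
  have h1 : l%:R * a n <= \sum_(n - l <= i < n) a i.
    have -> : l%:R * a n = \sum_(n - l <= i < n) a n.
      by rewrite sumr_const_nat subKn// mulr_natl.
    by apply: ler_sum_nat => i /andP[_ /ltnW]; exact: seq_nonincr.
  have h2 : P (n - l)%N * \sum_(n - l <= i < n) b i <= l%:R * (kap + eta).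
    have -> : l%:R * (kap + eta) = \sum_(n - l <= i < n) (kap + eta).
      by rewrite sumr_const_nat subKn// mulr_natl.
    rewrite big_distrr/=; apply: ler_sum_nat => i /andP[Ni _].
    by apply: ba => //; exact: leq_trans Ni.
  have h3 := ler_norm (\sum_(n - l <= i < n) (a i - b i)).
  rewrite sumrB in h3 D.
  have := ler_wpM2l (ltW PN) h3; have := ler_wpM2l (ltW PN) h1; lra.
have lo : l%:R * (kap * (1 - 2 * eps) - eta) - eta * n%:R <= P n * (l%:R * a n).
  have := diff _ nN2' (n + l)%N; rewrite leq_addr Mn2 => /(_ isT) D.
  have h1 : \sum_(n <= i < n + l) a i <= l%:R * a n.
    have -> : l%:R * a n = \sum_(n <= i < n + l) a n.
      by rewrite sumr_const_nat addKn mulr_natl.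
    by apply: ler_sum_nat => i /andP[ni _]; exact: seq_nonincr.
  have h2 : l%:R * (kap * (1 - 2 * eps) - eta) <= P n * \sum_(n <= i < n + l) b i.
    have -> : l%:R * (kap * (1 - 2 * eps) - eta) =
        \sum_(n <= i < n + l) (kap * (1 - 2 * eps) - eta).
      by rewrite sumr_const_nat addKn mulr_natl.
    rewrite big_distrr/=; apply: ler_sum_nat => i /andP[ni /ltnW il].
    by apply: bb; rewrite ni.
  have h3 := lerNnormlW (lexx `|\sum_(n <= i < n + l) (a i - b i)|).
  rewrite sumrB in h3 D.
  have := ler_wpM2l (ltW Pn) h3; have := ler_wpM2l (ltW Pn) h1; lra.
clear ba bb diff; have etae : eta <= e / 160 by rewrite /eta; nra.
rewrite ler_norml; apply/andP; split.
  have h1 : P n * (l%:R * a n) <= (1 + 6 * eps) * (l%:R * (kap + eta) + e / 20 * l%:R).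
    (* Enlarging the weight from P n to (1 + 6 eps) P (n - l) only preserves the inequality when a n
       >= 0; for a negative value the bound is immediate. *)
    have [an|an] := leP 0 (a n); last first.
      apply: (@le_trans _ _ 0); first by rewrite pmulr_rle0// pmulr_rle0// ltW.
      have q1 : 0 <= l%:R * (kap + eta) by rewrite mulr_ge0 ?(ltW lp)//; lra.
      have q2 : 0 <= e / 20 * l%:R by rewrite mulr_ge0 ?(ltW lp)//; lra.
      by apply: mulr_ge0; lra.
    apply: (@le_trans _ _ ((1 + 6 * eps) * (P (n - l)%N * (l%:R * a n)))).
      by rewrite [leRHS]mulrA ler_wpM2r// mulr_ge0// ltW.
    rewrite ler_wpM2l//; first by lra.
    apply: (le_trans up); rewrite lerD2l; apply: le_trans etan.
    by rewrite ler_wpM2l ?(ltW eta0)// ler_nat leq_subr.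
  have : P n * a n <= (1 + 6 * eps) * (kap + eta + e / 20).
    by rewrite -(ler_pM2l lp); lra.
  nra.
have : kap * (1 - 2 * eps) - eta - e / 20 <= P n * a n.
  by rewrite -(ler_pM2l lp); lra.
nra.
Unshelve. all: by end_near. Qed.

(* The coefficients ['C(2n, n) / 4 ^ n] of the power series of [1 / sqrt (1 - t)]. *)
Fixpoint sqrt_coef (R : realType) (n : nat) : R :=
  if n is m.+1 then sqrt_coef R m * (2 * m%:R + 1) / (2 * m%:R + 2) else 1.

Lemma sqrt_coef_gt0 (R : realType) n : 0 < sqrt_coef R n.
Proof.
elim: n => //= n IH; have n0 : 0 <= n%:R :> R by [].
by rewrite divr_gt0 ?mulr_gt0//; lra.
Qed.

Lemma sqrt_coef_decr (R : realType) n : sqrt_coef R n.+1 <= sqrt_coef R n.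
Proof.
have n0 : 0 <= n%:R :> R by [].
rewrite /= ler_pdivrMr; last by lra.
by rewrite ler_wpM2l ?(ltW (sqrt_coef_gt0 _ _))//; lra.
Qed.

Lemma sqrt_coefS (R : realType) n :
  2 * (n.+1%:R * sqrt_coef R n.+1) = (2 * n%:R + 1) * sqrt_coef R n.
Proof.
have n0 : 0 <= n%:R :> R by [].
by rewrite /= -natr1; field; rewrite gt_eqF//; lra.
Qed.

(** Let c_n be the convolution and s_n the same sum weighted by k. The symmetry k -> n - k gives 2
    s_n = n c_n, and the recurrence of the coefficients gives 2 s_(n+1) = 2 s_n + c_n; together they
    give c_(n+1) = c_n. *)
Lemma sqrt_coef_conv (R : realType) n :
  \sum_(k < n.+1) sqrt_coef R k * sqrt_coef R (n - k) = 1.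
Proof.
pose w := sqrt_coef R; pose c m := \sum_(k < m.+1) w k * w (m - k)%N.
pose s m := \sum_(k < m.+1) k%:R * w k * w (m - k)%N.
have sE m : 2 * s m = m%:R * c m.
  have -> : 2 * s m = s m + s m by ring.
  rewrite {2}/s (reindex_inj rev_ord_inj)/= -big_split/= big_distrr/=.
  apply: eq_bigr => i _; have im : (i <= m)%N by rewrite -ltnS.
  by rewrite subSS subKn// natrB//; ring.
elim: n => [|n IH]; first by rewrite big_ord_recl big_ord0 /= mulr1 addr0.
have sS : 2 * s n.+1 = 2 * s n + c n.
  rewrite /s big_ord_recl/= !mul0r add0r !big_distrr/= -big_split/=.
  apply: eq_bigr => i _; rewrite /bump [(_ + i)%N]add1n subSS.
  have := sqrt_coefS R i; rewrite -/w; set x := w (n - i)%N => e.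
  have -> : 2 * (i.+1%:R * w i.+1 * x) = 2 * (i.+1%:R * w i.+1) * x by ring.
  by rewrite e; ring.
have : n.+1%:R * c n.+1 = n.+1%:R * c n by rewrite -sE sS sE -natr1; ring.
have n0 : n.+1%:R != 0 :> R by rewrite pnatr_eq0.
by move/(mulfI n0); rewrite /c IH.
Qed.

(** The square of the partial sum has coefficients 1 below degree N and in [0, 1] up to degree 2N,
    so it lies between a geometric sum and 1/(1 - t); the square root is then continuous. *)
Lemma sqrt_coef_gen_fun (R : realType) :
  gen_fun (sqrt_coef R) (fun t => (Num.sqrt (1 - t))^-1).
Proof.
move=> t /andP[t0 t1]; have t1' : 0 < 1 - t by lra.
have tx n : 0 <= t ^+ n by rewrite exprn_ge0.
pose p N := \poly_(i < N) sqrt_coef R i.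
have pE N : (p N).[t] = \sum_(k < N) sqrt_coef R k * t ^+ k.
  by rewrite horner_poly.
have w0 n := ltW (sqrt_coef_gt0 R n).
have pp N : (size (p N * p N)%R <= N + N)%N.
  rewrite (leq_trans (size_polyMleq _ _))//.
  by rewrite (leq_trans (leq_pred _))// leq_add// size_poly.
have p0 N i : 0 <= (p N)`_i <= sqrt_coef R i.
  by rewrite coef_poly; case: ifP => _; rewrite ?w0 ?lexx.
have cle N n : 0 <= (p N * p N)`_n <= 1.
  rewrite coefM; apply/andP; split.
    by apply: sumr_ge0 => i _; rewrite mulr_ge0//; [case/andP: (p0 N i)|case/andP: (p0 N (n - i)%N)].
  rewrite -(sqrt_coef_conv R n); apply: ler_sum => i _.
  by have /andP[? ?] := p0 N i; have /andP[? ?] := p0 N (n - i)%N; rewrite ler_pM.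
have ceq N n : (n < N)%N -> (p N * p N)`_n = 1.
  move=> nN; rewrite coefM -[RHS](sqrt_coef_conv R n); apply: eq_bigr => i _.
  by rewrite !coef_poly (leq_trans _ nN) ?(leq_ltn_trans (leq_subr _ _) nN).
have geo N : \sum_(k < N) t ^+ k = (1 - t ^+ N) / (1 - t).
  elim: N => [|N IH]; first by rewrite big_ord0 expr0 subrr mul0r.
  by rewrite big_ord_recr/= IH exprS; field; rewrite gt_eqF.
have sq : (fun N => (p N).[t] ^+ 2) @ \oo --> (1 - t)^-1.
  apply: (@squeeze_cvgr _ _ _ _ (fun N => (1 - t ^+ N) / (1 - t)) (fun=> (1 - t)^-1)).
  - apply: nearW => N; rewrite expr2 -hornerM (horner_coef_wide _ (pp N)); apply/andP; split.
      rewrite -geo big_split_ord/= -[leLHS]addr0; apply: lerD.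
        by apply: ler_sum => i _; rewrite ceq// mul1r.
      by apply: sumr_ge0 => i _; rewrite mulr_ge0//; case/andP: (cle N (N + i)%N).
    apply: (@le_trans _ _ (\sum_(k < N + N) t ^+ k)).
      by apply: ler_sum => i _; rewrite ler_piMl//; case/andP: (cle N i).
    by rewrite geo -[leRHS]mul1r ler_pM2r ?invr_gt0// lerBlDr lerDl.
  - rewrite -[X in _ --> X]mul1r; apply: cvgMl.
    rewrite -[X in _ --> X]subr0; apply: cvgB; first exact: cvg_cst.
    by apply: cvg_expr; rewrite ger0_norm.
  - exact: cvg_cst.
split; rewrite (_ : series _ = fun N => Num.sqrt ((p N).[t] ^+ 2)); last first.
  apply/funext => N; rewrite seriesX sqrtr_sqr ger0_norm pE//.
  by apply: sumr_ge0 => i _; rewrite mulr_ge0.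
rewrite -sqrtrV ?ltW//.
exact: (continuous_cvg _ (@sqrt_continuous R _) sq).
Qed.

(** The reduction formula for the primitive of sin^n vanishing at 0. The Wallis integrals are its
    values at pi/2. *)
Fixpoint sin_primitive (R : realType) (n : nat) (x : R) : R :=
  match n with
  | 0%N => x
  | 1%N => 1 - cos x
  | m.+2 => (m.+1%:R * sin_primitive m x - sin x ^+ m.+1 * cos x) / m.+2%:R
  end.

Lemma nat_ind2 (Q : nat -> Prop) :
  Q 0%N -> Q 1%N -> (forall n, Q n -> Q n.+2) -> forall n, Q n.
Proof.
move=> Q0 Q1 QS n; suff : Q n /\ Q n.+1 by case.
by elim: n => // n [? ?]; split=> //; exact: QS.
Qed.

Lemma sin_primitive_is_derive (R : realType) n (x : R) :
  is_derive x 1 (sin_primitive n) (sin x ^+ n).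
Proof.
elim/nat_ind2: n => [||n IH].
- by rewrite expr0; exact: is_derive_id.
- rewrite (_ : sin_primitive 1 = cst 1 - cos) //.
  by apply: is_derive_eq; rewrite sub0r opprK expr1.
- rewrite (_ : sin_primitive _ =
    (n.+2%:R^-1 \*: (n.+1%:R \*: sin_primitive n - sin ^+ n.+1 * cos))); last first.
    by apply/funext => y; rewrite !fctE /= mulrC.
  apply: is_derive_eq; rewrite exprfctE /GRing.scale/=.
  have := cos2sin2 x; set c := cos x; set s := sin x => cs.
  have n2 : n.+2%:R != 0 :> R by rewrite pnatr_eq0.
  apply: (mulfI n2); rewrite mulVKf//.
  have -> : n.+1%:R * s ^+ n - (s ^+ n.+1 * - s + c * (n.+1%:R * s ^+ n * c)) =
    n.+1%:R * s ^+ n * (1 - c ^+ 2) + s ^+ n.+1 * s by ring.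
  by rewrite cs -[in RHS]natr1 !exprS; ring.
Qed.

Lemma sin_primitive0 (R : realType) n : sin_primitive n (0 : R) = 0.
Proof.
elim/nat_ind2: n => [||n IH] /=; rewrite ?cos0 ?subrr//.
by rewrite IH sin0 expr0n/= mulr0 mul0r subrr mul0r.
Qed.

Lemma sin_primitive_decr (R : realType) n :
  sin_primitive n.+1 (pi / 2) <= sin_primitive n (pi / 2) :> R.
Proof.
pose f : R -> R := sin_primitive n - sin_primitive n.+1.
have df (x : R) : is_derive x 1 f (sin x ^+ n - sin x ^+ n.+1).
  by apply: is_deriveB; exact: sin_primitive_is_derive.
have p2 : 0 < pi / 2 :> R by rewrite divr_gt0// pi_gt0.
have f0 : f 0 = 0 by rewrite /f !fctE !sin_primitive0 subrr.
suff : f 0 <= f (pi / 2) by rewrite f0 /f !fctE subr_ge0.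
apply: (@ger0_derive1_le_cc _ f 0 (pi / 2)).
- by move=> x _; case: (df x).
- move=> x; rewrite in_itv/= => /andP[x0 xp]; rewrite derive1E (@derive_val _ _ _ _ _ _ _ (df x)).
  have := sin_gt0_pihalf; move=> /(_ _ x); rewrite x0 xp => /(_ isT) s0.
  rewrite exprS -{1}[_ ^+ n]mul1r -mulrBl mulr_ge0 ?exprn_ge0 ?(ltW s0)//.
- apply: continuous_subspaceT => x; apply: differentiable_continuous.
  by apply/derivable1_diffP; case: (df x).
- by rewrite in_itv/= lexx ltW.
- by rewrite in_itv/= lexx ltW.
- exact: ltW.
Qed.

Lemma sin_primitive_pihalf (R : realType) n :
  n.+2%:R * sin_primitive n.+2 (pi / 2) = n.+1%:R * sin_primitive n (pi / 2) :> R.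
Proof.
by rewrite /= cos_pihalf mulr0 subr0 mulrC divfK// pnatr_eq0.
Qed.

Lemma wallis_even (R : realType) n :
  sin_primitive (2 * n) (pi / 2) = pi / 2 * sqrt_coef R n.
Proof.
elim: n => [|n IH]; first by rewrite muln0 /= mulr1.
have n2 : (2 * n).+2%:R != 0 :> R by rewrite pnatr_eq0.
apply: (mulfI n2); rewrite mulnS add2n sin_primitive_pihalf IH /=.
have n0 : 0 <= n%:R :> R by [].
have -> : (2 * n).+2%:R = 2 * n%:R + 2 :> R by rewrite -addn2 natrD natrM.
have -> : (2 * n).+1%:R = 2 * n%:R + 1 :> R by rewrite -addn1 natrD natrM.
by field; rewrite gt_eqF//; lra.
Qed.

Lemma wallis_odd (R : realType) n :
  (2 * n%:R + 1) * sqrt_coef R n * sin_primitive (2 * n).+1 (pi / 2) = 1.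
Proof.
have n0 : 0 <= n%:R :> R by [].
elim: n {n0} => [|n IH]; first by rewrite muln0 /= cos_pihalf; ring.
have n0 : 0 <= n%:R :> R by [].
have e : (2 * n%:R + 3) * sin_primitive (2 * n.+1).+1 (pi / 2) =
    (2 * n%:R + 2) * sin_primitive (2 * n).+1 (pi / 2) :> R.
  rewrite mulnS add2n; have := sin_primitive_pihalf R (2 * n).+1.
  have -> : (2 * n).+3%:R = 2 * n%:R + 3 :> R by rewrite -addn3 natrD natrM.
  by have -> : (2 * n).+2%:R = 2 * n%:R + 2 :> R by rewrite -addn2 natrD natrM.
have nE : n.+1%:R = n%:R + 1 :> R by rewrite natr1.
rewrite -[RHS]IH (_ : 2 * n.+1%:R + 1 = 2 * n%:R + 3); last by rewrite nE; ring.
rewrite mulrAC e /=; field; rewrite gt_eqF//; lra.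
Qed.

(** Wallis: the integrals of orders 2n and 2n + 2 are multiples of pi w_n and pi w_(n+1), the one of
    order 2n + 1 is 1 / ((2n + 1) w_n), and their monotonicity encloses n w_n^2 between (1 - 1/(n +
    1)) / pi and 1 / pi. *)
Lemma sqrt_coef_equiv (R : realType) :
  Num.sqrt n%:R * sqrt_coef R n @[n --> \oo] --> (Num.sqrt pi)^-1.
Proof.
have pi0 := pi_gt0 R.
rewrite -sqrtrV ?ltW//.
rewrite (_ : (fun _ => _) = fun n => Num.sqrt (n%:R * sqrt_coef R n ^+ 2)); last first.
  apply/funext => n; rewrite sqrtrM// sqrtr_sqr ger0_norm//.
  exact/ltW/sqrt_coef_gt0.
apply: (continuous_cvg _ (@sqrt_continuous R _)).
apply: (@squeeze_cvgr _ _ _ _ (fun n => pi^-1 - pi^-1 * harmonic n) (fun=> pi^-1)).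
- apply: nearW => n; rewrite /harmonic /=.
  have n0 : 0 <= n%:R :> R by [].
  have o := wallis_odd R n; have w0 := sqrt_coef_gt0 R n.
  have h1 := sin_primitive_decr R (2 * n)%N.
  have h2 := sin_primitive_decr R (2 * n).+1.
  have e2 := wallis_even R n.+1; rewrite mulnS add2n in e2.
  rewrite e2 in h2; rewrite wallis_even in h1.
  have wS : sqrt_coef R n.+1 = sqrt_coef R n * (2 * n%:R + 1) / (2 * n%:R + 2) by [].
  move: o w0 h1 h2; rewrite wS; set w := sqrt_coef R n; set J := sin_primitive _ _.
  move=> o w0 h1 h2.
  have i0 : 0 < n%:R + 1 :> R by lra.
  have f1 : 2 <= (2 * n%:R + 1) * (pi * w ^+ 2).
    have : (2 * n%:R + 1) * w * J <= (2 * n%:R + 1) * w * (pi / 2 * w).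
      by rewrite ler_wpM2l// mulr_ge0 ?(ltW w0)//; lra.
    by rewrite o; lra.
  have f2 : pi * w ^+ 2 * (2 * n%:R + 1) ^+ 2 <= 4 * (n%:R + 1).
    have : (2 * n%:R + 1) * w * (pi / 2 * (w * (2 * n%:R + 1) / (2 * n%:R + 2))) <=
      (2 * n%:R + 1) * w * J by rewrite ler_wpM2l// mulr_ge0 ?(ltW w0)//; lra.
    rewrite o !mulrA ler_pdivrMr; last by lra.
    lra.
  have e : n%:R * w ^+ 2 = pi^-1 * (n%:R * (pi * w ^+ 2)) by rewrite [RHS]mulrCA mulKf// gt_eqF.
  have pi0' : 0 <= pi^-1 :> R by rewrite invr_ge0 ltW.
  rewrite e -{1}[pi^-1]mulr1 -mulrBr -{4}[pi^-1]mulr1.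
  move: f1 f2; set W := pi * w ^+ 2 => f1 f2.
  have nE : (n.+1%:R : R) = n%:R + 1 by rewrite natr1.
  apply/andP; split; apply: ler_wpM2l => //.
    rewrite nE -(ler_pM2r i0) mulrBl mulVf ?gt_eqF//.
    have := ler_wpM2l n0 f1; nra.
  have k0 : 0 < (2 * n%:R + 1) ^+ 2 :> R by rewrite exprn_gt0//; lra.
  rewrite -(ler_pM2r k0) -mulrA; apply: le_trans (ler_wpM2l n0 f2) _; lra.
- rewrite -[X in _ --> X]subr0 -[in X in _ --> X](mulr0 pi^-1).
  by apply: cvgB; [exact: cvg_cst|apply: cvgMr; exact: cvg_harmonic].
- exact: cvg_cst.
Qed.

(** The model is K times the coefficients of 1 / sqrt(1 - t), whose generating function has the same
    leading behaviour as [ya]. [tauberian_sum] compares the partial sums, and [monotone_density]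
    with weight sqrt n returns to the terms. *)
Lemma tauberian_half (R : realType) (a : nat -> R) (ya : R -> R) (K : R) :
  (forall n, 0 <= a n) -> (forall n, a n.+1 <= a n) -> gen_fun a ya ->
  0 < K -> Num.sqrt (1 - t) * ya t @[t --> 1^'-] --> K ->
  Num.sqrt n%:R * a n @[n --> \oo] --> K / Num.sqrt pi.
Proof.
move=> a0 a_dec ay K0 aK.
pose w n := K * sqrt_coef R n.
have wy : gen_fun w (fun t => K * (Num.sqrt (1 - t))^-1).
  move=> t t01; apply: eq_has_sum (has_sumZ K (sqrt_coef_gen_fun t01)) _ => n.
  by rewrite /w mulrA.
have w0 n : 0 <= w n by rewrite mulr_ge0 ?ltW ?sqrt_coef_gt0.
have w_dec n : w n.+1 <= w n by rewrite ler_wpM2l ?(ltW K0) ?sqrt_coef_decr.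
have wK (t : R) : t < 1 -> Num.sqrt (1 - t) * (K * (Num.sqrt (1 - t))^-1) = K.
  by move=> t1; rewrite mulrCA mulfV ?mulr1// gt_eqF// sqrtr_gt0 subr_gt0.
have near_lt1 : \forall t \near (1 : R)^'-, t < 1 by exact: nbhs_left_lt.
have diff : Num.sqrt (1 - t) * (ya t - K * (Num.sqrt (1 - t))^-1) @[t --> 1^'-] --> (0 : R).
  rewrite -(subrr K).
  apply: cvg_trans (cvgB aK (cvg_cst K)); apply: near_eq_cvg.
  by apply: filterS near_lt1 => t t1; rewrite mulrBr wK.
have bnd : \forall t \near 1^'-, Num.sqrt (1 - t) * (ya t + K * (Num.sqrt (1 - t))^-1) <= 2 * K + 1.
  move/cvgrPdist_lt: aK => /(_ 1 ltr01) aK; near=> t.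
  rewrite mulrDr wK; last by near: t.
  have : `|K - Num.sqrt (1 - t) * ya t| < 1 by near: t.
  by rewrite ltr_norml; lra.
have K1 : 0 < 2 * K + 1 by lra.
have S := tauberian_sum a0 a_dec ay w0 w_dec wy K1 bnd diff.
apply: (@monotone_density _ (fun n => Num.sqrt n%:R) a w).
- by move=> n n0; rewrite sqrtr_gt0 ltr0n.
- by move=> m n mn; rewrite ler_wsqrtr// ler_nat.
- move=> m n mn; have m0 := sqrtr_ge0 (m%:R : R); have n0 := sqrtr_ge0 (n%:R : R).
  have mE : m%:R = Num.sqrt m%:R ^+ 2 :> R by rewrite sqr_sqrtr.
  have nE : n%:R = Num.sqrt n%:R ^+ 2 :> R by rewrite sqr_sqrtr.
  have : Num.sqrt m%:R <= Num.sqrt n%:R :> R by rewrite ler_wsqrtr// ler_nat.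
  move: mE nE m0 n0; set x := Num.sqrt m%:R; set y := Num.sqrt n%:R.
  move=> -> -> x0 y0 xy; have x3 : x ^+ 3 <= y ^+ 3 by rewrite lerXn2r.
  have xy0 : 0 <= x * y by rewrite mulr_ge0.
  have := ler_wpM2l xy0 x3; rewrite !exprS !expr0; lra.
- by rewrite divr_ge0 ?sqrtr_ge0 ?ltW.
- exact: a_dec.
- rewrite (_ : (fun _ => _) = fun n => K * (Num.sqrt n%:R * sqrt_coef R n)).
    by apply: cvgMr; exact: sqrt_coef_equiv.
  by apply/funext => n; rewrite /w mulrCA.
move=> eta eta0; have e3 : 0 < eta / 3 by lra.
have [N0 _ {}S] := S _ e3.
exists N0 => // N /= N0N M /andP[NM M2].
have SN := S N N0N; have SM := S M (leq_trans N0N NM).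
have NE : Num.sqrt N%:R * Num.sqrt N%:R = N%:R :> R by rewrite -expr2 sqr_sqrtr.
have r0 := sqrtr_ge0 (N%:R : R).
have rM : Num.sqrt M%:R <= 2 * Num.sqrt N%:R :> R.
  by apply: sqrtr_nat_half; apply: leq_trans M2 _; rewrite leq_mul2r orbT.
have -> : \sum_(N <= n < M) (a n - w n) =
    \sum_(n < M) (a n - w n) - \sum_(n < N) (a n - w n).
  by rewrite -!(seriesX (fun n => a n - w n)) sub_series_geq.
have le : `|\sum_(n < M) (a n - w n) - \sum_(n < N) (a n - w n)| <= eta * Num.sqrt N%:R.
  apply: (le_trans (ler_normB _ _)).
  have := ler_wpM2l (ltW e3) rM; lra.
by have := ler_wpM2l r0 le; rewrite mulrCA NE.
Unshelve. all: by end_near. Qed.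

Lemma sqrt_ratio_cvg1 (R : realType) :
  Num.sqrt n%:R / Num.sqrt n.+1%:R @[n --> \oo] --> (1 : R).
Proof.
rewrite (_ : (fun _ => _) = fun n => Num.sqrt (1 - harmonic n)); last first.
  apply/funext => n; rewrite /harmonic/= -sqrtrV// -sqrtrM//; congr Num.sqrt.
  have n1 : n.+1%:R != 0 :> R by rewrite pnatr_eq0.
  by apply: (mulIf n1); rewrite mulrBl divfK// mulVf// mul1r -[n.+1%:R]natr1 addrK.
rewrite -[X in _ --> X](@sqrtr1 R); apply: (continuous_cvg _ (@sqrt_continuous R _)).
rewrite -[X in _ --> X]subr0; apply: cvgB; [exact: cvg_cst|exact: cvg_harmonic].
Qed.

(** The remainders s_n have a generating function of order (1 - t)^(-1/2), so [tauberian_half] gives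
    s_n ~ K / sqrt(pi n). The terms are differences of remainders and are compared with the
    differences of K / sqrt(pi n), now with weight n^(3/2). *)
Lemma tauberian_three_half (R : realType) (a : nat -> R) (y : R -> R) (Y K : R) :
  (forall n, 0 <= a n) -> (forall n, a n.+1 <= a n) -> gen_fun a y ->
  0 < K -> y t @[t --> 1^'-] --> Y ->
  Num.sqrt (1 - t) * ((Y - y t) / (1 - t)) @[t --> 1^'-] --> K ->
  n%:R * Num.sqrt n%:R * a n @[n --> \oo] --> K / (2 * Num.sqrt pi).
Proof.
move=> a0 a_dec ay K0 yY H.
have sumY := gen_fun_sum_le ay a0 yY.
pose s n := Y - \sum_(k < n) a k.
have s0 n : 0 <= s n by rewrite subr_ge0.
have sS n : s n.+1 = s n - a n by rewrite /s big_ord_recr/=; ring.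
have sY n : s n <= Y by rewrite /s lerBlDr lerDl sumr_ge0.
have Ygf : gen_fun (fun n => s n.+1) (fun t => (Y - y t) / (1 - t)).
  by apply: (@tails_gen_fun _ _ _ _ _ Y ay) => n //; rewrite ger0_norm.
(* [s] starts one index earlier than the tails of [tails_gen_fun]; this adds y t, which is bounded
   near 1 and disappears after multiplication by sqrt(1 - t). *)
have sgf : gen_fun s (fun t => (Y - y t) / (1 - t) + y t).
  move=> t t01; apply: eq_has_sum (has_sumD (Ygf t t01) (ay t t01)) _ => n.
  by rewrite -mulrDl sS subrK.
have sqrt0 : Num.sqrt (1 - t) @[t --> 1^'-] --> (0 : R).
  rewrite -[X in _ --> X](@sqrtr0 R); apply: cvg_at_left_filter.
  apply: (continuous_cvg _ (@sqrt_continuous R _)).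
  by rewrite -[X in _ --> X](subrr (1 : R)); apply: cvgB; [exact: cvg_cst|exact: cvg_id].
have sK : Num.sqrt n%:R * s n @[n --> \oo] --> K / Num.sqrt pi.
  apply: tauberian_half sgf K0 _ => // [n|]; first by rewrite sS gerBl.
  rewrite -[X in _ --> X]addr0 -(mul0r Y).
  under eq_fun do rewrite mulrDr.
  by apply: cvgD => //; exact: cvgM.
pose c := K / Num.sqrt pi.
have c0 : 0 <= c by rewrite divr_ge0 ?sqrtr_ge0 ?ltW.
(* The model for the remainders. At n = 0 it is 0 by the convention for division, and this value
   cancels in sums over a window. *)
pose v n := c / Num.sqrt n%:R : R.
pose b n := v n - v n.+1.
have r0 n : 0 <= Num.sqrt n%:R :> R by rewrite sqrtr_ge0.
have rE n : Num.sqrt n%:R * Num.sqrt n%:R = n%:R :> R by rewrite -expr2 sqr_sqrtr.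
have rmono m n : (m <= n)%N -> Num.sqrt m%:R <= Num.sqrt n%:R :> R.
  by move=> mn; rewrite ler_wsqrtr// ler_nat.
have rp n : (0 < n)%N -> 0 < Num.sqrt n%:R :> R by rewrite sqrtr_gt0 ltr0n.
rewrite invfM mulrCA -/c mulrC.
apply: (@monotone_density _ (fun n => n%:R * Num.sqrt n%:R) a b).
- by move=> n n0; rewrite mulr_gt0 ?rp ?ltr0n.
- by move=> m n mn; rewrite ler_pM ?ler_nat ?rmono.
- move=> m n mn; move: (rE m) (rE n) (r0 m) (r0 n) (rmono _ _ mn).
  set x := Num.sqrt m%:R; set z := Num.sqrt n%:R => <- <- x0 z0 xz.
  have xz0 : 0 <= (x * z) ^+ 3 by rewrite exprn_ge0// mulr_ge0.
  by have := ler_wpM2l xz0 xz; rewrite !exprMn !exprS !expr0; lra.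
- by rewrite divr_ge0.
- exact: a_dec.
(* With q = sqrt(n / (n + 1)), the weighted model n^(3/2) b_n equals c q^2 / (1 + q); its limit c /
   2 is the source of the 2 in the conclusion. *)
- pose q n := Num.sqrt n%:R / Num.sqrt n.+1%:R : R.
  rewrite (_ : (fun _ => _) = fun n => c * (q n ^+ 2 / (1 + q n))); last first.
    apply/funext => n; have x0 := r0 n; have z0 := rp n.+1 isT.
    rewrite /b /v /q; move: (rmono _ _ (leqnSn n)) (rE n.+1) (rE n) x0 z0.
    set x := Num.sqrt n%:R; set z := Num.sqrt n.+1%:R => xz zz xx x0 z0.
    rewrite -xx; have zx : z * z = x * x + 1 by rewrite zz xx natr1.
    have [xe|xn] := eqVneq x 0; first by rewrite xe; ring.
    have z0' : z != 0 by rewrite gt_eqF.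
    have xz0 : z + x != 0 by rewrite gt_eqF// ltr_wpDr.
    have h : z - x = (z + x)^-1.
      by apply: (mulIf xz0); rewrite mulVf// -subr_sqr !expr2 zx; ring.
    have -> : x * x * x * (c / x - c / z) = c * (x * x * (z - x) / z).
      by field; rewrite ?xn ?z0'.
    by rewrite h; field; rewrite ?z0' ?xz0.
  have q1 : q @ \oo --> (1 : R) by exact: sqrt_ratio_cvg1.
  apply: cvgMr; rewrite [X in _ --> X](_ : _ = 1 ^+ 2 / (1 + 1)); last by rewrite expr1n mul1r.
  apply: cvgM.
    by rewrite expr2; under eq_fun do rewrite expr2; exact: cvgM.
  apply: cvgV; first by rewrite gt_eqF//; lra.
  by apply: cvgD => //; exact: cvg_cst.
move=> eta eta0; have e3 : 0 < eta / 3 by lra.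
have [N0 _ {}S] : \forall n \near \oo, `|c - Num.sqrt n%:R * s n| <= eta / 2.
  by move/cvgrPdist_le: sK; apply; lra.
exists N0.+1 => // N /= N0N M /andP[NM M2].
have SN := S N (ltnW N0N); have SM := S M (leq_trans (ltnW N0N) NM).
have xp := rp N (leq_ltn_trans (leq0n _) N0N).
have zp := rp M (leq_trans (leq_ltn_trans (leq0n _) N0N) NM).
have -> : \sum_(N <= n < M) (a n - b n) = (s N - v N) - (s M - v M).
  rewrite -sub_series_geq//.
  have tel n : series (fun n => a n - b n) n = (s 0%N - v 0%N) - (s n - v n).
    rewrite seriesX; elim: n => [|n IH]; first by rewrite big_ord0 subrr.
    by rewrite big_ord_recr/= IH sS /b; ring.
  by rewrite !tel; ring.
have dist n : 0 < Num.sqrt n%:R :> R -> `|c - Num.sqrt n%:R * s n| <= eta / 2 ->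
    Num.sqrt n%:R * `|s n - v n| <= eta / 2.
  move=> n0; have e : Num.sqrt n%:R * v n = c by rewrite /v mulrCA mulfV ?gt_eqF// mulr1.
  by rewrite -{1}e -mulrBr normrM distrC ger0_norm// ltW.
have dN := dist _ xp SN; have dM := dist _ zp SM.
have xz := rmono _ _ NM.
have tri := ler_normB (s N - v N) (s M - v M).
have NN := rE N; set x := Num.sqrt N%:R in NN xp dN xz *.
have d : x * `|s N - v N - (s M - v M)| <= eta.
  have h1 := ler_wpM2l (ltW xp) tri.
  have h2 : x * `|s M - v M| <= Num.sqrt M%:R * `|s M - v M| by rewrite ler_wpM2r.
  lra.
by rewrite -mulrA [leRHS]mulrC ler_wpM2l.
Qed.

(** * Functions that are smooth at 1 *)

(* Functions with an asymptotic expansion to order [k] in powers of [1 - t],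
   as [t] tends to [1], with a remainder bounded on the whole of [0, 1). *)
Fixpoint expandable (R : realType) (k : nat) (f : R -> R) : Prop :=
  if k is j.+1 then
    exists L g, (forall t : R, 0 <= t < 1 -> f t = L - (1 - t) * g t) /\ expandable j g
  else exists M, forall t : R, 0 <= t < 1 -> `|f t| <= M.

Lemma expandable_bounded (R : realType) k (f : R -> R) :
  expandable k f -> exists M, forall t : R, 0 <= t < 1 -> `|f t| <= M.
Proof.
elim: k f => // k IH f [L [g [fE /IH[M gM]]]].
exists (`|L| + M) => t t01; rewrite fE//.
apply: (le_trans (ler_normB _ _)); rewrite lerD2l normrM.
have := gM t t01; have := normr_ge0 (g t).
have -> : `|1 - t| = 1 - t by rewrite ger0_norm//; lra.
nra.
Qed.

Lemma expandableS (R : realType) k (f : R -> R) : expandable k.+1 f -> expandable k f.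
Proof.
elim: k f => [|k IH] f; first exact: expandable_bounded.
by move=> [L [g [fE /IH gk]]]; exists L, g.
Qed.

Lemma eq_expandable (R : realType) k (f g : R -> R) :
  (forall t : R, 0 <= t < 1 -> f t = g t) -> expandable k f -> expandable k g.
Proof.
case: k => [|k] fg /=.
  by move=> [M fM]; exists M => t t01; rewrite -fg// fM.
by move=> [L [g' [fE ?]]]; exists L, g'; split=> // t t01; rewrite -fg// fE.
Qed.

Lemma expandable_cst (R : realType) k (c : R) : expandable k (fun=> c).
Proof.
elim: k c => [|k IH] c /=; first by exists `|c|.
by exists c, (fun=> 0); split => // t _; rewrite mulr0 subr0.
Qed.

Lemma expandableD (R : realType) k (f g : R -> R) :
  expandable k f -> expandable k g -> expandable k (fun t => f t + g t).
Proof.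
elim: k f g => [|k IH] f g /=.
  move=> [M fM] [N gN]; exists (M + N) => t t01.
  by apply: (le_trans (ler_normD _ _)); rewrite lerD ?fM ?gN.
move=> [L [f' [fE f'k]]] [M [g' [gE g'k]]]; exists (L + M), (fun t => f' t + g' t).
by split; [move=> t t01; rewrite fE// gE//; ring|exact: IH].
Qed.

Lemma expandableM (R : realType) k (f g : R -> R) :
  expandable k f -> expandable k g -> expandable k (fun t => f t * g t).
Proof.
elim: k f g => [|k IH] f g.
  move=> [M fM] [N gN]; exists (M * N) => t t01.
  by rewrite normrM ler_pM ?fM ?gN.
move=> fk gk; have gk' := expandableS gk.
move: fk gk => [L [f' [fE f'k]]] [M [g' [gE g'k]]].
exists (L * M), (fun t => f' t * g t + L * g' t); split.
  by move=> t t01; rewrite fE// gE//; ring.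
by apply: expandableD; apply: IH => //; exact: expandable_cst.
Qed.

Lemma expandable1B (R : realType) k : expandable k (fun t : R => 1 - t).
Proof.
case: k => [|k] /=; first by exists 1 => t t01; rewrite ger0_norm; lra.
exists 0, (fun=> -1); split; last exact: expandable_cst.
by move=> t _; ring.
Qed.

(** From f = L - (1 - t) g follows 1/f = 1/L + (1 - t) g / (L f), where the 1/f on the right is only
    needed to one order less. *)
Lemma expandable_inv (R : realType) k (f : R -> R) (m : R) : 0 < m ->
  (forall t : R, 0 <= t < 1 -> m <= f t) -> expandable k f -> expandable k (fun t => (f t)^-1).
Proof.
move=> m0; elim: k f => [|k IH] f fm.
  move=> _; exists m^-1 => t t01; have := fm t t01 => mf.
  by rewrite normfV lef_pV2 ?posrE ?normr_gt0 ?gt_eqF// ?ger0_norm//; lra.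
move=> fk; have fk' := IH _ fm (expandableS fk).
move: fk => [L [g [fE gk]]].
(* L is the limit of f at 1 and inherits the lower bound; [s] is a distance from 1 at which a
   smaller L would contradict it. *)
have mL : m <= L.
  have [M gM] := expandable_bounded gk.
  have M0 : 0 <= M.
    by apply: le_trans (normr_ge0 (g 0)) (gM 0 _); rewrite lexx ltr01.
  rewrite leNgt; apply/negP => Lm.
  pose s := Num.min 1 ((m - L) / (2 * (M + 1))).
  have k0 : 0 < 2 * (M + 1) by lra.
  have s0 : 0 < s by rewrite lt_min ltr01 divr_gt0//; lra.
  have s1 : s <= 1 by rewrite ge_min lexx.
  have sM : s * (2 * (M + 1)) <= m - L.
    by rewrite -ler_pdivlMr// ge_min lexx orbT.
  have t01 : 0 <= 1 - s < 1 by lra.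
  have := fm _ t01; rewrite fE// (_ : 1 - (1 - s) = s); last by ring.
  have := gM _ t01; rewrite ler_norml => /andP[h _].
  nra.
exists L^-1, (fun t => - (g t * (L^-1 * (f t)^-1))); split.
  move=> t t01; have f0 : f t != 0 by rewrite gt_eqF//; have := fm t t01; lra.
  have L0 : L != 0 by rewrite gt_eqF//; lra.
  have -> : (1 - t) * - (g t * (L^-1 * (f t)^-1)) = (f t - L) * (L^-1 * (f t)^-1).
    have -> : f t - L = - (1 - t) * g t by rewrite fE//; ring.
    by ring.
  by field; rewrite L0 f0.
apply: (@eq_expandable _ _ (fun t => -1 * (g t * (L^-1 * (f t)^-1)))).
  by move=> t _; rewrite mulN1r.
apply: expandableM; first exact: expandable_cst.
by apply: expandableM => //; apply: expandableM => //; exact: expandable_cst.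
Qed.

Lemma bounded_gen_fun_sum_le (R : realType) (a : nat -> R) (y : R -> R) (M : R) :
  gen_fun a y -> (forall n, 0 <= a n) -> (forall t : R, 0 <= t < 1 -> `|y t| <= M) ->
  forall N, \sum_(k < N) a k <= M.
Proof.
move=> ay a0 yM N.
have c := @cvg_left1_sum _ a N.
rewrite -(cvg_lim _ c)//; apply: limr_le; first by apply/cvg_ex; eexists; exact: c.
near=> t; have t01 : 0 <= t < 1.
  by apply/andP; split; near: t; [exact: nbhs_left_ge|exact: nbhs_left_lt].
apply: le_trans (le_trans (ler_norm _) (yM t t01)).
apply: (has_sum_ge (ay t t01)) => n _.
by apply: mulr_ge0 => //; apply: exprn_ge0; lra.
Unshelve. all: by end_near. Qed.

(** One order of the expansion is traded for one power of n: the remainders [r] have generating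
    function [g], and monotonicity gives (m + 1) a_(2m+1) <= r_m. *)
Lemma expandable_coef_bound (R : realType) k (a : nat -> R) (y : R -> R) :
  (forall n, 0 <= a n) -> (forall n, a n.+1 <= a n) -> gen_fun a y -> expandable k y ->
  exists C, forall n, n.+1%:R ^+ k.+1 * a n <= C.
Proof.
elim: k a y => [|k IH] a y a0 a_dec ay.
  move=> [M yM]; exists M => n; apply: le_trans (bounded_gen_fun_sum_le ay a0 yM n.+1).
  rewrite expr1 mulr_natl -[X in _ *+ X]card_ord -sumr_const; apply: ler_sum => i _.
  by apply: seq_nonincr a_dec _; rewrite -ltnS.
move=> [L [g [yE gk]]].
have [M gM] := expandable_bounded gk.
have yL : y t @[t --> 1^'-] --> L.
  have M0 : 0 <= M.
    by apply: le_trans (normr_ge0 (g 0)) (gM 0 _); rewrite lexx ltr01.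
  apply/cvg_left1P => e e0; have k0 : 0 < M + 1 by lra.
  exists (Num.max 0 (1 - e / (M + 1))).
    by rewrite gt_max ltr01/= ltrBlDr ltrDl divr_gt0.
  move=> t /andP[]; rewrite gt_max => /andP[t0]; rewrite ltrBlDr -ltrBlDl.
  rewrite ltr_pdivlMr// => h t1; have t01 : 0 <= t < 1 by lra.
  rewrite yE// addrAC subrr sub0r normrN normrM ger0_norm; last by lra.
  have := gM t t01; have := normr_ge0 (g t); nra.
have sumL := gen_fun_sum_le ay a0 yL.
pose r n := L - \sum_(k < n.+1) a k.
have r0 n : 0 <= r n by rewrite subr_ge0.
have rL n : `|r n| <= L.
  by rewrite ger0_norm// /r lerBlDr lerDl sumr_ge0.
have rgf : gen_fun r g.
  move=> t t01.
  have -> : g t = (L - y t) / (1 - t) by rewrite yE//; field; lra.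
  exact: (tails_gen_fun ay _ rL).
have r_dec n : r n.+1 <= r n by rewrite /r [in leLHS]big_ord_recr/= opprD addrA gerBl.
have [C rC] := IH r g r0 r_dec rgf gk.
have C0 : 0 <= C by apply: le_trans (rC 0%N); rewrite mulr_ge0.
(* The term a_0 covers the index 0. For the index n + 1 with m the integer part of n/2, one has n +
   2 <= 3 (m + 1). *)
exists (a 0%N + 3 ^+ k.+2 * C) => n.
have odd_bound m : m.+1%:R ^+ k.+2 * a (2 * m).+1 <= C.
  have : m.+1%:R * a (2 * m).+1 <= r m.
    have := sumL (m.+1 + m.+1)%N; rewrite big_split_ord/= /r lerBrDl; apply: le_trans.
    rewrite lerD2l mulr_natl -[X in _ *+ X]card_ord -sumr_const; apply: ler_sum => i _.
    by apply: seq_nonincr a_dec _; rewrite mul2n -addnn -addSn leq_add2l -ltnS.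
  have m0 : 0 <= m.+1%:R ^+ k.+1 :> R by rewrite exprn_ge0.
  move=> /(ler_wpM2l m0) h; apply: le_trans (rC m); apply: le_trans h.
  by rewrite mulrA -exprSr.
case: n => [|n].
  by rewrite expr1n mul1r lerDl mulr_ge0// exprn_ge0.
pose m := n./2; have nE := odd_double_half n.
have h1 : a n.+1 <= a (2 * m).+1.
  by apply: seq_nonincr a_dec _; rewrite mul2n ltnS -[leqRHS]nE leq_addl.
have h2 : n.+2%:R <= 3 * m.+1%:R :> R.
  rewrite -natrM ler_nat -nE -/m -mul2n; case: (odd n) => /=; clear; lia.
apply: (@le_trans _ _ ((3 * m.+1%:R) ^+ k.+2 * a (2 * m).+1)).
  by rewrite ler_pM ?exprn_ge0// lerXn2r ?nnegrE// mulr_ge0.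
rewrite exprMn -mulrA; apply: (@le_trans _ _ (3 ^+ k.+2 * C)).
  by rewrite ler_wpM2l ?exprn_ge0.
by rewrite lerDr.
Qed.

(** * The equation satisfied by the tails *)

(** [qA] is E t^(1 + X), and [qk] below is the quotient of [qA al t - t] by 1 - t. *)
Definition qA (R : realType) (al t : R) : R := 1 - al * (1 - t ^+ 2).
Definition qk (R : realType) (al t : R) : R := 1 - al - al * t.

Lemma qA_gt0 (R : realType) (al t : R) : 0 < al < 1 -> 0 < qA al t.
Proof. by move=> /andP[a0 a1]; rewrite /qA; have := sqr_ge0 t; nra. Qed.

Lemma qA_itv (R : realType) (al t : R) : 0 < al < 1 -> 0 <= t <= 1 ->
  1 - al <= qA al t <= 1.
Proof.
move=> /andP[a0 a1] /andP[t0 t1]; rewrite /qA.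
have : 0 <= t ^+ 2 <= 1 by rewrite sqr_ge0 expr_le1.
nra.
Qed.

Lemma qk_itv (R : realType) (al t : R) : 0 < al < 1 -> 0 <= t <= 1 -> -1 <= qk al t <= 1.
Proof. by move=> /andP[a0 a1] /andP[t0 t1]; rewrite /qk; nra. Qed.

(** Apart from constants, h is the negative of (1 - t) qk^2 / (4 qA b) + al t, which is the value of
    c for which the discriminant vanishes at t. Hence minimising that value means maximising h. *)
Lemma hE (R : realType) (beta al t : R) : 0 < beta <= 1 / 2 -> 0 < al < 1 ->
  let b := beta * (1 - beta) in
  h beta al t = (4 * b ^+ 2)^-1 -
    ((1 - t) * qk al t ^+ 2 / (4 * qA al t * b) + al * t) / ((1 - al) * b).
Proof.
move=> /andP[b0 b1] al01 b; have A0 := qA_gt0 t al01.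
have [a0 a1] := andP al01.
rewrite /h /b; move: A0; rewrite /qA /qk => A0.
field; do ?[apply/andP; split]; rewrite gt_eqF//; lra.
Qed.

(** Coefficients in [0, 1] make the increments of y smaller than those of the geometric series,
    which thus provides a modulus of continuity. *)
Lemma gen_fun_diff (R : realType) (a : nat -> R) (y : R -> R) (s t : R) :
  (forall n, 0 <= a n <= 1) -> gen_fun a y -> 0 <= s -> s <= t -> t < 1 ->
  0 <= y t - y s <= (1 - t)^-1 - (1 - s)^-1.
Proof.
move=> a01 ay s0 st t1.
have t01 : 0 <= t < 1 by rewrite (le_trans s0 st).
have s01 : 0 <= s < 1 by rewrite s0 (le_lt_trans st t1).
have geo (x : R) : 0 <= x < 1 -> has_sum (fun n => x ^+ n) (1 - x)^-1.
  move=> /andP[x0 x1]; split.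
  have := @cvg_geometric_series R 1 x; rewrite ger0_norm// => /(_ x1).
  rewrite mul1r; rewrite (_ : geometric 1 x = GRing.exp x)//.
  by apply/funext => n; rewrite /geometric/= mul1r.
have D := has_sumB (ay t t01) (ay s s01).
have tsn n : s ^+ n <= t ^+ n by rewrite lerXn2r// nnegrE (le_trans s0).
apply/andP; split.
  apply: has_sum_ge0 D _ => n; rewrite -mulrBr mulr_ge0 ?subr_ge0//.
  by case/andP: (a01 n).
apply: ler_has_sum D (has_sumB (geo t t01) (geo s s01)) _ => n.
by rewrite -mulrBr ler_piMl ?subr_ge0//; case/andP: (a01 n).
Qed.

Lemma continuous_clamp (R : realType) (r : R) : 0 <= r ->
  continuous (fun t : R => Num.max 0 (Num.min t r)).
Proof.
move=> r0 t; apply: (@continuous_max _ _ (cst (0 : R)) (fun t => Num.min t r)).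
  exact: cvg_cst.
apply: (@continuous_min _ _ id (cst r)); [exact: cvg_id|exact: cvg_cst].
Qed.

Lemma continuous_neq0_lt0 (R : realType) (f : R -> R) (r : R) : 0 <= r ->
  continuous f -> (forall t, 0 <= t <= r -> f t != 0) -> f 0 < 0 -> f r < 0.
Proof.
move=> r0 fc f0 f00; rewrite ltNge; apply/negP => fr.
have [|t] := @IVT R f 0 r 0 r0 (continuous_subspaceT fc).
  by rewrite ge_min le_max (ltW f00) fr orbT.
by rewrite in_itv/= => /f0 /eqP.
Qed.

(** Nothing is known of [y] outside [0, 1). Clamping the argument to [0, r] gives a function
    continuous on the whole line, as [continuous_neq0_lt0] expects. *)
Lemma gen_fun_clamp_continuous (R : realType) (a : nat -> R) (y : R -> R) (r : R) :
  (forall n, 0 <= a n <= 1) -> gen_fun a y -> 0 <= r < 1 ->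
  continuous (fun t => y (Num.max 0 (Num.min t r))).
Proof.
move=> a01 ay /andP[r0 r1] t0.
pose c t : R := Num.max 0 (Num.min t r).
have c01 t : 0 <= c t <= r.
  by rewrite /c le_max lexx ge_max r0 ge_min lexx orbT.
have cc := continuous_clamp r0.
have ic : (1 - c t)^-1 @[t --> t0] --> (1 - c t0)^-1.
  apply: cvgV; first by rewrite subr_eq0 gt_eqF//; have := c01 t0; lra.
  by apply: cvgB; [exact: cvg_cst|exact: cc].
apply/cvgrPdist_lt => e e0; move/cvgrPdist_lt: ic => /(_ e e0).
apply: filterS => t; have /andP[h1 h2] := c01 t; have /andP[h3 h4] := c01 t0.
rewrite -/(c t) -/(c t0); have [le|/ltW le] := leP (c t) (c t0).
  have := gen_fun_diff a01 ay h1 le (le_lt_trans h4 r1) => /andP[d0 d1].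
  by apply: le_lt_trans; rewrite !ger0_norm//; lra.
have := gen_fun_diff a01 ay h3 le (le_lt_trans h2 r1) => /andP[d0 d1].
by apply: le_lt_trans; rewrite distrC [leRHS]distrC !ger0_norm//; lra.
Qed.

(* [a m] is the probability that the runoff exceeds [m], and [c] the
   probability that the root has contribution [-1] and a positive inflow. *)
Record tail_equation (R : realType) (b al c : R) (a : nat -> R) (y : R -> R) : Prop := {
  te_b : 0 < b <= 4^-1 ;
  te_al : 0 < al < 1 ;
  te_a01 : forall n, 0 <= a n <= 1 ;
  te_decr : forall n, a n.+1 <= a n ;
  te_gen : gen_fun a y ;
  te_eq : forall t : R, 0 <= t < 1 ->
    qA al t * b * ((1 - t) * y t) ^+ 2 - (1 - t) * qk al t * ((1 - t) * y t)
      + (1 - t) * (c - al * t) = 0 }.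

(** Completing the square in the quadratic for u = (1 - t) y: the sign of [branch] tells which root
    u is, and its square is the full discriminant. The latter has a factor 1 - t, which [discr]
    leaves out. *)
Definition branch (R : realType) (b al : R) (y : R -> R) (t : R) : R :=
  2 * qA al t * b * ((1 - t) * y t) - (1 - t) * qk al t.

Definition discr (R : realType) (b al c t : R) : R :=
  (1 - t) * qk al t ^+ 2 - 4 * qA al t * b * (c - al * t).

Lemma branch_sqr (R : realType) (b al c : R) a y (t : R) : tail_equation b al c a y ->
  0 <= t < 1 -> branch b al y t ^+ 2 = (1 - t) * discr b al c t.
Proof.
move=> te t01; have := te_eq te t01; rewrite /branch /discr.
set u := (1 - t) * y t; set A := qA al t; set k := qk al t => e.
have -> : (2 * A * b * u - (1 - t) * k) ^+ 2 =
  4 * A * b * (A * b * u ^+ 2 - (1 - t) * k * u) + (1 - t) ^+ 2 * k ^+ 2 by ring.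
have -> : A * b * u ^+ 2 - (1 - t) * k * u = - ((1 - t) * (c - al * t)) by lra.
ring.
Qed.

Lemma gen_fun_at0 (R : realType) (a : nat -> R) (y : R -> R) : gen_fun a y -> y 0 = a 0%N.
Proof.
move=> ay; have h : 0 <= (0 : R) < 1 by rewrite lexx ltr01.
apply: has_sum_unique (ay 0 h) _; have := has_sum_fin a 1; rewrite big_ord1.
by move/eq_has_sum; apply => -[|n]; rewrite ?expr0// expr0n/=.
Qed.

(** At 0 the branch is (1 - al) (2 b a_0 - 1), negative since b <= 1/4 and a_0 <= 1. It is
    continuous and cannot vanish where [discr] does not. *)
Lemma branch_neg (R : realType) (b al c : R) a y (r : R) : tail_equation b al c a y ->
  0 <= r < 1 -> (forall t : R, 0 <= t <= r -> discr b al c t != 0) -> branch b al y r < 0.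
Proof.
move=> te /andP[r0 r1] D0; have [/andP[b0 b4] al01] := (te_b te, te_al te).
pose cl t : R := Num.max 0 (Num.min t r).
have clE (t : R) : 0 <= t <= r -> cl t = t.
  by move=> /andP[t0 tr]; rewrite /cl min_l// max_r.
pose f t : R := 2 * qA al t * b * ((1 - t) * y (cl t)) - (1 - t) * qk al t.
have fE (t : R) : 0 <= t <= r -> f t = branch b al y t by move=> tr; rewrite /f clE.
rewrite -fE ?r0 ?lexx//; apply: (continuous_neq0_lt0 r0).
- have rr : 0 <= r < 1 by rewrite r0.
  have yc := gen_fun_clamp_continuous (te_a01 te) (te_gen te) rr.
  have c1 : continuous (fun t : R => 1 - t).
    by move=> t; apply: cvgB; [exact: cvg_cst|exact: cvg_id].
  have ct : continuous (fun t : R => al * t).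
    by move=> t; apply: cvgMr; exact: cvg_id.
  have cA : continuous (qA al).
    move=> t; apply: cvgB; first exact: cvg_cst.
    apply: cvgMr; apply: cvgB; first exact: cvg_cst.
    exact: exprn_continuous.
  have ck : continuous (qk al).
    by move=> t; apply: cvgB; [exact: cvg_cst|exact: ct].
  move=> t; apply: cvgB; last by apply: cvgM; [exact: c1|exact: ck].
  apply: cvgM; last by apply: cvgM; [exact: c1|exact: yc].
  by apply: cvgMl; apply: cvgMr; exact: cA.
- move=> t /[dup] tr /andP[t0 tr']; rewrite fE//.
  have t01 : 0 <= t < 1 by rewrite t0 (le_lt_trans tr').
  by rewrite -sqrf_eq0 (branch_sqr te t01) mulf_neq0 ?D0// subr_eq0 gt_eqF//; case/andP: t01.
- rewrite fE ?lexx ?r0// /branch (gen_fun_at0 (te_gen te)).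
  have /andP[a0 a1] := te_a01 te 0; case/andP: al01 => al0 al1.
  rewrite /qA /qk expr0n/= (_ : _ - _ = (1 - al) * (2 * b * a 0%N - 1)); last by ring.
  rewrite pmulr_rlt0 ?subr_gt0//; nra.
Qed.

Lemma discr_ge0 (R : realType) (b al c : R) a y (t : R) : tail_equation b al c a y ->
  0 <= t < 1 -> 0 <= discr b al c t.
Proof.
move=> te t01; have := sqr_ge0 (branch b al y t).
by rewrite (branch_sqr te t01) pmulr_rge0// subr_gt0; case/andP: t01.
Qed.

(* The value of [c] is forced: otherwise the discriminant would not vanish on
   [0, 1), the smaller root would be selected throughout, and it is negative
   near [1]. *)
Lemma tail_equation_cE (R : realType) (beta al c : R) a y (t0 : R) :
  let b := beta * (1 - beta) in
  0 < beta <= 1 / 2 -> tail_equation b al c a y ->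
  0 <= t0 <= 1 -> (forall t : R, 0 <= t <= 1 -> h beta al t <= h beta al t0) ->
  c = (1 - al) * b * ((4 * b ^+ 2)^-1 - h beta al t0).
Proof.
move=> b bet te /andP[t00 t01] tmax.
have [/andP[b0 b4] al01] := (te_b te, te_al te); have [al0 al1] := andP al01.
pose H t := (1 - al) * b * ((4 * b ^+ 2)^-1 - h beta al t).
have HE (t : R) : H t = (1 - t) * qk al t ^+ 2 / (4 * qA al t * b) + al * t.
  rewrite /H (hE t bet al01) -/b; have := qA_gt0 t al01; set A := qA al t => A0.
  by field; do ?[apply/andP; split]; rewrite gt_eqF//; lra.
clearbody b.
have dE (t : R) : discr b al c t = 4 * qA al t * b * (H t - c).
  rewrite HE /discr; have := qA_gt0 t al01; set A := qA al t => A0.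
  by field; do ?[apply/andP; split]; rewrite gt_eqF//; lra.
have Hmin (t : R) : 0 <= t <= 1 -> H t0 <= H t.
  move=> tt; rewrite /H ler_wpM2l ?mulr_ge0 ?(ltW b0)//; first by lra.
  by rewrite lerB// tmax.
have cH (t : R) : 0 <= t < 1 -> c <= H t.
  move=> tt; have := discr_ge0 te tt; have A0 := qA_gt0 t al01.
  by rewrite dE pmulr_rge0 ?subr_ge0// !mulr_gt0.
have cle : c <= H t0.
  (* The discriminant is only known to be nonnegative on [0, 1), so t0 = 1 is reached as a limit: if
     c > al, the point 1 - s already gives H (1 - s) < c. *)
  move: t01; rewrite le_eqVlt => /orP[/eqP ->|t01]; last by rewrite cH ?t00.
  rewrite (HE 1) subrr !mul0r add0r mulr1 leNgt; apply/negP => ac.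
  pose k := 4 * (1 - al) * b; have k0 : 0 < k by rewrite !mulr_gt0//; lra.
  pose s := Num.min 1 ((c - al) * k / 2).
  have s0 : 0 < s by rewrite lt_min ltr01 divr_gt0// mulr_gt0//; lra.
  have s1 : s <= 1 by rewrite ge_min lexx.
  have sk : s <= (c - al) * k / 2 by rewrite ge_min lexx orbT.
  have tt : 0 <= 1 - s < 1 by lra.
  have tt' : 0 <= 1 - s <= 1 by lra.
  have := cH _ tt; rewrite HE (_ : 1 - (1 - s) = s); last by ring.
  have := qA_itv al01 tt'; have := qk_itv al01 tt'.
  set A := qA _ _; set q := qk _ _ => q1 A1.
  have q2 : q ^+ 2 <= 1 by nra.
  have : s * q ^+ 2 / (4 * A * b) <= s / k.
    apply: ler_pM.
    - by rewrite mulr_ge0 ?sqr_ge0 ?(ltW s0).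
    - by rewrite invr_ge0 !mulr_ge0 ?(ltW b0)//; lra.
    - by rewrite ler_piMr ?(ltW s0).
    - rewrite lef_pV2 ?posrE// /k ?mulr_gt0//; last by lra.
      by rewrite !ler_pM ?mulr_ge0//; lra.
  have : s / k <= (c - al) / 2 by rewrite ler_pdivrMr//; lra.
  nra.
apply/eqP; rewrite eq_le cle /= leNgt; apply/negP => cH0; clear cH cle.
pose eta := 4 * (1 - al) * b * (H t0 - c).
have cH1 : 0 < H t0 - c by rewrite subr_gt0.
have eta0 : 0 < eta by rewrite /eta !mulr_gt0//; lra.
have dlow (t : R) : 0 <= t <= 1 -> eta <= discr b al c t.
  move=> tt; rewrite dE /eta; have := Hmin t tt; have := qA_itv al01 tt => /andP[A1 _] Ht.
  by rewrite !ler_pM ?mulr_ge0 ?(ltW b0) ?(ltW cH1)//; lra.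
(* At 1 - s a negative branch is at least -s, because y >= 0 and qk <= 1, so its square is at most
   s^2. That square is also s times the discriminant, hence at least s eta >= 2 s^2. *)
pose s := Num.min 1 (eta / 2).
have s0 : 0 < s by rewrite lt_min ltr01 divr_gt0.
have s1 : s <= 1 by rewrite ge_min lexx.
have sk : s <= eta / 2 by rewrite ge_min lexx orbT.
have tt : 0 <= 1 - s < 1 by lra.
have tt' : 0 <= 1 - s <= 1 by lra.
have bn : branch b al y (1 - s) < 0.
  apply: (branch_neg te tt) => t /andP[t1 t2]; rewrite gt_eqF//.
  by apply: lt_le_trans (dlow t _) => //; lra.
have sq := branch_sqr te tt; have dl := dlow _ tt'.
have y0 : 0 <= y (1 - s).
  apply: has_sum_ge0 (te_gen te tt) _ => n; rewrite mulr_ge0 ?exprn_ge0//; last by lra.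
  by case/andP: (te_a01 te n).
have bl : - s <= branch b al y (1 - s).
  rewrite /branch (_ : 1 - (1 - s) = s); last by ring.
  have := qk_itv al01 tt'; have A0 := qA_gt0 (1 - s) al01.
  have : 0 <= 2 * qA al (1 - s) * b * (s * y (1 - s)).
    by rewrite !mulr_ge0 ?(ltW s0) ?(ltW b0) ?(ltW A0).
  nra.
move: sq; rewrite (_ : 1 - (1 - s) = s); last by ring.
have : branch b al y (1 - s) ^+ 2 <= s * s by nra.
nra.
Qed.

(** The critical value is the smaller root of (1 - 2 al)^2 = 4 b al, the equation saying that
    [delta], the reduced discriminant for c = al, vanishes at t = 1. *)
Lemma alpha_c_facts (R : realType) (beta : R) : 0 < beta <= 1 / 2 ->
  let b := beta * (1 - beta) in
  [/\ alpha_c beta < 2^-1, (1 - 2 * alpha_c beta) ^+ 2 = 4 * b * alpha_c beta & 0 < b <= 4^-1].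
Proof.
move=> /andP[b0 b1] b.
have B0 : 0 < b by rewrite mulr_gt0//; lra.
have B4 : b <= 4^-1 by have := sqr_ge0 (2 * beta - 1); rewrite /b; lra.
rewrite /alpha_c -/b; clearbody b.
have p0 : 0 <= b * (2 + b) by rewrite mulr_ge0//; lra.
have sb : b < Num.sqrt (b * (2 + b)).
  rewrite -[X in X < _](@ger0_norm _ b) ?(ltW B0)// -sqrtr_sqr ltr_sqrt; nra.
have ss : Num.sqrt (b * (2 + b)) ^+ 2 = b * (2 + b) by rewrite sqr_sqrtr.
move: ss sb; set s := Num.sqrt _ => ss sb.
split; [lra| |by rewrite B0].
have -> : (1 - 2 * (2^-1 * (1 + b - s))) ^+ 2 = s ^+ 2 - 2 * s * b + b ^+ 2 by field.
by rewrite ss; field.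
Qed.

Lemma le_alpha_c (R : realType) (beta al : R) : 0 < beta <= 1 / 2 ->
  let b := beta * (1 - beta) in
  al <= alpha_c beta -> 0 < 1 - 2 * al /\ 4 * b * al <= (1 - 2 * al) ^+ 2.
Proof.
move=> bet b alc; have [h1 h2 /andP[h3 h4]] := alpha_c_facts bet.
rewrite -/b in h2 h3 h4; clearbody b; split; first by lra.
have : (1 - 2 * alpha_c beta) ^+ 2 <= (1 - 2 * al) ^+ 2.
  by rewrite lerXn2r// ?nnegrE; lra.
have := ler_wpM2l (ltW h3) alc; lra.
Qed.

Lemma lt_alpha_c (R : realType) (beta al : R) : 0 < beta <= 1 / 2 ->
  let b := beta * (1 - beta) in
  al < alpha_c beta -> 4 * b * al < (1 - 2 * al) ^+ 2.
Proof.
move=> bet b alc; have [h1 h2 /andP[h3 h4]] := alpha_c_facts bet.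
rewrite -/b in h2 h3 h4; clearbody b.
have : (1 - 2 * alpha_c beta) ^+ 2 <= (1 - 2 * al) ^+ 2.
  by rewrite lerXn2r// ?nnegrE; lra.
have : b * al < b * alpha_c beta by rewrite ltr_pM2l.
lra.
Qed.

Lemma gt_alpha_c (R : realType) (beta al : R) : 0 < beta <= 1 / 2 ->
  let b := beta * (1 - beta) in
  alpha_c beta < al -> al <= 2^-1 -> (1 - 2 * al) ^+ 2 < 4 * b * al.
Proof.
move=> bet b alc al2; have [h1 h2 /andP[h3 h4]] := alpha_c_facts bet.
rewrite -/b in h2 h3 h4; clearbody b.
have : (1 - 2 * al) ^+ 2 <= (1 - 2 * alpha_c beta) ^+ 2.
  by rewrite lerXn2r// ?nnegrE; lra.
have : b * alpha_c beta < b * al by rewrite ltr_pM2l.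
lra.
Qed.

Lemma h_lt_supercritical (R : realType) (beta al : R) : 0 < beta <= 1 / 2 -> 0 < al < 1 ->
  alpha_c beta < al -> exists2 t : R, 0 <= t < 1 & h beta al 1 < h beta al t.
Proof.
move=> bet al01 alc; have [al0 al1] := andP al01.
have [_ _ /andP[b0 b4]] := alpha_c_facts bet.
suff [t tt Ht] : exists2 t : R, 0 <= t < 1 &
    (1 - t) * qk al t ^+ 2 / (4 * qA al t * (beta * (1 - beta))) + al * t < al.
  exists t => //; rewrite !hE// subrr !mul0r add0r mulr1 ltrD2l ltrN2.
  by rewrite ltr_pM2r// invr_gt0 mulr_gt0//; lra.
(* For al > 1/2 the witness is the zero of [qk], which lies in [0, 1) and leaves only al t = 1 - al
   < al. *)
have [al2|al2] := leP al 2^-1; last first.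
  exists ((1 - al) / al).
    by rewrite divr_ge0 ?subr_ge0 ?ltW//= ltr_pdivrMr// mul1r; lra.
  have e : al * ((1 - al) / al) = 1 - al by rewrite mulrC divfK// gt_eqF.
  by rewrite /qk e subrr expr0n/= mulr0 mul0r add0r; lra.
have D := gt_alpha_c bet alc al2.
move: b0 b4 D; set b := beta * (1 - beta) => b0 b4 D; clearbody b.
(* For al <= 1/2 the inequality holds to first order at 1 with margin d. A step of d/6 is short
   enough: the correction terms add up to at most d/3 + d/36 + d/12 < d. *)
pose d := 4 * b * al - (1 - 2 * al) ^+ 2.
have d0 : 0 < d by rewrite subr_gt0.
have d1 : d <= 1 by rewrite /d; have := sqr_ge0 (1 - 2 * al); nra.
have tt : 0 <= 1 - d / 6 < 1 by lra.
exists (1 - d / 6) => //; have := qA_gt0 (1 - d / 6) al01; set A := qA _ _ => A0.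
have k0 : 0 < 4 * A * b by rewrite !mulr_gt0.
rewrite -ltrBrDr ltr_pdivrMr//.
have -> : 1 - (1 - d / 6) = d / 6 by ring.
have -> : al - al * (1 - d / 6) = d / 6 * al by ring.
rewrite -[ltRHS]mulrA ltr_pM2l; last by lra.
have AE : A = 1 - al * (2 * (d / 6) - (d / 6) ^+ 2) by rewrite /A /qA; ring.
have -> : qk al (1 - d / 6) = (1 - 2 * al) + al * (d / 6) by rewrite /qk; ring.
have A1 : 1 - al * (d / 3) <= A by rewrite AE; have := sqr_ge0 (d / 6); nra.
have h1 : al * (4 * (1 - al * (d / 3)) * b) <= al * (4 * A * b).
  by rewrite !(ler_pM2l, ler_pM2r).
apply: lt_le_trans h1.
have ad : al * al * b * d <= d / 16.
  have : al * al * b <= 16^-1 by nra.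
  by move/(ler_wpM2r (ltW d0)); lra.
have dE : 4 * b * al = d + (1 - 2 * al) ^+ 2 by rewrite /d; ring.
have -> : al * (4 * (1 - al * (d / 3)) * b) = 4 * b * al - 4 / 3 * (al * al * b * d) by ring.
rewrite dE sqrrD; have : (1 - 2 * al) * (al * (d / 6)) <= 1 * (1 * (d / 6)) by nra.
have : (al * (d / 6)) ^+ 2 <= d / 36 by nra.
lra.
Qed.

Lemma h_cvg_left1 (R : realType) (beta al : R) : 0 < beta <= 1 / 2 -> 0 < al < 1 ->
  h beta al t @[t --> 1^'-] --> h beta al 1.
Proof.
move=> bet al01; have [_ _ /andP[b0 b4]] := alpha_c_facts bet.
under eq_fun do rewrite (hE _ bet al01).
rewrite (hE 1 bet al01); apply: cvg_at_left_filter.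
have cx : (fun x : R => x) x @[x --> (1 : R)] --> (1 : R) by exact: cvg_id.
have c1 : 1 - x @[x --> (1 : R)] --> (1 - 1 : R) by apply: cvgB => //; exact: cvg_cst.
have ca : al * x @[x --> (1 : R)] --> al * 1 by exact: cvgMr.
have ck : qk al x @[x --> (1 : R)] --> qk al 1 by apply: cvgB => //; exact: cvg_cst.
have cA : qA al x @[x --> (1 : R)] --> qA al 1.
  apply: cvgB; first exact: cvg_cst.
  by apply: cvgMr; apply: cvgB; [exact: cvg_cst|exact: exprn_continuous].
apply: cvgB; first exact: cvg_cst.
apply: cvgMl; apply: cvgD => //; apply: cvgM.
  apply: cvgM => //; rewrite expr2; under eq_fun do rewrite expr2.
  exact: cvgM.
apply: cvgV; first by rewrite gt_eqF// mulr_gt0// mulr_gt0// qA_gt0.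
by apply: cvgMl; apply: cvgMr.
Qed.

(** The discriminant has a positive limit D at 1, where the larger root is in force; hence sqrt(1 -
    t) y(t) tends to sqrt D / (2b). *)
Lemma tail_supercritical (R : realType) (beta al c : R) a y (t0 : R) :
  let b := beta * (1 - beta) in
  0 < beta <= 1 / 2 -> tail_equation b al c a y ->
  0 <= t0 <= 1 -> (forall t : R, 0 <= t <= 1 -> h beta al t <= h beta al t0) ->
  alpha_c beta < al ->
  Num.sqrt n%:R * a n @[n --> \oo] -->
    Num.sqrt ((h beta al t0 - h beta al 1) * (1 - al) / pi).
Proof.
move=> b bet te t01 tmax alc.
have [/andP[b0 b4] al01] := (te_b te, te_al te); have [al0 al1] := andP al01.
have cE := tail_equation_cE bet te t01 tmax; rewrite -/b in cE.
have H01 : h beta al 1 < h beta al t0.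
  have [t tt] := h_lt_supercritical bet al01 alc; move=> /lt_le_trans; apply.
  by apply: tmax; lra.
have near01 : \forall t \near (1 : R)^'-, 0 <= t < 1.
  by near=> t; apply/andP; split; near: t; [exact: nbhs_left_ge|exact: nbhs_left_lt].
have dE (t : R) : discr b al c t = 4 * qA al t * b * ((1 - al) * b * (h beta al t0 - h beta al t)).
  rewrite cE [h beta al t](hE t bet al01) -/b /discr.
  have := qA_gt0 t al01; set A := qA al t => A0; set H := h _ _ _.
  by field; do ?[apply/andP; split]; rewrite gt_eqF//; lra.
have cA : qA al t @[t --> (1 : R)^'-] --> (1 : R).
  have A1 : qA al 1 = 1 by rewrite /qA; ring.
  rewrite -[X in _ --> X]A1.
  apply: cvg_at_left_filter; apply: cvgB; first exact: cvg_cst.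
  by apply: cvgMr; apply: cvgB; [exact: cvg_cst|exact: exprn_continuous].
pose D := 4 * 1 * b * ((1 - al) * b * (h beta al t0 - h beta al 1)).
have cD : discr b al c t @[t --> (1 : R)^'-] --> D.
  under eq_fun do rewrite dE.
  apply: cvgM; first by apply: cvgMl; apply: cvgMr.
  by apply: cvgMr; apply: cvgB; [exact: cvg_cst|exact: h_cvg_left1].
clearbody b; have D0 : 0 < D by rewrite /D !mulr_gt0 ?subr_gt0.
have sD : Num.sqrt (discr b al c t) @[t --> (1 : R)^'-] --> Num.sqrt D.
  exact: (continuous_cvg _ (@sqrt_continuous R _) cD).
have c1 : 1 - t @[t --> (1 : R)^'-] --> (0 : R).
  rewrite -[X in _ --> X](subrr 1); apply: cvg_at_left_filter.
  by apply: cvgB; [exact: cvg_cst|exact: cvg_id].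
have s1 : Num.sqrt (1 - t) @[t --> (1 : R)^'-] --> (0 : R).
  by rewrite -[X in _ --> X](@sqrtr0 R); exact: (continuous_cvg _ (@sqrt_continuous R _) c1).
have ck : qk al t @[t --> (1 : R)^'-] --> qk al 1.
  apply: cvg_at_left_filter; apply: cvgB; first exact: cvg_cst.
  by apply: cvgMr; exact: cvg_id.
(* A nonpositive branch would be at least -(1 - t), forcing discr <= 1 - t, which fails near 1 since
   discr tends to D > 0. *)
have bpos : \forall t \near (1 : R)^'-, 0 < branch b al y t.
  have : \forall t \near (1 : R)^'-, 1 - t < discr b al c t.
    have d2 : 0 < D / 2 by lra.
    near=> t; apply: (@lt_trans _ _ (D / 2)); near: t.
      exact: (cvgr_lt _ c1).
    by apply: (cvgr_gt _ cD); lra.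
  apply: filterS2 near01 => t tt dt; rewrite ltNge; apply/negP => bt.
  have := branch_sqr te tt; have [tt0 tt1] := andP tt.
  have y0 : 0 <= y t.
    apply: has_sum_ge0 (te_gen te tt) _ => n; rewrite mulr_ge0 ?exprn_ge0//.
    by case/andP: (te_a01 te n).
  have bl : - (1 - t) <= branch b al y t.
    have tt' : 0 <= t <= 1 by lra.
    rewrite /branch; have := qk_itv al01 tt'; have A0 := qA_gt0 t al01.
    have : 0 <= 2 * qA al t * b * ((1 - t) * y t).
      by rewrite !mulr_ge0 ?(ltW b0) ?(ltW A0)//; lra.
    nra.
  have : branch b al y t ^+ 2 <= (1 - t) * (1 - t) by nra.
  nra.
have main : Num.sqrt (1 - t) * y t @[t --> 1^'-] -->
    (0 * qk al 1 + Num.sqrt D) / (2 * 1 * b).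
  have : (Num.sqrt (1 - t) * qk al t + Num.sqrt (discr b al c t)) / (2 * qA al t * b)
      @[t --> 1^'-] --> (0 * qk al 1 + Num.sqrt D) / (2 * 1 * b).
    apply: cvgM; first by apply: cvgD => //; exact: cvgM.
    apply: cvgV; first by rewrite gt_eqF// !mulr_gt0.
    by apply: cvgMl; exact: cvgMr.
  apply: cvg_trans; apply: near_eq_cvg.
  apply: filterS2 near01 bpos => t tt bp; have [tt0 tt1] := andP tt.
  have A0 := qA_gt0 t al01.
  have z0 : 0 < Num.sqrt (1 - t) by rewrite sqrtr_gt0 subr_gt0.
  have zz : Num.sqrt (1 - t) ^+ 2 = 1 - t by rewrite sqr_sqrtr//; lra.
  have bE : branch b al y t = Num.sqrt (1 - t) * Num.sqrt (discr b al c t).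
    rewrite -sqrtrM; last by lra.
    by rewrite -(branch_sqr te tt) sqrtr_sqr ger0_norm ?ltW.
  move: bE zz; rewrite /branch; set z := Num.sqrt (1 - t) in z0 *; set sd := Num.sqrt _.
  move=> bE zz; rewrite -zz in bE; have zn : z != 0 by rewrite gt_eqF.
  have An : 2 * qA al t * b != 0 by rewrite gt_eqF// !mulr_gt0.
  have e : z * qk al t + sd = z * y t * (2 * qA al t * b).
    apply: (mulfI zn); have -> : z * (z * qk al t + sd) = z ^+ 2 * qk al t + z * sd by ring.
    by rewrite -bE; ring.
  by rewrite e mulfK.
have K0 : 0 < (0 * qk al 1 + Num.sqrt D) / (2 * 1 * b).
  by rewrite mul0r add0r divr_gt0 ?sqrtr_gt0// !mulr_gt0.
have an0 n : 0 <= a n by case/andP: (te_a01 te n).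
have := tauberian_half an0 (te_decr te) (te_gen te) K0 main.
congr (_ --> _); rewrite mul0r add0r mulr1.
have -> : D = (2 * b) ^+ 2 * ((h beta al t0 - h beta al 1) * (1 - al)) by rewrite /D; ring.
have b2 : 0 < 2 * b by rewrite mulr_gt0.
rewrite [in LHS]sqrtrM ?sqr_ge0// sqrtr_sqr (ger0_norm (ltW b2)).
rewrite [X in X / _ = _]mulrC mulKf ?gt_eqF// [in RHS]sqrtrM.
  by rewrite sqrtrV ?pi_ge0.
by rewrite mulr_ge0 ?subr_ge0// ltW.
Unshelve. all: by end_near. Qed.

(** * The second derivative of h at 1 *)

Definition p3 (R : realType) (al t : R) : R := (1 - t) * qk al t ^+ 2.
Definition dp3 (R : realType) (al t : R) : R := - qk al t ^+ 2 - 2 * al * (1 - t) * qk al t.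

Lemma is_derive_1B (R : realType) (t : R) : is_derive t 1 (fun x : R => 1 - x) (- 1).
Proof.
rewrite (_ : (fun _ => _) = cst 1 - id)//; apply: is_derive_eq.
by rewrite sub0r.
Qed.

Lemma is_derive_qk (R : realType) (al t : R) : is_derive t 1 (qk al) (- al).
Proof.
rewrite (_ : qk al = cst (1 - al) - al \*: id); last by apply/funext.
by apply: is_derive_eq; rewrite /GRing.scale/= mulr1 sub0r.
Qed.

Lemma is_derive_qA (R : realType) (al t : R) : is_derive t 1 (qA al) (2 * al * t).
Proof.
rewrite (_ : qA al = cst (1 - al) + al \*: (id * id)); last first.
  apply/funext => x; rewrite /qA.
  by transitivity (1 - al + al * (x * x)); first ring.
by apply: is_derive_eq; rewrite /GRing.scale/=; ring.
Qed.

Lemma is_derive_p3 (R : realType) (al t : R) : is_derive t 1 (p3 al) (dp3 al t).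
Proof.
have h1 := is_derive_1B t; have h2 := is_derive_qk al t.
rewrite (_ : p3 al = (fun x => 1 - x) * (qk al * qk al)); last first.
  by apply/funext => x; rewrite !fctE /p3 expr2.
apply: is_derive_eq.
by rewrite !mulrfctE /GRing.scale/= /dp3; ring.
Qed.

Lemma is_derive_dp3 (R : realType) (al t : R) :
  is_derive t 1 (dp3 al) (4 * al * qk al t + 2 * al ^+ 2 * (1 - t)).
Proof.
have h1 := is_derive_1B t; have h2 := is_derive_qk al t.
rewrite (_ : dp3 al = - (qk al * qk al) - (2 * al) \*: ((fun x => 1 - x) * qk al)); last first.
  apply/funext => x; rewrite /dp3.
  by transitivity (- (qk al x * qk al x) - 2 * al * ((1 - x) * qk al x)); first ring.
apply: is_derive_eq.
by rewrite ?mulrfctE /GRing.scale/=; ring.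
Qed.

Lemma is_derive_div (R : realType) (f g : R -> R) (x df dg : R) : g x != 0 ->
  is_derive x 1 f df -> is_derive x 1 g dg ->
  is_derive x 1 (fun t => f t / g t) ((df * g x - f x * dg) / g x ^+ 2).
Proof.
move=> gx hf hg; have hv := is_deriveV gx hg.
rewrite (_ : (fun _ => _) = f * (fun t => (g t)^-1))//.
apply: is_derive_eq; rewrite /GRing.scale/=; field.
by rewrite gx.
Qed.

Lemma derive2_h (R : realType) (beta al : R) : 0 < beta <= 1 / 2 -> 0 < al < 1 ->
  let b := beta * (1 - beta) in
  derive1n 2 (h beta al) 1 = - (2 * al * (1 - 2 * al) / b ^+ 2).
Proof.
move=> bet al01 b; have [_ _ /andP[b0 b4]] := alpha_c_facts bet.
have [al0 al1] := andP al01.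
have hb (t : R) := hE t bet al01.
rewrite -/b in b0 b4 hb; clearbody b; have A0 (t : R) : qA al t != 0 by rewrite gt_eqF// qA_gt0.
pose k := (4 * (1 - al) * b ^+ 2)^-1.
have kn : 4 * (1 - al) * b ^+ 2 != 0 by rewrite gt_eqF// mulr_gt0 ?exprn_gt0// mulr_gt0//; lra.
have hk : h beta al = cst ((4 * b ^+ 2)^-1) - k \*: (fun t => p3 al t / qA al t)
    - (al / ((1 - al) * b)) \*: id.
  apply/funext => t; rewrite hb /p3.
  transitivity ((4 * b ^+ 2)^-1 - k * ((1 - t) * qk al t ^+ 2 / qA al t)
    - (al / ((1 - al) * b)) * t); last by []. rewrite /k.
  have An := A0 t; have q1 : 1 - al != 0 by rewrite gt_eqF//; lra.
  have bn : b != 0 by rewrite gt_eqF.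
  by field; rewrite ?q1 ?bn ?An.
have d1 (t : R) : is_derive t 1 (h beta al)
    (- k * ((dp3 al t * qA al t - p3 al t * (2 * al * t)) / qA al t ^+ 2) - al / ((1 - al) * b)).
  have hd := is_derive_div (A0 t) (is_derive_p3 al t) (is_derive_qA al t).
  by rewrite hk; apply: is_derive_eq; rewrite /GRing.scale/= mulr1; ring.
rewrite derive1nS derive1n1.
pose f1 (t : R) := dp3 al t * qA al t - p3 al t * (2 * al * t).
pose f2 (t : R) := qA al t * qA al t.
have -> : derive1 (h beta al) = cst (- (al / ((1 - al) * b))) - k \*: (fun t => f1 t / f2 t).
  apply/funext => t; rewrite derive1E (@derive_val _ _ _ _ _ _ _ (d1 t)).
  transitivity (- (al / ((1 - al) * b)) - k * (f1 t / f2 t)); last by [].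
  by rewrite /f1 /f2 expr2; ring.
(* The value is kept as the product rule gives it at 1, where p3 = 0, dp3 = -(1 - 2 al)^2 and qA =
   1; the last two terms cancel. *)
have df1 : is_derive (1 : R) 1 f1 (4 * al * (1 - 2 * al) * 1 + - (1 - 2 * al) ^+ 2 * (2 * al)
    - (- (1 - 2 * al) ^+ 2 * (2 * al))).
  have e1 := is_derive_dp3 al (1 : R); have e2 := is_derive_qA al (1 : R); have e3 := is_derive_p3 al (1 : R).
  rewrite (_ : f1 = dp3 al * qA al - p3 al * ((2 * al) \*: id))//.
  apply: is_derive_eq.
  change (dp3 al 1 * (2 * al * 1) + qA al 1 * (4 * al * qk al 1 + 2 * al ^+ 2 * (1 - 1))
    - (p3 al 1 * (2 * al * 1) + (2 * al * 1) * dp3 al 1) =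
    4 * al * (1 - 2 * al) * 1 + - (1 - 2 * al) ^+ 2 * (2 * al)
    - (- (1 - 2 * al) ^+ 2 * (2 * al))).
  by rewrite /dp3 /p3 /qA /qk; ring.
have df2 : is_derive (1 : R) 1 f2 (4 * al).
  have e2 := is_derive_qA al (1 : R).
  rewrite (_ : f2 = qA al * qA al)//.
  by apply: is_derive_eq; rewrite /GRing.scale/= /qA; ring.
have f20 : f2 1 != 0 by rewrite mulf_neq0.
have dd := is_derive_div f20 df1 df2.
rewrite derive1E; apply: derive_val.
apply: is_derive_eq; rewrite /GRing.scale/= /k /f1 /f2 /qA /qk /p3 /dp3 /qk.
have q1 : 1 - al != 0 by rewrite gt_eqF//; lra.
have bn : b != 0 by rewrite gt_eqF.
by rewrite /qA; field; rewrite ?q1 ?bn.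
Qed.

(** For c = al the discriminant is (1 - t) times [delta]. *)
Definition delta (R : realType) (b al t : R) : R := qk al t ^+ 2 - 4 * qA al t * b * al.

Lemma delta_ge (R : realType) (b al t : R) : 0 < b -> 0 < al < 1 ->
  0 < 1 - 2 * al -> 4 * b * al <= (1 - 2 * al) ^+ 2 -> 0 <= t < 1 ->
  0 < delta b al t /\ delta b al 1 <= delta b al t.
Proof.
move=> b0 al01 k0 kb tt; have [al0 al1] := andP al01; have [t0 t1] := andP tt.
have tt' : 0 <= t <= 1 by lra.
have /andP[_ A1] := qA_itv al01 tt'.
have kE : qk al t = (1 - 2 * al) + al * (1 - t) by rewrite /qk; ring.
have at0 : 0 < al * (1 - t) by rewrite mulr_gt0//; lra.
have k2 : (1 - 2 * al) ^+ 2 < qk al t ^+ 2 by rewrite kE; nra.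
have ba : 0 < b * al by rewrite mulr_gt0.
have Ab : 4 * qA al t * b * al <= 4 * b * al by nra.
have -> : delta b al 1 = (1 - 2 * al) ^+ 2 - 4 * b * al by rewrite /delta /qk /qA; ring.
by rewrite /delta; split; lra.
Qed.

(** h(1) - h(t) is a positive multiple of (1 - t) delta(t), so the maximum is h(1) and c = al. Then
    the discriminant does not vanish on [0, 1), the smaller root is in force throughout, and a
    factor 1 - t cancels from the formula. *)
Lemma tail_le_critical (R : realType) (beta al c : R) a y (t0 : R) :
  let b := beta * (1 - beta) in
  0 < beta <= 1 / 2 -> tail_equation b al c a y ->
  0 <= t0 <= 1 -> (forall t : R, 0 <= t <= 1 -> h beta al t <= h beta al t0) ->
  al <= alpha_c beta ->
  forall t : R, 0 <= t < 1 ->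
    2 * qA al t * b * y t = qk al t - Num.sqrt (delta b al t).
Proof.
move=> b bet te t01 tmax alc.
have [/andP[b0 b4] al01] := (te_b te, te_al te); have [al0 al1] := andP al01.
have cE := tail_equation_cE bet te t01 tmax; rewrite -/b in cE.
have [k0 kb] := le_alpha_c bet alc; rewrite -/b in kb.
have hb (t : R) := hE t bet al01; rewrite /= -/b in hb.
clearbody b.
have h1E (t : R) : (1 - al) * b * (h beta al 1 - h beta al t) =
    (1 - t) * delta b al t / (4 * qA al t * b).
  rewrite !hb /delta; have := qA_gt0 t al01; have := qA_gt0 1 al01.
  have A1 : qA al 1 = 1 by rewrite /qA; ring.
  rewrite A1; set A := qA al t => _ A0.
  have An : A != 0 by rewrite gt_eqF.
  have bn : b != 0 by rewrite gt_eqF.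
  have q1 : 1 - al != 0 by rewrite gt_eqF//; lra.
  by field; rewrite ?An ?bn ?q1.
have h1 : h beta al t0 = h beta al 1.
  apply/eqP; rewrite eq_le tmax ?andbT; last by lra.
  have /andP[t00 t1'] := t01; have [->//|tn1] := eqVneq t0 1.
  have t1 : t0 < 1 by rewrite lt_neqAle tn1.
  have tt : 0 <= t0 < 1 by lra.
  have [d0 _] := delta_ge b0 al01 k0 kb tt; have A0 := qA_gt0 t0 al01.
  have : 0 <= (1 - al) * b * (h beta al 1 - h beta al t0).
    by rewrite h1E divr_ge0 ?mulr_ge0 ?(ltW d0) ?(ltW A0) ?(ltW b0)//; lra.
  by rewrite pmulr_rge0 ?subr_ge0// mulr_gt0//; lra.
have {}cE : c = al.
  rewrite cE h1 hb subrr !mul0r add0r mulr1.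
  have bn : b != 0 by rewrite gt_eqF.
  have q1 : 1 - al != 0 by rewrite gt_eqF//; lra.
  by field; rewrite ?bn ?q1.
subst c.
have dE (t : R) : discr b al al t = (1 - t) * delta b al t by rewrite /discr /delta; ring.
move=> t tt; have [d0 _] := delta_ge b0 al01 k0 kb tt.
have [t0' t1] := andP tt; have t1' : 0 < 1 - t by lra.
have bn : branch b al y t < 0.
  apply: (branch_neg te tt) => s /andP[s0 st].
  have ss : 0 <= s < 1 by lra.
  have [ds _] := delta_ge b0 al01 k0 kb ss.
  by rewrite dE gt_eqF// mulr_gt0//; lra.
have bE : branch b al y t = (1 - t) * (2 * qA al t * b * y t - qk al t).
  by rewrite /branch; ring.
have := branch_sqr te tt; rewrite dE bE exprMn mulrA -expr2.
have t2 : (1 - t) ^+ 2 != 0 by rewrite gt_eqF// exprn_gt0.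
move/(mulfI t2) => <-; rewrite sqrtr_sqr ltr0_norm; first by ring.
by move: bn; rewrite bE pmulr_rlt0.
Qed.

(** At the critical value delta vanishes at 1, delta = (1 - t) d1 with d1(1) > 0, so y has a
    square-root singularity with a finite limit. *)
Lemma tail_critical (R : realType) (beta al c : R) a y (t0 : R) :
  let b := beta * (1 - beta) in
  0 < beta <= 1 / 2 -> tail_equation b al c a y ->
  0 <= t0 <= 1 -> (forall t : R, 0 <= t <= 1 -> h beta al t <= h beta al t0) ->
  al = alpha_c beta ->
  n%:R * Num.sqrt n%:R * a n @[n --> \oo] -->
    Num.sqrt (- derive1n 2 (h beta al) 1 * (1 - al) / (8 * pi)).
Proof.
move=> b bet te t01 tmax alc.
have [/andP[b0 b4] al01] := (te_b te, te_al te); have [al0 al1] := andP al01.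
have alc' : al <= alpha_c beta by rewrite alc.
have yE := tail_le_critical bet te t01 tmax alc'; rewrite -/b in yE.
have [k0 kb] := le_alpha_c bet alc'; rewrite -/b in kb.
have ke : (1 - 2 * al) ^+ 2 = 4 * b * al by have [_] := alpha_c_facts bet; rewrite -alc.
rewrite derive2_h// -/b; clearbody b.
(* K2 is the value of d1 at 1, simplified with the critical relation in the form 8 b al^2 = 2 al
   kap^2. *)
pose kap := 1 - 2 * al; pose K2 := 4 * al * kap * (1 - al).
pose d1 (t : R) := 2 * kap * al + 8 * b * al ^+ 2 + (1 - t) * (al ^+ 2 - 4 * b * al ^+ 2).
have dE (t : R) : delta b al t = (1 - t) * d1 t.
  transitivity (kap ^+ 2 - 4 * b * al + (1 - t) * d1 t); last by rewrite ke subrr add0r.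
  by rewrite /delta /qA /qk /d1 /kap; ring.
have near01 : \forall t \near (1 : R)^'-, 0 <= t < 1.
  by near=> t; apply/andP; split; near: t; [exact: nbhs_left_ge|exact: nbhs_left_lt].
have cx : t @[t --> (1 : R)^'-] --> (1 : R) by apply: cvg_at_left_filter; exact: cvg_id.
have c1 : 1 - t @[t --> (1 : R)^'-] --> (0 : R).
  by rewrite -[X in _ --> X](subrr 1); apply: cvgB => //; exact: cvg_cst.
have s1 : Num.sqrt (1 - t) @[t --> (1 : R)^'-] --> (0 : R).
  by rewrite -[X in _ --> X](@sqrtr0 R); exact: (continuous_cvg _ (@sqrt_continuous R _) c1).
have cA : qA al t @[t --> (1 : R)^'-] --> (1 : R).
  have A1 : qA al 1 = 1 by rewrite /qA; ring.
  rewrite -[X in _ --> X]A1.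
  apply: cvg_at_left_filter; apply: cvgB; first exact: cvg_cst.
  by apply: cvgMr; apply: cvgB; [exact: cvg_cst|exact: exprn_continuous].
have cA2 : (2 * qA al t * b)^-1 @[t --> (1 : R)^'-] --> (2 * 1 * b)^-1.
  apply: cvgV; first by rewrite gt_eqF// !mulr_gt0.
  by apply: cvgMl; exact: cvgMr.
have cd1 : d1 t @[t --> (1 : R)^'-] --> K2.
  have -> : K2 = 2 * kap * al + 8 * b * al ^+ 2 + 0 * (al ^+ 2 - 4 * b * al ^+ 2).
    transitivity (2 * kap * al + 2 * al * (4 * b * al)); last by ring.
    by rewrite -ke /K2 /kap; ring.
  by apply: cvgD; [exact: cvg_cst|apply: cvgMl].
have sd1 : Num.sqrt (d1 t) @[t --> (1 : R)^'-] --> Num.sqrt K2.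
  exact: (continuous_cvg _ (@sqrt_continuous R _) cd1).
have K20 : 0 < K2 by rewrite !mulr_gt0//; lra.
have yeq : \forall t \near (1 : R)^'-,
    y t = (qk al t - Num.sqrt (1 - t) * Num.sqrt (d1 t)) * (2 * qA al t * b)^-1.
  apply: filterS near01 => t tt; have A0 := qA_gt0 t al01.
  have A2 : 2 * qA al t * b != 0 by rewrite gt_eqF// !mulr_gt0.
  apply: (mulIf A2); rewrite divfK// mulrC yE// dE sqrtrM//; lra.
have ck : qk al t @[t --> (1 : R)^'-] --> kap.
  have -> : kap = 1 - al - al * 1 by rewrite /kap; ring.
  by apply: cvgB; [exact: cvg_cst|exact: cvgMr].
pose Y := (kap - 0 * Num.sqrt K2) * (2 * 1 * b)^-1.
have yY : y t @[t --> 1^'-] --> Y.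
  have : (qk al t - Num.sqrt (1 - t) * Num.sqrt (d1 t)) * (2 * qA al t * b)^-1 @[t --> 1^'-] --> Y.
    by apply: cvgM => //; apply: cvgB => //; exact: cvgM.
  by apply: cvg_trans; apply: near_eq_cvg; apply: filterS yeq => t ->.
(* The factor 0 is the limit of sqrt(1 - t), and its cofactor comes from expanding [qA] and [qk] at
   1; the form matches the limit term by term. *)
pose K := (0 * (kap * (al * 0 - 2 * al) - al) + Num.sqrt K2) * (2 * 1 * b)^-1.
have main : Num.sqrt (1 - t) * ((Y - y t) / (1 - t)) @[t --> 1^'-] --> K.
  have : (Num.sqrt (1 - t) * (kap * (al * (1 - t) - 2 * al) - al) + Num.sqrt (d1 t))
      * (2 * qA al t * b)^-1 @[t --> 1^'-] --> K.
    apply: cvgM => //; apply: cvgD => //; apply: cvgM => //.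
    by apply: cvgB; [apply: cvgMr; apply: cvgB; [exact: cvgMr|exact: cvg_cst]|exact: cvg_cst].
  apply: cvg_trans; apply: near_eq_cvg.
  apply: filterS2 near01 yeq => t tt ->; have [t0' t1] := andP tt.
  have A0 := qA_gt0 t al01.
  have z0 : 0 < Num.sqrt (1 - t) by rewrite sqrtr_gt0 subr_gt0.
  have zz : 1 - t = Num.sqrt (1 - t) ^+ 2 by rewrite sqr_sqrtr//; lra.
  have AE : qA al t = 1 - al * ((1 - t) * (2 - (1 - t))) by rewrite /qA; ring.
  have kE : qk al t = kap + al * (1 - t) by rewrite /qk /kap; ring.
  rewrite kE /Y mul0r subr0 mulr1; move: A0; rewrite AE.
  move: zz z0; set z := Num.sqrt (1 - t); set s := Num.sqrt (d1 t) => -> z0 A0.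
  have zn : z != 0 by rewrite gt_eqF.
  have bn : b != 0 by rewrite gt_eqF.
  have An : 1 - al * (z ^+ 2 * (2 - z ^+ 2)) != 0 by rewrite gt_eqF.
  by field; rewrite ?zn ?bn ?An.
have KE : K = Num.sqrt K2 / (2 * b) by rewrite /K mul0r add0r mulr1.
have K0 : 0 < K by rewrite KE divr_gt0 ?sqrtr_gt0// mulr_gt0.
have an0 n : 0 <= a n by case/andP: (te_a01 te n).
have := tauberian_three_half an0 (te_decr te) (te_gen te) K0 yY main.
congr (_ --> _).
have b40 : 0 < 4 * b by rewrite mulr_gt0.
have -> : - - (2 * al * (1 - 2 * al) / b ^+ 2) * (1 - al) / (8 * pi) =
    K2 / ((4 * b) ^+ 2 * pi).
  have pn : pi != 0 :> R by rewrite gt_eqF// pi_gt0.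
  have bn : b != 0 by rewrite gt_eqF.
  by rewrite /K2 /kap; move: (@pi R) pn => p pn; field; rewrite ?pn ?bn.
rewrite sqrtrM ?(ltW K20)// sqrtrV; last by rewrite mulr_ge0 ?sqr_ge0 ?pi_ge0.
have -> : Num.sqrt ((4 * b) ^+ 2 * pi) = 4 * b * Num.sqrt pi.
  by rewrite sqrtrM ?sqr_ge0// sqrtr_sqr (ger0_norm (ltW b40)).
rewrite KE; move: (Num.sqrt K2) => s2.
have sn : Num.sqrt pi != 0 :> R by rewrite gt_eqF// sqrtr_gt0 pi_gt0.
have bn : b != 0 by rewrite gt_eqF.
by field; rewrite ?sn ?bn.
Unshelve. all: by end_near. Qed.

(** Bootstrap: subtracting the quadratic equations at 1 and at t expresses (Y - y) / (1 - t)
    rationally in t and y, with a denominator bounded below. An expansion of y of order k thus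
    yields one of order k + 1. *)
Lemma tail_subcritical (R : realType) (beta al c : R) a y (t0 : R) :
  let b := beta * (1 - beta) in
  0 < beta <= 1 / 2 -> tail_equation b al c a y ->
  0 <= t0 <= 1 -> (forall t : R, 0 <= t <= 1 -> h beta al t <= h beta al t0) ->
  al < alpha_c beta ->
  forall k, exists C, forall n, n.+1%:R ^+ k.+1 * a n <= C.
Proof.
move=> b bet te t01 tmax alc k.
have [/andP[b0 b4] al01] := (te_b te, te_al te); have [al0 al1] := andP al01.
have yE := tail_le_critical bet te t01 tmax (ltW alc); rewrite -/b in yE.
have [k0 kb] := le_alpha_c bet (ltW alc); rewrite -/b in kb.
have ks := lt_alpha_c bet alc; rewrite -/b in ks; clearbody b.
have an0 n : 0 <= a n by case/andP: (te_a01 te n).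
apply: expandable_coef_bound (te_decr te) (te_gen te) _ => //.
have d10 : 0 < delta b al 1.
  by rewrite /delta /qk /qA expr1n; lra.
pose m := Num.sqrt (delta b al 1); have m0 : 0 < m by rewrite sqrtr_gt0.
(* The smaller root of the quadratic at t = 1, which is the limit of y there. *)
pose Y := (1 - 2 * al - m) / (2 * b).
have YE : b * Y ^+ 2 - (1 - 2 * al) * Y + al = 0.
  have mm : m ^+ 2 = (1 - 2 * al) ^+ 2 - 4 * b * al.
    by rewrite sqr_sqrtr ?(ltW d10)// /delta /qk /qA expr1n; ring.
  have bn : b != 0 by rewrite gt_eqF.
  have -> : b * Y ^+ 2 - (1 - 2 * al) * Y + al =
      (m ^+ 2 - (1 - 2 * al) ^+ 2 + 4 * b * al) / (4 * b).
    by rewrite /Y; field; rewrite ?bn.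
  by rewrite mm; field; rewrite ?bn.
have yq (t : R) : 0 <= t < 1 -> qA al t * b * y t ^+ 2 - qk al t * y t + al = 0.
  move=> tt; have [d0 _] := delta_ge b0 al01 k0 kb tt.
  have dd : Num.sqrt (delta b al t) ^+ 2 = delta b al t by rewrite sqr_sqrtr// ltW.
  have A0 := qA_gt0 t al01; have := yE t tt; move: dd; set s := Num.sqrt _ => dd e.
  have sE : s = qk al t - 2 * qA al t * b * y t by rewrite e; ring.
  have An : 4 * (qA al t * b) != 0 by rewrite gt_eqF// !mulr_gt0.
  by apply: (mulfI An); move: dd; rewrite sE /delta mulr0 => dd; lra.
(* The denominator of [(Y - y t) / (1 - t)], as a function of [t] and [y t]. *)
pose g t := qk al t - qA al t * b * (Y + y t).
have gm (t : R) : 0 <= t < 1 -> m <= g t.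
  move=> tt; have [d0 dm] := delta_ge b0 al01 k0 kb tt; have [t0' t1] := andP tt.
  have tt' : 0 <= t <= 1 by lra.
  have A0 := qA_gt0 t al01; have /andP[_ A1] := qA_itv al01 tt'.
  have y1 : qk al t - 2 * qA al t * b * y t >= m.
    by rewrite yE// opprB addrC subrK ler_wsqrtr.
  have Y2 : 2 * b * Y = 1 - 2 * al - m.
    by rewrite /Y mulrC divfK// gt_eqF// mulr_gt0.
  have Y0 : 0 <= 1 - 2 * al - m.
    rewrite subr_ge0 -[leRHS](ger0_norm (ltW k0)) -sqrtr_sqr ler_wsqrtr//.
    by rewrite /delta /qk /qA expr1n; have : 0 < b * al by [rewrite mulr_gt0]; lra.
  have kt : 1 - 2 * al <= qk al t by rewrite /qk; nra.
  have : qk al t - 2 * qA al t * b * Y >= m.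
    have -> : 2 * qA al t * b * Y = qA al t * (2 * b * Y) by ring.
    by rewrite Y2; nra.
  by rewrite /g; lra.
have y1E (t : R) : 0 <= t < 1 ->
    y t = Y - (1 - t) * (al * Y * (1 + (1 + t) * b * Y) * (g t)^-1).
  move=> tt; have g0 : g t != 0 by rewrite gt_eqF//; apply: lt_le_trans (gm t tt).
  have -> : Y - (1 - t) * (al * Y * (1 + (1 + t) * b * Y) * (g t)^-1) =
      (Y * g t - (1 - t) * (al * Y * (1 + (1 + t) * b * Y))) / g t.
    by field; rewrite ?g0.
  apply: (mulIf g0); rewrite divfK//; have := yq t tt; move: YE; rewrite /g /qA /qk.
  set yt := y t => Yq yq'.
  apply/eqP; rewrite -subr_eq0; apply/eqP.
  transitivity ((b * Y ^+ 2 - (1 - 2 * al) * Y + al) -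
    ((1 - al * (1 - t ^+ 2)) * b * yt ^+ 2 - (1 - al - al * t) * yt + al)).
    by ring.
  by rewrite Yq yq' subrr.
have exp_aff (j : nat) (u v : R) : expandable j (fun t : R => u + v * (1 - t)).
  by apply: expandableD; [exact: expandable_cst|apply: expandableM; [exact: expandable_cst|exact: expandable1B]].
elim: k => [|k IH].
  exists (2 * (1 - al) * b)^-1 => t tt; have [t0' t1] := andP tt.
  have tt' : 0 <= t <= 1 by lra.
  have y0 : 0 <= y t.
    by apply: has_sum_ge0 (te_gen te tt) _ => n; rewrite mulr_ge0 ?exprn_ge0.
  have k1 : 0 < 2 * (1 - al) * b by rewrite !mulr_gt0//; lra.
  rewrite ger0_norm// -[leRHS]mul1r ler_pdivlMr// mulrC.
  apply: (@le_trans _ _ (2 * qA al t * b * y t)).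
    have /andP[A1 _] := qA_itv al01 tt'.
    by rewrite ler_wpM2r// ler_wpM2r ?(ltW b0)// ler_wpM2l.
  rewrite yE//; have /andP[_ q1] := qk_itv al01 tt'.
  by have := sqrtr_ge0 (delta b al t); lra.
exists Y, (fun t => al * Y * (1 + (1 + t) * b * Y) * (g t)^-1); split => //.
apply: expandableM.
  apply: eq_expandable (exp_aff k (al * Y * (1 + 2 * b * Y)) (- (al * Y * b * Y))) => t _.
  by ring.
apply: (expandable_inv m0 gm).
(* The denominator is rewritten through 1 - t, y and constants, to which the closure lemmas
   apply. *)
apply: (@eq_expandable _ _ (fun t => (1 - 2 * al + al * (1 - t)) +
    (- b) * ((1 + (- (2 * al) * (1 - t) + al * ((1 - t) * (1 - t)))) * (Y + y t)))).
  by move=> t _; rewrite /g /qk /qA; ring.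
apply: expandableD; first exact: exp_aff.
apply: expandableM; first exact: expandable_cst.
apply: expandableM; last by apply: expandableD => //; exact: expandable_cst.
apply: expandableD; first exact: expandable_cst.
apply: expandableD; apply: expandableM; try exact: expandable_cst.
  exact: expandable1B.
by apply: expandableM; exact: expandable1B.
Qed.

(** * The law of the runoff *)

Lemma fine_probD d (T : measurableType d) (R : realType) (P : probability T R)
    (A B : set T) : measurable A -> measurable B -> A `&` B = set0 ->
  fine (P (A `|` B)) = fine (P A) + fine (P B).
Proof. by move=> mA mB AB; rewrite measureU// fineD// fin_num_measure. Qed.

Lemma fine_prob_setC d (T : measurableType d) (R : realType) (P : probability T R)
    (A : set T) : measurable A -> fine (P (~` A)) = 1 - fine (P A).
Proof. by move=> mA; rewrite probability_setC// fineB ?fin_num_measure. Qed.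

Lemma le_fine_prob d (T : measurableType d) (R : realType) (P : probability T R)
    (A B : set T) : measurable A -> measurable B -> A `<=` B -> fine (P A) <= fine (P B).
Proof.
by move=> mA mB AB; rewrite fine_le ?fin_num_measure// le_measure ?inE.
Qed.

Lemma fine_prob_itv d (T : measurableType d) (R : realType) (P : probability T R)
    (A : set T) : measurable A -> 0 <= fine (P A) <= 1.
Proof.
by move=> mA; rewrite fine_ge0 //= -(@lee_fin R) fineK ?fin_num_measure// probability_le1.
Qed.

Lemma fine_prob_partition d (T : measurableType d) (R : realType) (P : probability T R)
    (K : finType) (f : T -> K) (E : set T) : measurable E ->
  (forall k, measurable (f @^-1` [set k])) ->
  fine (P E) = \sum_k fine (P (E `&` f @^-1` [set k])).
Proof.
move=> mE mf.
have mr (r : seq K) : measurable [set w | f w \in r].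
  elim: r => [|k r IH]; first by rewrite (_ : [set _ | _] = set0)//; apply/seteqP; split.
  rewrite (_ : [set _ | _] = f @^-1` [set k] `|` [set w | f w \in r]).
    exact: measurableU.
  apply/seteqP; split=> w /=; rewrite inE.
    by move=> /orP[/eqP|]; [left|right].
  by move=> [->|->]; rewrite ?eqxx ?orbT.
have sum (r : seq K) : uniq r -> fine (P (E `&` [set w | f w \in r])) =
    \sum_(k <- r) fine (P (E `&` f @^-1` [set k])).
  elim: r => [_|k r IH /= /andP[kr ur]].
    by rewrite big_nil (_ : _ `&` _ = set0) ?measure0//; apply/seteqP; split=> w [].
  rewrite big_cons -IH// -fine_probD; try exact: measurableI; last first.
    by apply/seteqP; split=> w //= [[_ ->] [_]]; rewrite (negbTE kr).
  rewrite -setIUr; congr (fine (P (_ `&` _))); apply/seteqP; split=> w /=; rewrite inE.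
    by move=> /orP[/eqP|]; [left|right].
  by move=> [->|->]; rewrite ?eqxx ?orbT.
rewrite -sum ?index_enum_uniq//; congr (fine (P _)).
by apply/seteqP; split=> w /=; [move=> Ew; split=> //; rewrite mem_index_enum|case].
Qed.

Lemma measurable_finfun_preimage d (T : measurableType d) (K : countType) (f : T -> K)
    (B : set K) : (forall k, measurable (f @^-1` [set k])) -> measurable (f @^-1` B).
Proof.
move=> mf; rewrite (_ : f @^-1` B = \bigcup_(k in B) f @^-1` [set k]).
  rewrite bigcup_mkcond; apply: countable_bigcupT_measurable => // k.
  by case: ifP.
apply/seteqP; split=> w /=; first by move=> Bw; exists (f w).
by move=> [k Bk ->].
Qed.

(** Missing children are ignored. The sum [s] is the inflow; the inner successor or truncated
    predecessor is max(s + X, 0) for X = 1 or -1, and the outer successor keeps 0 free for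
    non-extinction. *)
Definition combine (x : bool) (z i j : nat) : nat :=
  (if ((0 < z) && (i == 0)) || ((1 < z) && (j == 0)) then 0
   else let s := (0 < z) * i.-1 + (1 < z) * j.-1 in (if x then s.+1 else s.-1).+1)%N.

Lemma combine_le x z i j M : (0 < M)%N -> (i <= M)%N -> (j <= M)%N ->
  (combine x z i j <= 2 * M)%N.
Proof.
move=> M0 iM jM; rewrite /combine; case: ifP => // _.
by case: (0 < z)%N; case: (1 < z)%N; case: x => /=; lia.
Qed.

(* [0] encodes that the subtree at [u] is not extinct within [n] generations,
   and [k.+1] that it is and that the runoff from [u] is [k]. *)
Fixpoint runoff_code (T : Type) (xb : node -> T -> bool) (zb : node -> T -> nat)
    (n : nat) (u : node) (w : T) : nat :=
  if n is m.+1 then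
    combine (xb u w) (zb u w) (runoff_code xb zb m (rcons u 0%N) w)
      (runoff_code xb zb m (rcons u 1%N) w)
  else 0%N.

(** A binary tree of n generations has at most 2^n - 1 nodes, which bounds the runoff, and the code
    is one more. The finite range makes all laws finite sums. *)
Lemma runoff_code_le (T : Type) xb zb n u (w : T) : (runoff_code xb zb n u w <= 2 ^ n)%N.
Proof.
elim: n u => [|n IH] u //=; rewrite expnS.
by apply: combine_le; rewrite ?expn_gt0.
Qed.

Notation code_key n := (bool * 'I_3 * 'I_(2 ^ n).+1 * 'I_(2 ^ n).+1)%type.

Definition combine_key n (q : code_key n) : nat :=
  let: (x, z, i, j) := q in combine x z i j.

Fixpoint code_law (R : realType) (px : bool -> R) (pz : nat -> R) (n k : nat) : R :=
  if n is m.+1 then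
    \sum_(q : code_key m) px q.1.1.1 * pz q.1.1.2 *
      code_law px pz m q.1.2 * code_law px pz m q.2 * (combine_key q == k)%:R
  else (k == 0%N)%:R.

Lemma measurable_runoff_code d (T : measurableType d) xb zb n u (B : set nat) :
  (forall u x, measurable [set w : T | xb u w = x]) ->
  (forall u z, measurable [set w : T | zb u w = z]) ->
  measurable [set w : T | B (runoff_code xb zb n u w)].
Proof.
move=> mx mz; elim: n u B => [|n IH] u B /=.
  have [B0|B0] := pselect (B 0%N).
    by rewrite (_ : [set _ | _] = setT)//; apply/seteqP; split.
  by rewrite (_ : [set _ | _] = set0)//; apply/seteqP; split.
pose f w := (xb u w, zb u w, runoff_code xb zb n (rcons u 0%N) w,
  runoff_code xb zb n (rcons u 1%N) w).
apply: (@measurable_finfun_preimage _ _ _ f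
  [set q | B (combine q.1.1.1 q.1.1.2 q.1.2 q.2)]).
move=> [[[x z] i] j].
rewrite (_ : f @^-1` _ = [set w | xb u w = x] `&` [set w | zb u w = z] `&`
  [set w | runoff_code xb zb n (rcons u 0%N) w = i] `&`
  [set w | runoff_code xb zb n (rcons u 1%N) w = j]).
  by apply: measurableI; [apply: measurableI; [exact: measurableI|exact: (IH _ [set i])]|
    exact: (IH _ [set j])].
by rewrite /f; apply/seteqP; split=> w /=; [case=> <- <- <- <-|case=> [[[<- <-] <-] <-]].
Qed.

Definition incomparable (u v : node) : bool := ~~ prefix u v && ~~ prefix v u.

Lemma prefix_rcons_inv (v u : node) i :
  prefix v (rcons u i) -> v = rcons u i \/ prefix v u.
Proof.
move=> /prefixP[s]; case/lastP: s => [|s x]; first by rewrite cats0 => ->; left.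
rewrite -rcons_cat => /rcons_inj[-> _]; right; exact: prefix_prefix.
Qed.

Lemma prefix_rcons_l (u v : node) j : prefix (rcons u j) v -> prefix u v.
Proof. exact: (prefix_trans (prefix_rcons u j)). Qed.

Lemma prefix_rcons_self (u : node) j : prefix (rcons u j) u = false.
Proof. by apply/negP => /size_prefix; rewrite size_rcons ltnn. Qed.

Lemma incomparable_rcons (u v : node) i :
  incomparable u v -> incomparable (rcons u i) v.
Proof.
move=> /andP[uv vu]; apply/andP; split.
  by apply: contra uv; exact: prefix_rcons_l.
apply: contra vu => /prefix_rcons_inv[vE|//].
by move: uv; rewrite vE prefix_rcons.
Qed.

Lemma incomparable_siblings (u : node) i j : i != j -> incomparable (rcons u i) (rcons u j).
Proof.
have aux (k l : nat) : k != l -> ~~ prefix (rcons u k) (rcons u l).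
  move=> kl; apply/negP => /prefix_rcons_inv[/rcons_inj[e]|].
    by move: kl; rewrite e eqxx.
  by rewrite prefix_rcons_self.
by move=> ij; rewrite /incomparable !aux// eq_sym.
Qed.

Definition label_node (i : (node + node)%type) : node :=
  match i with inl v => v | inr v => v end.

Definition xbit (R : realType) (T : Type) (X : node -> T -> R) (u : node) (w : T) : bool :=
  X u w == 1.
(* Truncating at 2 leaves finitely many values everywhere, not only almost
   surely. *)
Definition zbit (T : Type) (Z : node -> T -> nat) (u : node) (w : T) : nat :=
  minn (Z u w) 2.

Definition xlaw (R : realType) (alpha : R) (x : bool) : R := if x then alpha else 1 - alpha.
Definition zlaw (R : realType) (beta : R) (z : nat) : R :=
  if z == 1%N then beta ^+ 2 + (1 - beta) ^+ 2 else beta * (1 - beta).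

Lemma measurable_xbit d (T : measurableType d) (R : realType) (P : probability T R)
    (X : node -> {RV P >-> R}) u x :
  sigma_of (X u) [set w : T | xbit (fun u => X u) u w = x].
Proof.
case: x.
  exists [set 1]; first exact: measurable_set1.
  by rewrite setTI /xbit; apply/seteqP; split=> w /= => [->|/eqP//]; rewrite eqxx.
exists (~` [set 1]); first by apply: measurableC; exact: measurable_set1.
rewrite setTI /xbit; apply/seteqP; split=> w /=; first by move=> /eqP/negbTE.
by move=> e /eqP; rewrite e.
Qed.

Lemma measurable_zbit d (T : measurableType d) (R : realType) (P : probability T R)
    (Z : node -> {RV P >-> nat}) u z :
  sigma_of (Z u) [set w : T | zbit (fun u => Z u) u w = z].
Proof. by exists [set k | minn k 2 = z] => //; rewrite setTI. Qed.

Lemma sigma_of_measurable d (T : measurableType d) (R : realType) (P : probability T R)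
    d' (E : measurableType d') (Y : {RV P >-> E}) A : sigma_of Y A -> measurable A.
Proof. by move=> [B mB <-]; exact: (measurable_funPT Y). Qed.

Lemma xlawE d (T : measurableType d) (R : realType) (P : probability T R) beta alpha
    (Z : node -> {RV P >-> nat}) (X : node -> {RV P >-> R}) u x :
  runoff_environment beta alpha Z X ->
  fine (P [set w : T | xbit (fun u => X u) u w = x]) = xlaw alpha x.
Proof.
move=> hZX; have e1 : fine (P [set w : T | xbit (fun u => X u) u w = true]) = alpha.
  rewrite (_ : [set w | _] = [set w | X u w = 1]).
    by rewrite (contribution_eq1 hZX).
  by apply/seteqP; split=> w /=; rewrite /xbit => /eqP.
case: x => //; rewrite /xlaw -{}e1 -fine_prob_setC; last first.
  exact: (sigma_of_measurable (P := P) (measurable_xbit X u true)).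
by congr (fine (P _)); apply/seteqP; split=> w /=; case: (xbit _ _ _).
Qed.

Lemma zlawE d (T : measurableType d) (R : realType) (P : probability T R) beta alpha
    (Z : node -> {RV P >-> nat}) (X : node -> {RV P >-> R}) u (z : 'I_3) :
  runoff_environment beta alpha Z X ->
  fine (P [set w : T | zbit (fun u => Z u) u w = z]) = zlaw beta z.
Proof.
move=> hZX; pose e (k : nat) := fine (P [set w : T | zbit (fun u => Z u) u w = k]).
have me k := sigma_of_measurable (P := P) (measurable_zbit Z u k).
have e0 : e 0%N = beta * (1 - beta).
  rewrite /e (_ : [set w | _] = [set w | Z u w = 0%N]).
    by rewrite (offspring_eq0 hZX).
  by apply/seteqP; split=> w /=; rewrite /zbit; lia.
have e1 : e 1%N = beta ^+ 2 + (1 - beta) ^+ 2.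
  rewrite /e (_ : [set w | _] = [set w | Z u w = 1%N]).
    by rewrite (offspring_eq1 hZX).
  by apply/seteqP; split=> w /=; rewrite /zbit; lia.
(* The truncated value 2 stands for every offspring number at least 2, so its probability is taken
   from the complement. *)
have e2 : e 2%N = beta * (1 - beta).
  have : e 2%N = 1 - (e 0%N + e 1%N).
    rewrite /e -fine_probD//; last by apply/seteqP; split=> w //= [->].
    rewrite -fine_prob_setC; last exact: measurableU.
    congr (fine (P _)); apply/seteqP; split=> w /=; rewrite /zbit.
      by move=> -> [].
    by move=> h; have := geq_minr (Z u w) 2; case: (minn _ _) h => [|[|[|k]]] // [];
      [left|right].
  by rewrite e0 e1 => ->; ring.
by case: z => -[|[|[|//]]] /= _; rewrite -/(e _) /zlaw ?e0 ?e1 ?e2.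
Qed.

Definition label_class d (T : measurableType d) (R : realType) (P : probability T R)
    (Z : node -> {RV P >-> nat}) (X : node -> {RV P >-> R}) (i : (node + node)%type)
    : set (set T) :=
  match i with inl u => sigma_of (Z u) | inr u => sigma_of (X u) end.

Definition codes_event (T : Type) (Y : nat -> node -> T -> nat)
    (ys : seq (node * nat * nat)) : set T :=
  [set w | all (fun y => Y y.1.2 y.1.1 w == y.2) ys].

Lemma codes_event_nil (T : Type) (Y : nat -> node -> T -> nat) : codes_event Y [::] = setT.
Proof. by apply/seteqP; split. Qed.

Lemma codes_event_cons (T : Type) (Y : nat -> node -> T -> nat) y ys :
  codes_event Y (y :: ys) = [set w | Y y.1.2 y.1.1 w = y.2] `&` codes_event Y ys.
Proof.
apply/seteqP; split=> w /=; first by move=> /andP[/eqP].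
by move=> [e h]; rewrite /codes_event/= e eqxx.
Qed.

Lemma label_class_measurable d (T : measurableType d) (R : realType) (P : probability T R)
    (Z : node -> {RV P >-> nat}) (X : node -> {RV P >-> R}) i A :
  label_class Z X i A -> measurable A.
Proof. by case: i => u; exact: (sigma_of_measurable (P := P)). Qed.

Lemma measurable_codes_event d (T : measurableType d) (Y : nat -> node -> T -> nat) ys :
  (forall n u (B : set nat), measurable [set w | B (Y n u w)]) ->
  measurable (codes_event Y ys).
Proof.
move=> mY; elim: ys => [|y ys IH]; first by rewrite codes_event_nil.
by rewrite codes_event_cons; apply: measurableI => //; exact: (mY _ _ [set y.2]).
Qed.

(* Unfolding a code of depth [n.+1] at [u] gives two codes of depth [n] and the
   two labels of [u], so that the sum of the [3 ^ n] decreases. *)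
Lemma joint_law d (T : measurableType d) (R : realType) (P : probability T R) beta alpha
    (Z : node -> {RV P >-> nat}) (X : node -> {RV P >-> R})
    (s : seq (node + node)) (A : node + node -> set T) (ys : seq (node * nat * nat)) :
  runoff_environment beta alpha Z X ->
  let Y := runoff_code (xbit (fun u => X u)) (zbit (fun u => Z u)) in
  let law := code_law (xlaw alpha) (zlaw beta) in
  uniq s -> (forall i, i \in s -> label_class Z X i (A i)) ->
  (forall y i, y \in ys -> i \in s -> ~~ prefix y.1.1 (label_node i)) ->
  pairwise (fun y y' => incomparable y.1.1 y'.1.1) ys ->
  fine (P ((\bigcap_(i in [set` s]) A i) `&` codes_event Y ys)) =
  (\prod_(i <- s) fine (P (A i))) * \prod_(y <- ys) law y.1.2 y.2.
Proof.
move=> hZX Y law.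
have mx u x : measurable [set w : T | xbit (fun u => X u) u w = x].
  exact: (sigma_of_measurable (P := P) (measurable_xbit X u x)).
have mz u z : measurable [set w : T | zbit (fun u => Z u) u w = z].
  exact: (sigma_of_measurable (P := P) (measurable_zbit Z u z)).
have mY n u (B : set nat) : measurable [set w | B (Y n u w)].
  exact: measurable_runoff_code.
have mE s' A' ys' : uniq s' -> (forall i, i \in s' -> label_class Z X i (A' i)) ->
    measurable ((\bigcap_(i in [set` s']) A' i) `&` codes_event Y ys').
  move=> us cA; apply: measurableI; last exact: measurable_codes_event.
  apply: fin_bigcap_measurable => [|i /= /cA]; first exact: finite_seq.
  exact: label_class_measurable.
have [N] := ubnP (\sum_(y <- ys) 3 ^ y.1.2)%N.
elim: N s A ys => // N IH s A [_ us cA _ _|[[u n] k] ys le us cA fr].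
  rewrite big_nil mulr1 codes_event_nil setIT.
  rewrite (environment_independent hZX us)//.
  suff -> : (\prod_(i <- s) P (A i) = (\prod_(i <- s) fine (P (A i)))%:E)%E by [].
  elim: s {us} cA => [|i s IHs] cA; first by rewrite !big_nil.
  rewrite !big_cons EFinM IHs; last by move=> j js; apply: cA; rewrite inE js orbT.
  by rewrite fineK//; apply: fin_num_measure; exact: label_class_measurable (cA i (mem_head _ _)).
move=> /= /andP[hu pw].
have fr' : forall y i, y \in ys -> i \in s -> ~~ prefix y.1.1 (label_node i).
  by move=> y i yys; apply: fr; rewrite inE yys orbT.
case: n le fr hu => [|n] le fr hu.
  rewrite codes_event_cons big_cons /=; have [k0|k0] := eqVneq k 0%N.
    rewrite (_ : [set w | Y 0%N u w = k] = setT) ?setTI ?mul1r; last first.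
      by apply/seteqP; split=> w //= _; rewrite k0.
    rewrite (_ : law 0%N k = 1) ?mul1r; last by rewrite /law /= k0.
    by apply: IH => //; move: le; rewrite big_cons expn0 add1n ltnS.
  rewrite (_ : law 0%N k = 0) ?mul0r ?mulr0; last by rewrite /law /= (negbTE k0).
  rewrite (_ : _ `&` _ = set0) ?measure0//; apply/seteqP; split=> w //=.
  by move=> [_ [k0' _]]; rewrite -k0' eqxx in k0.
(* The event is split according to the two labels of u and the codes of its first two children;
   [inord] is harmless as all these values are in range. *)
pose f w : code_key n := (xbit (fun u => X u) u w, inord (zbit (fun u => Z u) u w),
  inord (Y n (rcons u 0%N) w), inord (Y n (rcons u 1%N) w)).
have fE w (q : code_key n) : f w = q <->
   [/\ xbit (fun u => X u) u w = q.1.1.1, zbit (fun u => Z u) u w = q.1.1.2 :> nat,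
     Y n (rcons u 0%N) w = q.1.2 :> nat & Y n (rcons u 1%N) w = q.2 :> nat].
  case: q => [[[x z] i] j] /=; rewrite /f; split; last first.
    by move=> [-> -> -> ->]; rewrite !inord_val.
  case=> <- <- <- <-; rewrite !inordK// ltnS; try exact: runoff_code_le.
  exact: geq_minr.
have mf q : measurable (f @^-1` [set q]).
  rewrite (_ : _ @^-1` _ = [set w | xbit (fun u => X u) u w = q.1.1.1] `&`
    [set w | zbit (fun u => Z u) u w = q.1.1.2 :> nat] `&`
    [set w | Y n (rcons u 0%N) w = q.1.2 :> nat] `&`
    [set w | Y n (rcons u 1%N) w = q.2 :> nat]).
    by apply: measurableI; [apply: measurableI; [exact: measurableI|
      exact: (mY _ _ [set (q.1.2 : nat)])]|exact: (mY _ _ [set (q.2 : nat)])].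
  by apply/seteqP; split=> w /=; [move/fE => []|move=> [[[? ?] ?] ?]; apply/fE].
have -> : \prod_(y <- (u, n.+1, k) :: ys) law y.1.2 y.2 =
    (\sum_(q : code_key n) xlaw alpha q.1.1.1 * zlaw beta q.1.1.2 *
      law n q.1.2 * law n q.2 * (combine_key q == k)%:R) * \prod_(y <- ys) law y.1.2 y.2.
  by rewrite big_cons.
rewrite (fine_prob_partition P (mE s A _ us cA) mf) big_distrl big_distrr.
apply: eq_bigr => q _.
change (fine (P (\bigcap_(i in [set` s]) A i `&` codes_event Y ((u, n.+1, k) :: ys)
    `&` f @^-1` [set q])) =
  \prod_(i <- s) fine (P (A i)) * (xlaw alpha q.1.1.1 * zlaw beta q.1.1.2 *
    law n q.1.2 * law n q.2 * (combine_key q == k)%:R * \prod_(y <- ys) law y.1.2 y.2)).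
pose s' := inl u :: inr u :: s.
pose A' i := if i == inl u then [set w : T | zbit (fun u => Z u) u w = q.1.1.2 :> nat]
  else if i == inr u then [set w : T | xbit (fun u => X u) u w = q.1.1.1] else A i.
pose ys' := (rcons u 0%N, n, nat_of_ord q.1.2) :: (rcons u 1%N, n, nat_of_ord q.2) :: ys.
have uns i : label_node i = u -> i \notin s.
  move=> iu; apply/negP => is_; have := fr _ i (mem_head _ _) is_.
  by rewrite iu prefix_refl.
have A's i : i \in s -> A' i = A i.
  move=> is_; rewrite /A'; case: eqP => [e|_]; first by have := uns (inl u) erefl; rewrite -e is_.
  by case: eqP => // e; have := uns (inr u) erefl; rewrite -e is_.
have us' : uniq s' by rewrite /= inE/= !uns.
have fY w : f w = q -> Y n.+1 u w = combine_key q.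
  by move/fE; case: (q) => [[[x z] i] j] /= [<- <- <- <-].
have [ck|ck] := eqVneq (combine_key q) k; last first.
  rewrite mulr0 mul0r mulr0 (_ : _ `&` _ = set0) ?measure0//.
  rewrite codes_event_cons; apply/seteqP; split=> w //= [[_ [Yk _]] /fY]; rewrite Yk => e.
  by rewrite e eqxx in ck.
have -> : (\bigcap_(i in [set` s]) A i) `&` codes_event Y ((u, n.+1, k) :: ys) `&` f @^-1` [set q] =
   (\bigcap_(i in [set` s']) A' i) `&` codes_event Y ys'.
  rewrite !codes_event_cons; apply/seteqP; split=> w /=.
    move=> [[hA [_ hY]]] /fE[h1 h2 h3 h4]; split; last by split.
    move=> i /=; rewrite !inE => /orP[/eqP ->|/orP[/eqP ->|is_]].
    - by rewrite /A' eqxx.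
    - by rewrite /A' /= eqxx.
    - by rewrite A's//; exact: hA.
  move=> [hA [h3 [h4 hY]]].
  have h1 : A' (inl u) w by apply: hA; rewrite /= inE eqxx.
  have h2 : A' (inr u) w by apply: hA; rewrite /= !inE eqxx orbT.
  rewrite /A' eqxx in h1; rewrite /A' /= eqxx in h2.
  have fq : f w = q by apply/fE.
  split; last by [].
  split; last by split; [rewrite (fY _ fq)|].
  by move=> i /= is_; rewrite -A's//; apply: hA; rewrite /= !inE is_ !orbT.
rewrite IH//.
- rewrite /s' !big_cons /= -/law (eq_big_seq (fun i => fine (P (A i)))); last first.
    by move=> i is_; rewrite A's.
  rewrite {1}/A' eqxx (zlawE _ _ hZX) {1}/A' [inr u == inl u]/= eqxx (xlawE _ _ hZX).
  by ring.
- move: le; rewrite !big_cons /= expnS; set S := (\sum_(_ <- _) _)%N.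
  by have := expn_gt0 3 n; lia.
- move=> i; rewrite !inE => /orP[/eqP ->|/orP[/eqP ->|is_]].
  + by rewrite /A' eqxx; exact: measurable_zbit.
  + by rewrite /A' /= eqxx; exact: measurable_xbit.
  + by rewrite A's//; exact: cA.
- move=> y i; rewrite !inE.
  have key (l : nat) : i \in s' -> ~~ prefix (rcons u l) (label_node i).
    rewrite !inE => /orP[/eqP ->|/orP[/eqP ->|is_]]; rewrite /= ?prefix_rcons_self//.
    by apply: contra (fr _ i (mem_head _ _) is_); exact: prefix_rcons_l.
  move=> /orP[/eqP ->|/orP[/eqP ->|yys]] is'; try exact: key.
  move: is' => /orP[/eqP ->|/orP[/eqP ->|is_]]; last exact: fr'.
    by move/allP: hu => /(_ _ yys) /andP[].
  by move/allP: hu => /(_ _ yys) /andP[].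
- rewrite /= pw incomparable_siblings//= andbT.
  have inc (l : nat) : all (fun y => incomparable (rcons u l) y.1.1) ys.
    by apply: sub_all hu => y /=; exact: incomparable_rcons.
  by rewrite !inc.
Qed.

Lemma runoff_code_law d (T : measurableType d) (R : realType) (P : probability T R) beta alpha
    (Z : node -> {RV P >-> nat}) (X : node -> {RV P >-> R}) n u k :
  runoff_environment beta alpha Z X ->
  fine (P [set w | runoff_code (xbit (fun u => X u)) (zbit (fun u => Z u)) n u w = k]) =
  code_law (xlaw alpha) (zlaw beta) n k.
Proof.
move=> hZX; have := @joint_law _ _ _ _ _ _ _ _ [::] (fun=> setT) [:: (u, n, k)] hZX.
rewrite /= big_cons !big_nil mul1r mulr1 => <- //.
rewrite (_ : [set` [::]] = set0) ?bigcap_set0 ?setTI ?codes_event_cons ?codes_event_nil ?setIT//.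
by apply/seteqP; split.
Qed.

(* The code [0], which means no extinction so far, contributes nothing. *)
Definition ext_pow (R : realType) (t : R) (k : nat) : R := if k is j.+1 then t ^+ j else 0.

Definition code_gf (R : realType) (law : nat -> nat -> R) (n : nat) (t : R) : R :=
  \sum_(k < (2 ^ n).+1) law n k * ext_pow t k.

Lemma code_law_sum (R : realType) (px : bool -> R) (pz : nat -> R) n (phi : nat -> R) :
  \sum_(k < (2 ^ n.+1).+1) code_law px pz n.+1 k * phi k =
  \sum_(x : bool) \sum_(z < 3) \sum_(i < (2 ^ n).+1) \sum_(j < (2 ^ n).+1)
    px x * pz z * code_law px pz n i * code_law px pz n j * phi (combine x z i j).
Proof.
transitivity (\sum_(q : code_key n) px q.1.1.1 * pz q.1.1.2 *
    code_law px pz n q.1.2 * code_law px pz n q.2 * phi (combine_key q)).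
  under eq_bigr => k _ do rewrite /= big_distrl/=.
  rewrite exchange_big /=; apply: eq_bigr => -[[[x z] i] j] _ /=.
  have le : (combine x z i j < (2 ^ n.+1).+1)%N.
    by rewrite ltnS expnS combine_le ?expn_gt0// -ltnS.
  rewrite (bigD1 (Ordinal le))//= eqxx mulr1 big1 ?addr0// => k kn.
  rewrite (_ : (_ == _) = false) ?mulr0 ?mul0r//.
  by apply/negbTE; apply: contra kn => /eqP e; apply/eqP/val_inj.
rewrite !pair_bigA /=; apply: eq_bigr => -[[[x z] i] j] _ //.
Qed.

(** [D] is t to the inflow, or 0 if a subtree present is not known to be extinct. The factor t
    avoids negative powers: t * t^max(s-1, 0) = t^s - (1 - t) 0^s, and the term 0^s is what brings
    in the value at 0. *)
Lemma ext_pow_combine (R : realType) (t : R) x (z : 'I_3) i j :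
  let D s : R := if z == 0%N :> nat then 1 else if z == 1%N :> nat then ext_pow s i
             else ext_pow s i * ext_pow s j in
  t * ext_pow t (combine x z i j) =
  if x then t ^+ 2 * D t else D t - (1 - t) * D 0.
Proof.
case: z => -[|[|[|//]]] z3 /=; case: x; case: i => [|i]; case: j => [|j] /=;
  rewrite /combine /= ?mul1n ?mul0n ?addn0 ?add0n ?mulr0 ?mul0r ?expr1n /=; try ring.
all: try by rewrite exprS; ring.
all: try by rewrite !exprS; ring.
all: try by (case: i => [|i] /=; rewrite ?expr0n ?exprS /=; ring).
- by rewrite !exprS exprD; ring.
- by case: i => [|i]; case: j => [|j]; rewrite ?addSn ?addnS ?add0n ?addn0 /= ?expr0n /= ?exprS ?exprD ?expr0; ring.
Qed.

Lemma code_law_mass (R : realType) (alpha beta : R) n :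
  \sum_(k < (2 ^ n).+1) code_law (xlaw alpha) (zlaw beta) n k = 1.
Proof.
elim: n => [|n IH].
  by rewrite expn0 !big_ord_recl big_ord0 /= !addr0.
transitivity (\sum_(k < (2 ^ n.+1).+1) code_law (xlaw alpha) (zlaw beta) n.+1 k * 1).
  by apply: eq_bigr => k _; rewrite mulr1.
rewrite (code_law_sum _ _ _ (fun=> 1)).
transitivity (\sum_(x : bool) \sum_(z < 3) xlaw alpha x * zlaw beta z).
  apply: eq_bigr => x _; apply: eq_bigr => z _.
  rewrite -[RHS]mulr1 -IH big_distrr/=; apply: eq_bigr => i _.
  rewrite -[RHS]mulr1 -IH big_distrr/=; apply: eq_bigr => j _.
  by rewrite IH mulr1.
by rewrite big_bool /= !big_ord_recl !big_ord0 /= /zlaw /=; ring.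
Qed.

(** The offspring generating function, with beta^2 + (1 - beta)^2 = 1 - 2b. *)
Definition offspring_gf (R : realType) (b g : R) : R := b + (1 - 2 * b) * g + b * g ^+ 2.

Lemma code_gf_rec (R : realType) (alpha beta : R) n (t : R) :
  let b := beta * (1 - beta) in
  let g := code_gf (code_law (xlaw alpha) (zlaw beta)) n in
  t * code_gf (code_law (xlaw alpha) (zlaw beta)) n.+1 t =
  qA alpha t * offspring_gf b (g t) - (1 - alpha) * (1 - t) * offspring_gf b (g 0).
Proof.
move=> b g; set law := code_law _ _; pose D (z i j : nat) s : R :=
  if z == 0%N then 1 else if z == 1%N then ext_pow s i else ext_pow s i * ext_pow s j.
have DE (z : 'I_3) s : \sum_(i < (2 ^ n).+1) \sum_(j < (2 ^ n).+1)
    law n i * law n j * D z i j s =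
    if z == 0%N :> nat then 1 else if z == 1%N :> nat then g s else g s ^+ 2.
  have M := code_law_mass alpha beta n; rewrite -/law in M.
  rewrite /D; case: (z == 0%N :> nat).
    rewrite -[RHS]M; apply: eq_bigr => i _; rewrite -[RHS]mulr1 -M big_distrr/=.
    by apply: eq_bigr => j _; rewrite M mulr1.
  case: (z == 1%N :> nat).
    apply: eq_bigr => i _; rewrite -[RHS]mulr1 -M big_distrr/=.
    by apply: eq_bigr => j _; rewrite -/law; ring.
  rewrite expr2 {1}/g big_distrl/=; apply: eq_bigr => i _.
  by rewrite /g /code_gf big_distrr/=; apply: eq_bigr => j _; rewrite -/law; ring.
have PE s : \sum_(z < 3) zlaw beta z * (\sum_(i < (2 ^ n).+1) \sum_(j < (2 ^ n).+1)
    law n i * law n j * D z i j s) = offspring_gf b (g s).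
  under eq_bigr do rewrite DE.
  by rewrite !big_ord_recl !big_ord0 /= /zlaw /offspring_gf /= /b; ring.
rewrite /code_gf code_law_sum big_distrr /=.
transitivity (\sum_(x : bool) xlaw alpha x *
    (if x then t ^+ 2 * offspring_gf b (g t)
     else offspring_gf b (g t) - (1 - t) * offspring_gf b (g 0))); last first.
  by rewrite big_bool /= /qA; ring.
apply: eq_bigr => x _.
transitivity (xlaw alpha x * \sum_(z < 3) zlaw beta z *
    (\sum_(i < (2 ^ n).+1) \sum_(j < (2 ^ n).+1) law n i * law n j *
      (if x then t ^+ 2 * D z i j t else D z i j t - (1 - t) * D z i j 0))).
  rewrite !big_distrr/=; apply: eq_bigr => z _; rewrite !big_distrr/=.
  apply: eq_bigr => i _; rewrite !big_distrr/=; apply: eq_bigr => j _.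
  have := ext_pow_combine t x z i j; rewrite /= -/(D z i j t) -/(D z i j 0) => <-.
  by rewrite -/law; ring.
congr (_ * _); rewrite -!PE; case: x.
  rewrite big_distrr/=; apply: eq_bigr => z _; rewrite mulrCA; congr (_ * _).
  rewrite big_distrr/=; apply: eq_bigr => i _; rewrite big_distrr/=.
  by apply: eq_bigr => j _; ring.
rewrite big_distrr/= -sumrB; apply: eq_bigr => z _; rewrite mulrCA -mulrBr; congr (_ * _).
rewrite big_distrr/= -sumrB; apply: eq_bigr => i _; rewrite big_distrr/= -sumrB.
by apply: eq_bigr => j _; ring.
Qed.

(** The survival probability satisfies e' = e - b e^2, so 1/e grows by at least b at each step. *)
Lemma extinction_cvg (R : realType) (b : R) (q : nat -> R) : 0 < b <= 4^-1 ->
  q 0%N = 0 -> (forall n, q n.+1 = offspring_gf b (q n)) ->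
  forall n, 0 <= 1 - q n <= (1 + b * n%:R)^-1.
Proof.
move=> /andP[b0 b4] q0 qS; elim=> [|n /andP[e0 e1]].
  by rewrite q0 subr0 mulr0 addr0 invr1 ler01 lexx.
have E : 1 - q n.+1 = (1 - q n) - b * (1 - q n) ^+ 2.
  by rewrite qS /offspring_gf; ring.
rewrite E; move: e0 e1; set e := 1 - q n => e0 e1.
have n0 : 0 <= b * n%:R by rewrite mulr_ge0// ltW.
pose d := 1 + b * n%:R; have d1 : 1 <= d by rewrite /d; lra.
have i1 : d^-1 <= 1 by rewrite invf_le1//; lra.
apply/andP; split; first by nra.
have -> : 1 + b * n.+1%:R = d + b by rewrite -natr1 /d; ring.
rewrite -/d in e1; have d0 : 0 < d by lra.
have dd : d * d^-1 = 1 by rewrite mulfV// gt_eqF.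
have h : e - b * e ^+ 2 <= d^-1 - b * d^-1 ^+ 2.
  have : b * (d^-1 + e) <= 1 by nra.
  nra.
apply: (le_trans h); rewrite -[leRHS]mul1r ler_pdivlMr; last by lra.
have -> : (d^-1 - b * d^-1 ^+ 2) * (d + b) =
    (d * d^-1) * (1 - b * d^-1) + (b * d^-1 - b ^+ 2 * d^-1 ^+ 2) by ring.
have := sqr_ge0 (b * d^-1); rewrite dd exprMn; lra.
Qed.

Lemma in_tree_rcons (z : node -> nat) u j : in_tree z u -> (j < z u)%N -> in_tree z (rcons u j).
Proof.
move=> tu jz v i /prefix_rcons_inv[/rcons_inj[-> ->]//|]; exact: tu.
Qed.

(** A nonzero code certifies that the subtree at u is finite, so induction on the depth determines
    any solution of the recursion there. *)
Lemma runoff_codeP (R : realType) (T : Type) (X : node -> T -> R) (Z : node -> T -> nat)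
    (w : T) (W : node -> R) n u k :
  (forall u, (Z u w <= 2)%N) -> (forall u, X u w = 1 \/ X u w = -1) ->
  is_runoff (fun u => Z u w) (fun u => X u w) W -> in_tree (fun u => Z u w) u ->
  runoff_code (xbit X) (zbit Z) n u w = k.+1 -> W u = k%:R.
Proof.
move=> Z2 X1 rW; elim: n u k => //= n IH u k tu.
rewrite (rW u tu) /combine; set i := runoff_code _ _ _ _ _; set j := runoff_code _ _ _ _ _.
have zE : zbit Z u w = Z u w by rewrite /zbit; apply/minn_idPl.
rewrite zE; case: ifP => // /negbT; rewrite negb_or !negb_and => /andP[hi hj] [kE].
pose s := ((0 < Z u w) * i.-1 + (1 < Z u w) * j.-1)%N.
have sE : \sum_(j < Z u w) W (rcons u j) = s%:R.
  have Wi : (0 < Z u w)%N -> W (rcons u 0%N) = i.-1%:R.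
    move=> Z0; apply: IH; first exact: in_tree_rcons.
    by rewrite -/i prednK// lt0n; move: hi; rewrite Z0.
  have Wj : (1 < Z u w)%N -> W (rcons u 1%N) = j.-1%:R.
    move=> Z0; apply: IH; first exact: in_tree_rcons.
    by rewrite -/j prednK// lt0n; move: hj; rewrite Z0.
  rewrite /s; move: Wi Wj (Z2 u); case: (Z u w) => [|[|[|//]]] Wi Wj _.
  - by rewrite big_ord0.
  - by rewrite big_ord1 /= Wi// mul1n mul0n addn0.
  - by rewrite !big_ord_recl big_ord0 /= /bump /= Wi// Wj// !mul1n addr0 natrD.
rewrite sE -kE -/s /xbit.
have s0 : 0 <= s%:R :> R by [].
have [->|->] := X1 u.
  rewrite eqxx max_l; first by rewrite addrC natr1.
  by rewrite addr_ge0.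
rewrite (_ : (-1 == 1 :> R) = false); last by apply/eqP; lra.
case: (s) => [|s']; first by rewrite addr0 max_r//; lra.
by rewrite -natr1 addrC addrK max_l.
Qed.

Lemma fine_prob_mod_null d (T : measurableType d) (R : realType) (P : probability T R)
    (A B N : set T) : measurable A -> measurable B -> measurable N -> P N = 0%E ->
  A `<=` B `|` N -> fine (P A) <= fine (P B).
Proof.
move=> mA mB mN N0 AB; apply: (le_trans (le_fine_prob P mA (measurableU _ _ mB mN) AB)).
rewrite fine_le ?fin_num_measure//; first exact: measurableU.
by rewrite measureU0.
Qed.

Lemma code_tail d (T : measurableType d) (R : realType) (P : probability T R) beta alpha
    (Z : node -> {RV P >-> nat}) (X : node -> {RV P >-> R}) n u m :
  runoff_environment beta alpha Z X ->
  fine (P [set w | (m < runoff_code (xbit (fun u => X u)) (zbit (fun u => Z u)) n u w)%N]) =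
  \sum_(k < (2 ^ n).+1) code_law (xlaw alpha) (zlaw beta) n k * (m < k)%:R.
Proof.
move=> hZX; set Y := runoff_code _ _.
have mY (B : set nat) : measurable [set w | B (Y n u w)].
  apply: measurable_runoff_code => v x.
    exact: (sigma_of_measurable (P := P) (measurable_xbit X v x)).
  exact: (sigma_of_measurable (P := P) (measurable_zbit Z v x)).
pose f w : 'I_(2 ^ n).+1 := inord (Y n u w).
have fE w k : f w = k <-> Y n u w = k.
  have le : (Y n u w < (2 ^ n).+1)%N by rewrite ltnS; exact: runoff_code_le.
  by split=> [<-|e]; [rewrite inordK|rewrite /f e inord_val].
have fS k : f @^-1` [set k] = [set w | Y n u w = k].
  by apply/seteqP; split=> w /=; [move/fE|move=> e; apply/fE].
have mf k : measurable (f @^-1` [set k]) by rewrite fS; exact: (mY [set (k : nat)]).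
rewrite (fine_prob_partition P (mY [set k | (m < k)%N]) mf); apply: eq_bigr => k _.
rewrite fS -(runoff_code_law n u k hZX) -/Y; case: ltnP => mk.
  rewrite mulr1; congr (fine (P _)); apply/seteqP; split=> w /=; first by case.
  by move=> e; split=> //; rewrite e.
rewrite mulr0 (_ : _ `&` _ = set0) ?measure0//; apply/seteqP; split=> w //= [h e].
by move: h; rewrite e ltnNge mk.
Qed.

(** The condition m + 1 < k says that the code k stands for a runoff k - 1 > m; the code 0 never
    counts. *)
Lemma code_tail_gf (R : realType) (alpha beta : R) n (t : R) : 0 <= t < 1 ->
  let law := code_law (xlaw alpha) (zlaw beta) in
  has_sum (fun m => (\sum_(k < (2 ^ n).+1) law n k * (m.+1 < k)%:R) * t ^+ m)
    ((code_gf law n 1 - code_gf law n t) / (1 - t)).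
Proof.
move=> tt law; have geo N : \sum_(k < N) t ^+ k = (1 - t ^+ N) / (1 - t).
  elim: N => [|N IH]; first by rewrite big_ord0 expr0 subrr mul0r.
  by rewrite big_ord_recr/= IH exprS; field; lra.
have H (k : 'I_(2 ^ n).+1) : has_sum (fun m => law n k * (t ^+ m * (m < k.-1)%:R))
    (law n k * ((ext_pow 1 k - ext_pow t k) / (1 - t))).
  apply: has_sumZ; have := has_sum_fin (fun m => t ^+ m) k.-1; rewrite geo.
  case: (nat_of_ord k) => [|j] /=; last by rewrite expr1n.
  by rewrite expr0 !subrr.
have := has_sum_sum (index_enum _) H.
rewrite /code_gf -sumrB big_distrl/= => /eq_has_sum HH.
rewrite (eq_bigr (fun k : 'I_(2 ^ n).+1 => law n k * ((ext_pow 1 k - ext_pow t k) / (1 - t)))).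
  apply: HH => m; rewrite big_distrl/=; apply: eq_bigr => k _.
  rewrite (_ : (m.+1 < k)%N = (m < k.-1)%N); first by ring.
  by case: (nat_of_ord k).
by move=> k _; ring.
Qed.

Lemma measurable_tail d (T : measurableType d) (R : realType) (P : probability T R)
    (W : {RV P >-> R}) (x : R) : measurable [set w | x < W w].
Proof.
rewrite (_ : [set _ | _] = W @^-1` `]x, +oo[%classic).
  exact: (measurable_funPTI W (measurable_itv _)).
by apply/seteqP; split=> w /=; rewrite in_itv/= andbT.
Qed.

Lemma negligible_countable d (T : measurableType d) (R : realType) (P : probability T R)
    (K : countType) (F : K -> set T) :
  (forall k, P.-negligible (F k)) -> P.-negligible (\bigcup_k F k).
Proof.
move=> nF; pose G i := if unpickle i is Some k then F k else set0.
apply: (@negligibleS _ _ _ _ (\bigcup_i G i)).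
  by move=> w [k _ Fw]; exists (pickle k) => //; rewrite /G pickleK.
by apply: negligible_bigcup => i; rewrite /G; case: unpickle => // ; exact: negligible_set0.
Qed.

Lemma environment_values d (T : measurableType d) (R : realType) (P : probability T R) beta alpha
    (Z : node -> {RV P >-> nat}) (X : node -> {RV P >-> R}) :
  runoff_environment beta alpha Z X ->
  {ae P, forall w : T, forall u, (Z u w <= 2)%N /\ (X u w = 1 \/ X u w = -1)}.
Proof.
move=> hZX; apply: (@negligibleS _ _ _ _ (\bigcup_u
  ([set w | (2 < Z u w)%N] `|` ~` [set w | X u w = 1 \/ X u w = -1]))).
  move=> w /= /existsNP[u] /not_andP h; exists u => //=.
  by case: h => [/negP|h]; [rewrite -ltnNge; left|right].
apply: negligible_countable => u; apply: negligibleU.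
  have mZ k : measurable [set w | Z u w = k] by apply: (@measurable_funPTI _ _ _ _ (Z u) [set k]).
  have mB : measurable [set w | (2 < Z u w)%N] by apply: (@measurable_funPTI _ _ _ _ (Z u) [set k | (2 < k)%N]).
  apply/negligibleP => //; rewrite -[LHS]fineK ?fin_num_measure//; congr EFin.
  rewrite (_ : [set w | (2 < Z u w)%N] = ~` ([set w | Z u w = 0%N] `|` [set w | Z u w = 1%N] `|` [set w | Z u w = 2%N])).
    rewrite fine_prob_setC; last by do 2?apply: measurableU.
    rewrite !fine_probD; try by do ?apply: measurableU.
    - rewrite (offspring_eq0 hZX) (offspring_eq1 hZX) (offspring_eq2 hZX) /=; ring.
    - by apply/seteqP; split=> w //= [->].
    - by apply/seteqP; split=> w //= [[->|->]].
  apply/seteqP; split=> w /=; first by move=> h [[]|] e; rewrite e in h.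
  by case: (Z u w) => [|[|[|k]]] // h; exfalso; apply: h; tauto.
have m1 : measurable [set w | X u w = 1] by exact: (measurable_funPTI (X u) (measurable_set1 1)).
have m2 : measurable [set w | X u w = -1] by exact: (measurable_funPTI (X u) (measurable_set1 (-1))).
have mU : measurable [set w | X u w = 1 \/ X u w = -1] by exact: measurableU.
apply/negligibleP; first exact: measurableC.
rewrite -[LHS]fineK ?fin_num_measure//; last exact: measurableC.
congr EFin; rewrite fine_prob_setC// (fine_probD _ m1 m2).
  rewrite (contribution_eq1 hZX) (contribution_eqN1 hZX) /=; ring.
by apply/seteqP; split=> w //= [->]; lra.
Qed.

Lemma runoff_root_code d (T : measurableType d) (R : realType) (P : probability T R) beta alpha
    (Z : node -> {RV P >-> nat}) (X W : node -> {RV P >-> R}) :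
  runoff_environment beta alpha Z X ->
  {ae P, forall w : T, is_runoff (fun u => Z u w) (fun u => X u w) (fun u => W u w)} ->
  exists N, [/\ measurable N, P N = 0%E & forall w, ~ N w -> forall n k,
    runoff_code (xbit (fun u => X u)) (zbit (fun u => Z u)) n [::] w = k.+1 ->
    W [::] w = k%:R].
Proof.
move=> hZX hW; have [N [mN N0 sN]] := negligibleU (environment_values hZX) hW.
exists N; split=> // w Nw n k.
have [h1 h2] : (forall u, (Z u w <= 2)%N /\ (X u w = 1 \/ X u w = -1)) /\
    is_runoff (fun u => Z u w) (fun u => X u w) (fun u => W u w).
  by split; apply: contrapT => h; apply: Nw; apply: sN; [left|right].
apply: (runoff_codeP _ _ h2) => [u|u|v j]; try by case: (h1 u).
by rewrite prefixs0; case: v.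
Qed.

(** P(W > m) lies between the tail of the code of depth n and that tail plus the probability of the
    code 0. As the latter tends to 0, the recursion for the codes passes to the limit. *)
Lemma runoff_root_tail_equation d (T : measurableType d) (R : realType) (P : probability T R)
    beta alpha (Z : node -> {RV P >-> nat}) (X W : node -> {RV P >-> R}) :
  let b := beta * (1 - beta) in
  let a m := fine (P [set w | m%:R < W [::] w]) in
  0 < beta <= 1 / 2 -> 0 < alpha < 1 ->
  runoff_environment beta alpha Z X ->
  {ae P, forall w : T, is_runoff (fun u => Z u w) (fun u => X u w) (fun u => W u w)} ->
  exists c y, tail_equation b alpha c a y.
Proof.
move=> b a bet al01 hZX hW.
have [_ _ b4] := alpha_c_facts bet; rewrite -/b in b4.
have [N [mN N0 WY]] := runoff_root_code hZX hW.
pose law := code_law (xlaw alpha) (zlaw beta).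
pose g n t := code_gf law n t.
pose tail n m := \sum_(k < (2 ^ n).+1) law n k * (m.+1 < k)%:R.
have mW := measurable_tail (W [::]).
have a01 m : 0 <= a m <= 1 by exact: fine_prob_itv.
have a_dec m : a m.+1 <= a m.
  apply: le_fine_prob => // w /=; apply: le_lt_trans; by rewrite ler_nat.
pose eps n := 1 - g n 1.
have b01 := b4.
have eps_bound n : 0 <= eps n <= (1 + b * n%:R)^-1.
  apply: (@extinction_cvg R b (fun n => g n 1)) => // [|k].
    by rewrite /g /code_gf expn0 !big_ord_recl big_ord0 /= mulr0 mul0r !addr0.
  have := code_gf_rec alpha beta k 1; rewrite /= mul1r subrr mulr0 mul0r subr0 /qA.
  by rewrite expr1n subrr mulr0 subr0 mul1r => e; exact: e.
have law0 n : law n 0%N = eps n.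
  have M := code_law_mass alpha beta n; rewrite -/law in M.
  rewrite /eps -[X in X - _]M /g /code_gf -sumrB big_ord_recl /= mulr0 subr0 big1 ?addr0// => i _.
  by rewrite /= expr1n mulr1 subrr.
have atail n m : tail n m <= a m <= tail n m + eps n.
  rewrite /tail -(code_tail n [::] m.+1 hZX) -law0 /law -(runoff_code_law n [::] 0 hZX).
  set Y := runoff_code _ _.
  have mY (B : set nat) : measurable [set w | B (Y n [::] w)].
    apply: measurable_runoff_code => v x.
      exact: (sigma_of_measurable (P := P) (measurable_xbit X v x)).
    exact: (sigma_of_measurable (P := P) (measurable_zbit Z v x)).
  have mY1 := mY [set k | (m.+1 < k)%N]; have mY0 := mY [set 0%N].
  apply/andP; split.
    apply: (fine_prob_mod_null _ _ mN N0) => // w /= h.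
    have [Nw|Nw] := pselect (N w); [by right|left].
    by rewrite /= (WY w Nw n (Y n [::] w).-1) ?ltr_nat ?prednK//; move: h; case: (Y n [::] w).
  rewrite -fine_probD//; last by apply/seteqP; split=> w //= [h e]; rewrite e in h.
  apply: (fine_prob_mod_null _ _ mN N0) => //; first exact: measurableU.
  move=> w /= h; have [Nw|Nw] := pselect (N w); [by right|left].
  case YE : (Y n [::] w) => [|k]; [by right|left].
  by rewrite /= ltnS -(ltr_nat R) -(WY w Nw n k).
have b0 : 0 < b by case/andP: b4.
have eps0 : eps @ \oo --> (0 : R).
  apply: (@cvg0_le _ _ _ _ _ (fun n => b^-1 * harmonic n)).
    apply: nearW => n; have /andP[e0 e1] := eps_bound n; rewrite ger0_norm//.
    have n0 : 0 <= n%:R :> R by [].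
    have bn : 0 <= b * n%:R by rewrite mulr_ge0// ltW.
    apply: (le_trans e1); rewrite /harmonic /= -invfM lef_pV2 ?posrE//.
    - by rewrite -natr1 mulrDr mulr1 addrC lerD2r; case/andP: b4; lra.
    - by lra.
    - by rewrite mulr_gt0.
  by rewrite -[X in _ --> X](mulr0 b^-1); apply: cvgMr; exact: cvg_harmonic.
pose y t := lim (series (fun m => a m * t ^+ m) @ \oo).
have ay : gen_fun a y.
  move=> t /andP[t0 t1]; split.
  suff : cvg (series (fun m => a m * t ^+ m) @ \oo) by [].
  have tm m : 0 <= t ^+ m by rewrite exprn_ge0.
  apply: (@series_le_cvg _ _ (fun m => t ^+ m)) => //.
  - by move=> m; rewrite mulr_ge0//; case/andP: (a01 m).
  - by move=> m; rewrite ler_piMl//; case/andP: (a01 m).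
  rewrite (_ : (fun _ => _) = geometric 1 t).
    by apply: is_cvg_geometric_series; rewrite ger0_norm.
  by apply/funext => m; rewrite /geometric /= mul1r.
(* [G] is E t^W, written through the tails. *)
pose G (t : R) := 1 - (1 - t) * y t.
have Gg n (t : R) : 0 <= t < 1 -> 0 <= G t - g n t <= eps n.
  move=> tt; have [t0 t1] := andP tt.
  have tm m : 0 <= t ^+ m by rewrite exprn_ge0.
  have tl := code_tail_gf alpha beta n tt.
  have lo : (code_gf law n 1 - code_gf law n t) / (1 - t) <= y t.
    apply: ler_has_sum tl (ay t tt) _ => m; rewrite ler_wpM2r//.
    by case/andP: (atail n m).
  have up : y t <= (code_gf law n 1 - code_gf law n t) / (1 - t) + eps n * (1 - t)^-1.
    have geo : has_sum (fun m => t ^+ m) (1 - t)^-1.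
      split; have := @cvg_geometric_series R 1 t; rewrite ger0_norm// => /(_ t1).
      rewrite mul1r; rewrite (_ : geometric 1 t = GRing.exp t)//.
      by apply/funext => m; rewrite /geometric /= mul1r.
    apply: ler_has_sum (ay t tt) (has_sumD tl (has_sumZ (eps n) geo)) _ => m.
    rewrite -mulrDl ler_wpM2r//.
    by case/andP: (atail n m).
  have t1' : 0 < 1 - t by lra.
  move: lo up; rewrite -mulrDl ler_pdivlMr// ler_pdivrMr// /G /eps /g; lra.
have gG (t : R) : 0 <= t < 1 -> (fun n => g n t) @ \oo --> G t.
  move=> tt; have : (fun n => G t - g n t) @ \oo --> (0 : R).
    apply: (@cvg0_le _ _ _ _ _ eps) => //; apply: nearW => n.
    by have /andP[h1 h2] := Gg n t tt; rewrite ger0_norm.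
  move=> e0; have -> : (fun n => g n t) = (fun n => G t - (G t - g n t)).
    by apply/funext => n; rewrite subKr.
  by rewrite -[X in _ --> X]subr0; apply: cvgB e0; exact: cvg_cst.
have psi (t : R) : 0 <= t < 1 ->
    (fun n => offspring_gf b (g n t)) @ \oo --> offspring_gf b (G t).
  move=> /gG h; apply: cvgD; last first.
    by apply: cvgMr; rewrite expr2; under eq_fun do rewrite expr2; exact: cvgM.
  by apply: cvgD; [exact: cvg_cst|exact: cvgMr].
have z01 : 0 <= (0 : R) < 1 by rewrite lexx ltr01.
(* [G 0] is P(W = 0), so [offspring_gf b (G 0)] is the probability of no inflow at the root. *)
exists ((1 - alpha) * (1 - offspring_gf b (G 0))), y; split => // t tt.
have E : t * G t = qA alpha t * offspring_gf b (G t)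
    - (1 - alpha) * (1 - t) * offspring_gf b (G 0).
  have h1 : (fun n => t * g n.+1 t) @ \oo --> t * G t.
    by apply: cvgMr; have := gG t tt; rewrite -cvg_shiftS.
  have h2 : (fun n => t * g n.+1 t) @ \oo --> qA alpha t * offspring_gf b (G t)
    - (1 - alpha) * (1 - t) * offspring_gf b (G 0).
    rewrite /g; under eq_fun do rewrite code_gf_rec.
    by apply: cvgB; apply: cvgMr; [exact: psi|exact: psi].
  exact: (cvg_unique _ h1 h2).
have u1 : (1 - t) * y t = 1 - G t by rewrite /G; ring.
rewrite u1; move: E; rewrite /offspring_gf /qA /qk; clear; move: (G t) (G 0) => x z E.
transitivity ((1 - alpha * (1 - t ^+ 2)) * (b + (1 - 2 * b) * x + b * x ^+ 2) -
  (1 - alpha) * (1 - t) * (b + (1 - 2 * b) * z + b * z ^+ 2) - t * x); first by ring.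
by rewrite -E subrr.
Qed.

(** * Tails at real arguments and moments *)

Lemma cvg_truncn (R : realType) : Num.truncn x @[x --> (+oo : set_system R)] --> \oo.
Proof.
apply/cvgnyPge => A; near=> x; rewrite truncn_ge_nat; near: x.
  exact: nbhs_pinfty_ge.
exact: nbhs_pinfty_ge.
Unshelve. all: by end_near.
Qed.

(** For n <= x < n + 1, monotonicity puts s(x) F(x) between s(n) F(n+1) and s(n+1) F(n), and both
    have the limit C because s(n) / s(n+1) tends to 1. *)
Lemma asymp_equiv_tail (R : realType) (F s : R -> R) (C : R) :
  0 < C -> (forall x, 0 <= F x) -> (forall x y, x <= y -> F y <= F x) ->
  (forall x, 0 < x -> 0 < s x) -> (forall x y, 0 <= x -> x <= y -> s x <= s y) ->
  s n%:R / s n.+1%:R @[n --> \oo] --> (1 : R) ->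
  s n%:R * F n%:R @[n --> \oo] --> C ->
  asymp_equiv F (fun x => C * (s x)^-1).
Proof.
move=> C0 F0 Fle s0 sle sr sF.
have lo : s n%:R * F n.+1%:R @[n --> \oo] --> C.
  have h1 : s n.+1%:R * F n.+1%:R @[n --> \oo] --> C.
    by rewrite -(cvg_shiftS (fun n => s n%:R * F n%:R)) in sF.
  have h2 : s n%:R / s n.+1%:R * (s n.+1%:R * F n.+1%:R) @[n --> \oo] --> 1 * C.
    exact: cvgM.
  rewrite mul1r in h2; apply: cvg_trans h2; apply: near_eq_cvg.
  apply: nearW => n /=; have := s0 _ (ltr0Sn R n); set z := s n.+1%:R => z0.
  by rewrite /= mulrA divfK ?gt_eqF.
have up : s n.+1%:R * F n%:R @[n --> \oo] --> C.
  have h2 : (s n%:R / s n.+1%:R)^-1 * (s n%:R * F n%:R) @[n --> \oo] --> 1^-1 * C.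
    by apply: cvgM => //; apply: cvgV => //; exact: oner_neq0.
  rewrite invr1 mul1r in h2; apply: cvg_trans h2; apply: near_eq_cvg; near=> n.
  have n0 : 0 < s n%:R by apply: s0; rewrite ltr0n; near: n; exact: nbhs_infty_gt.
  by rewrite /= invf_div mulrA divfK// gt_eqF.
have tr (u : nat -> R) : u n @[n --> \oo] --> C ->
    u (Num.truncn (x : R)) @[x --> +oo] --> C.
  by move=> hu; apply: cvg_comp hu; exact: cvg_truncn.
have trC (u : nat -> R) : u n @[n --> \oo] --> C ->
    u (Num.truncn (x : R)) * C^-1 @[x --> +oo] --> (1 : R).
  move=> /tr hu; rewrite -(@divff _ C) ?gt_eqF//.
  by apply: cvgM => //; exact: cvg_cst.
rewrite /asymp_equiv; have up' := trC _ up; have lo' := trC _ lo.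
apply: squeeze_cvgr lo' up'; near=> x.
have x0 : 0 < x by near: x; exact: nbhs_pinfty_gt.
have sn : 0 < s (Num.truncn x)%:R.
  by apply: s0; rewrite ltr0n truncn_gt0; near: x; exact: nbhs_pinfty_ge.
have /andP[n1 n2] := truncn_itv (ltW x0); set n := Num.truncn x in n1 n2 sn *.
rewrite invfM invrK (mulrC C^-1) mulrA !ler_pM2r ?invr_gt0// (mulrC (F x)).
by apply/andP; split; apply: ler_pM; rewrite ?F0 ?sle ?Fle ?(ltW sn) ?(ltW (s0 _ x0)) ?(ltW n2) ?(ltW x0).
Unshelve. all: by end_near.
Qed.

(** This yields the pointwise bound of W^p by 1 plus the sum of (m + 1)^K over the m with W > m; the
    relevant m is the last integer strictly below x. *)
Lemma powR_le_steps (R : realType) (x p : R) (K : nat) : 0 < p -> p <= K%:R ->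
  x `^ p <= 1 \/ exists m : nat, m%:R < x /\ x `^ p <= m.+1%:R ^+ K.
Proof.
move=> p0 pK; have [x0|x0] := ltP 0 x; last first.
  (* By convention the power is 0 at 0 and 1 at negative arguments. *)
  left; rewrite /powR; case: eqP => [_|/eqP x0']; first by rewrite gt_eqF.
  by rewrite ln0 ?mulr0 ?expR0.
right; have [m mx xm] : exists2 m : nat, m%:R < x & x <= m.+1%:R.
  have /andP[n1 n2] := truncn_itv (ltW x0).
  move: n1 n2; case: (Num.truncn x) => [|n] n1 n2; first by exists 0%N; rewrite ?ltW.
  have [nx|nx] := ltP n.+1%:R x; first by exists n.+1; rewrite ?ltW.
  by exists n => //; apply: lt_le_trans n1; rewrite ltr_nat.
exists m; split=> //; rewrite -powR_mulrn//.
apply: (@le_trans _ _ (m.+1%:R `^ p)).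
  by apply: ge0_ler_powR => //; rewrite ?nnegrE ltW.
by apply: ler_powR => //; rewrite ler1n.
Qed.

Lemma sum_inv_square_le (R : realType) n :
  \sum_(0 <= m < n) (m.+1%:R ^+ 2)^-1 <= 2 :> R.
Proof.
(* The sharper bound 2 - 2/(n + 1) can be proved by induction. *)
suff : \sum_(0 <= m < n) (m.+1%:R ^+ 2)^-1 <= 2 - 2 / n.+1%:R :> R.
  by move/le_trans; apply; rewrite gerBl divr_ge0.
elim: n => [|n IH]; first by rewrite big_nil divr1 subrr.
rewrite big_nat_recr//=; apply: (le_trans (lerD IH (lexx _))).
have n0 : 0 <= n%:R :> R by [].
rewrite -![n.+2%:R]natr1 -![n.+1%:R]natr1; move: n%:R n0 => x x0.
have E : 2 - 2 / (x + 1 + 1) - (2 - 2 / (x + 1) + ((x + 1) ^+ 2)^-1) =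
    x / ((x + 1) ^+ 2 * (x + 1 + 1)) by field; lra.
by rewrite -subr_ge0 E divr_ge0// mulr_ge0 ?sqr_ge0//; lra.
Qed.

(** With K an integer above p, the tail bound of order K + 2 leaves C / (m + 1)^2 after
    multiplication by (m + 1)^K, which is summable. *)
Lemma expectation_powR_lt_pinfty d (T : measurableType d) (R : realType) (P : probability T R)
    (W : {RV P >-> R}) (p : R) : 0 < p ->
  (forall k, exists C, forall n, n.+1%:R ^+ k.+1 * fine (P [set w | n%:R < W w]) <= C) ->
  ('E_P[(fun w => W w `^ p)%R] < +oo)%E.
Proof.
move=> p0 tail; pose K := (Num.truncn p).+1.
have pK : p <= K%:R by exact/ltW/truncnS_gt.
have [C HC] := tail K.+1.
pose A m := [set w | m%:R < W w].
have mA m : measurable (A m) by exact: measurable_tail.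
pose f m w : \bar R := ((m.+1%:R ^+ K)%:E * (\1_(A m) w)%:E)%E.
have f0 m w : (0 <= f m w)%E by rewrite /f -EFinM lee_fin mulr_ge0.
have mf m : measurable_fun setT (f m).
  apply: measurable_funeM; apply/measurable_EFinP; exact: measurable_indic.
have msum : measurable_fun setT (fun w => \big[+%E/0%E]_(0 <= m <oo) f m w).
  exact: (@ge0_emeasurable_sum _ _ _ _ _ predT).
have C0 : 0 <= C by apply: le_trans (HC 0%N); rewrite mulr_ge0 ?fine_ge0.
rewrite unlock; apply: (@le_lt_trans _ _ (\int[P]_w (1 + \big[+%E/0%E]_(0 <= m <oo) f m w))%E).
  apply: ge0_le_integral => //.
  - by move=> w _; rewrite lee_fin powR_ge0.
  - apply/measurable_EFinP.
    by apply: (measurableT_comp (measurable_powR p)).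
  - exact: emeasurable_funD.
  - move=> w _; have s0 : (0 <= \big[+%E/0%E]_(0 <= m <oo) f m w)%E by exact: nneseries_ge0.
    have [h|[m [mw h]]] := powR_le_steps (W w) p0 pK.
      by apply: (@le_trans _ _ 1%E); rewrite ?lee_fin// leeDl.
    apply: (@le_trans _ _ (\big[+%E/0%E]_(0 <= m <oo) f m w)); last by rewrite leeDr.
    apply: le_trans (nneseries_lim_ge m.+1 _) => //.
    rewrite big_nat_recr//=; apply: (@le_trans _ _ (f m w)); last by rewrite leeDr// sume_ge0.
    by rewrite /f indicE mem_set// mule1 lee_fin.
rewrite ge0_integralD//; last by move=> w _; exact: nneseries_ge0.
rewrite (_ : (\int[P]_w 1 = 1)%E); last first.
  rewrite (integral_cst P measurableT 1) mul1e; exact: probability_setT.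
rewrite integral_nneseries//.
apply: lte_add_pinfty; first by rewrite ltry.
apply: (@le_lt_trans _ _ (C * 2)%:E); last by rewrite ltry.
apply: lime_le; first by apply: is_cvg_nneseries => m _ _; exact: integral_ge0.
apply: nearW => n.
rewrite (eq_bigr (fun m => (m.+1%:R ^+ K * fine (P (A m)))%:E)).
  rewrite sumEFin lee_fin; apply: le_trans (ler_wpM2l C0 (sum_inv_square_le R n)).
  rewrite mulr_sumr; apply: ler_sum => m _.
  rewrite ler_pdivlMr ?exprn_gt0//; apply: le_trans (HC m).
  by rewrite mulrAC -exprD addn2.
move=> m _; rewrite /f ge0_integralZl_EFin//.
- by rewrite integral_indic// setIT EFinM fineK// fin_num_measure.
- by apply/measurable_EFinP; exact: measurable_indic.
Qed.

Theorem proposition2 (R : realType) (d : measure_display)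
    (T : measurableType d) (P : probability T R) (beta alpha : R)
    (Z : node -> {RV P >-> nat}) (X W : node -> {RV P >-> R}) (t0 : R)
    (hbeta : 0 < beta <= 1 / 2) (halpha : 0 < alpha < 1)
    (hZX : runoff_environment beta alpha Z X)
    (hW : {ae P, forall w : T,
      is_runoff (fun u => Z u w) (fun u => X u w) (fun u => W u w)})
    (ht0 : 0 <= t0 <= 1)
    (ht0_max : forall t : R, 0 <= t <= 1 -> h beta alpha t <= h beta alpha t0) :
  [/\ alpha = alpha_c beta ->
        asymp_equiv (fun x : R => fine (P [set w | x < W [::] w]))
          (fun x : R =>
            Num.sqrt (- derive1n 2 (h beta alpha) 1 * (1 - alpha) / (8 * pi))
            * x `^ (- (3 / 2))),
      alpha_c beta < alpha ->
        asymp_equiv (fun x : R => fine (P [set w | x < W [::] w]))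
          (fun x : R =>
            Num.sqrt ((h beta alpha t0 - h beta alpha 1) * (1 - alpha) / pi)
            * x `^ (- (1 / 2)))
    & alpha < alpha_c beta ->
        forall p : R, 0 < p -> ('E_P[(fun w => W [::] w `^ p)%R] < +oo)%E].
Proof.
have [c [y te]] := runoff_root_tail_equation hbeta halpha hZX hW.
have [al0 al1] := andP halpha; have [_ _ /andP[b0 b4]] := alpha_c_facts hbeta.
have mW := measurable_tail (W [::]).
have F0 (x : R) : 0 <= fine (P [set w | x < W [::] w]) by exact: fine_ge0.
have Fle (x x' : R) : x <= x' ->
    fine (P [set w | x' < W [::] w]) <= fine (P [set w | x < W [::] w]).
  by move=> xx; apply: le_fine_prob => // w /=; exact: le_lt_trans.
have rt := @sqrt_ratio_cvg1 R.
split=> alc; last first.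
- move=> p p0; apply: expectation_powR_lt_pinfty => // k.
  exact: (tail_subcritical hbeta te ht0 ht0_max alc).
- have E : (fun x : R => Num.sqrt ((h beta alpha t0 - h beta alpha 1) * (1 - alpha) / pi) *
      x `^ (- (1 / 2))) = fun x =>
      Num.sqrt ((h beta alpha t0 - h beta alpha 1) * (1 - alpha) / pi) * (x `^ (1 / 2))^-1.
    by apply/funext => x; rewrite powRN.
  have pw n : n%:R `^ (1 / 2) = Num.sqrt n%:R :> R by rewrite div1r powR12_sqrt.
  rewrite E; apply: asymp_equiv_tail => //.
  + rewrite sqrtr_gt0 divr_gt0 ?pi_gt0// mulr_gt0 ?subr_gt0//.
    have [t tt] := h_lt_supercritical hbeta halpha alc; move=> /lt_le_trans; apply.
    by apply: ht0_max; lra.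
  + by move=> x x0; exact: powR_gt0.
  + move=> x x' x0 xx; apply: ge0_ler_powR => //; rewrite ?nnegrE//.
    exact: le_trans xx.
  + by under eq_fun do rewrite !pw.
  + under eq_fun do rewrite pw.
    exact: (tail_supercritical hbeta te ht0 ht0_max alc).
- set C := Num.sqrt _.
  have C0 : 0 < C.
    have alc' : alpha <= alpha_c beta by rewrite alc.
    have [k0 _] := le_alpha_c hbeta alc'.
    rewrite sqrtr_gt0 (derive2_h hbeta halpha) opprK divr_gt0// mulr_gt0 ?pi_gt0//; last by lra.
    by rewrite divr_gt0 ?exprn_gt0// mulr_gt0// mulr_gt0.
  have -> : (fun x : R => C * x `^ (- (3 / 2))) = fun x => C * (x `^ (3 / 2))^-1.
    by apply/funext => x; rewrite powRN.
  have pw n : n%:R `^ (3 / 2) = n%:R * Num.sqrt n%:R :> R.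
    rewrite -powR12_sqrt// (_ : 3 / 2 = 1 + 2^-1); last by field.
    by rewrite powRD ?powRr1//; apply/implyP => /eqP; lra.
  apply: asymp_equiv_tail => //.
  + by move=> x x0; exact: powR_gt0.
  + move=> x x' x0 xx; apply: ge0_ler_powR => //; rewrite ?nnegrE//.
    exact: le_trans xx.
  + have r2 : (Num.sqrt n%:R / Num.sqrt n.+1%:R) ^+ 3 @[n --> \oo] --> (1 : R) ^+ 3.
      exact: (continuous_cvg _ (@exprn_continuous R 3 _)).
    rewrite expr1n in r2; apply: cvg_trans r2; apply: near_eq_cvg; apply: nearW => n.
    have sq (m : nat) : m%:R * Num.sqrt m%:R = Num.sqrt m%:R ^+ 3 :> R.
      by rewrite exprSr sqr_sqrtr.
    by rewrite /= !pw !sq expr_div_n.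
  + under eq_fun do rewrite pw.
    exact: (tail_critical hbeta te ht0 ht0_max alc).
Qed.
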